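(* Let $u\in H\mathbb{W}^{s,G}(\Omega)\cap L^g_s(\mathbb{H}^n)$ be a weak solution of $\mathcal{L}u=0$ in $\Omega$ that is locally bounded in $\Omega$. Then $u$ is locally of class $C^{0,\alpha}(\Omega)$ for some $\alpha\in(0,1)$ determined only by $n,p,q,s$. More precisely, for any ball $B_R(\xi_0)\subset\subset\Omega$ there exists a constant $C>1$, depending only on $n,p,q,s$, such that for every $r\in(0,R]$ $$ \operatorname*{osc}_{B_r(\xi_0)}u\le C\left(\frac rR\right)^\alpha\left[\sup_{B_R(\xi_0)}|u|+R^sg^{-1}\left(R^s\,\mathrm{Tail}(u;\xi_0,R)\right)\right]. $$
   Context: $\mathbb{H}^n$ ($n\ge1$) is the Heisenberg group: $\mathbb{R}^{2n+1}$ with $\xi\circ\eta=(x_1+y_1,\dots,x_{2n}+y_{2n},\tau+\tau'+\frac12\sum_{i=1}^n(x_iy_{n+i}-x_{n+i}y_i))$ for $\xi=(x_1,\dots,x_{2n},\tau)$, $\eta=(y_1,\dots,y_{2n},\tau')$; homogeneous norm $|\xi|_{\mathbb{H}^n}=\big((\sum_{i=1}^{2n}x_i^2)^2+\tau^2\big)^{1/4}$; balls $B_r(\xi_0)=\{\xi:|\xi_0^{-1}\circ\xi|_{\mathbb{H}^n}<r\}$; $Q=2n+2$; $d\xi$ is Lebesgue measure on $\mathbb{R}^{2n+1}$. $\Omega\subset\mathbb{H}^n$ is a bounded domain, $s\in(0,1)$, and $\subset\subset$ means compactly contained. $\operatorname{osc}_Eu=\sup_Eu-\inf_Eu$. Suprema,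 infima, oscillations and regularity are understood up to null sets. The function $g:[0,\infty)\to[0,\infty)$ is continuous and strictly increasing with $g(0)=0$, $\lim_{t\to\infty}g(t)=\infty$, and $G(t)=\int_0^tg(\tau)\,d\tau$ satisfies $1<p\le \frac{tg(t)}{G(t)}\le q<\infty$ for $t>0$. $g^{-1}$ is the inverse function of $g$. Equation: $\mathcal{L}u(\xi)=\mathrm{P.V.}\int_{\mathbb{H}^n}g\Big(\frac{|u(\xi)-u(\eta)|}{|\eta^{-1}\circ\xi|^s_{\mathbb{H}^n}}\Big)\frac{u(\xi)-u(\eta)}{|u(\xi)-u(\eta)|}\frac{d\eta}{|\eta^{-1}\circ\xi|^{Q+s}_{\mathbb{H}^n}}=0$ in $\Omega$ (the integrand is $0$ where $u(\xi)=u(\eta)$). Spaces: $L^G(\Omega)=\{u \text{ measurable on }\Omega:\int_\Omega G(|u|)\,d\xi<\infty\}$. With $\mathcal{C}_\Omega=(\Omega\times\mathbb{H}^n)\cup(\mathbb{H}^n\times\Omega)$, $H\mathbb{W}^{s,G}(\Omega)$ is the set of measurable $u:\mathbb{H}^n\to\mathbb{R}$ with $u|_\Omega\in L^G(\Omega)$ and $\iint_{\mathcal{C}_\Omega}G\Big(\frac{|u(\xi)-u(\eta)|}{|\eta^{-1}\circ\xi|^s_{\mathbb{H}^n}}\Big)\frac{d\xi d\eta}{|\eta^{-1}\circ\xi|^Q_{\mathbb{H}^n}}<\infty$. $L^g_s(\mathbb{H}^n)$ is the set of measurable $u:\mathbb{H}^n\to\mathbb{R}$ with $\int_{\mathbb{H}^n}g\Big(\frac{|u(\xi)|}{(1+|\xi|_{\mathbb{H}^n})^s}\Big)\frac{d\xi}{(1+|\xi|_{\mathbb{H}^n})^{Q+s}}<\infty$.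 Weak solution: $u\in H\mathbb{W}^{s,G}(\Omega)$ is a weak solution if $$\iint_{\mathcal{C}_\Omega}g\Big(\frac{|u(\xi)-u(\eta)|}{|\eta^{-1}\circ\xi|^s_{\mathbb{H}^n}}\Big)\frac{u(\xi)-u(\eta)}{|u(\xi)-u(\eta)|}(\psi(\xi)-\psi(\eta))\frac{d\xi d\eta}{|\eta^{-1}\circ\xi|^{Q+s}_{\mathbb{H}^n}}=0$$ for every $\psi\in H\mathbb{W}^{s,G}(\Omega)$ with compact support in $\Omega$. Tail: $\mathrm{Tail}(u;\xi_0,r)=\int_{\mathbb{H}^n\setminus B_r(\xi_0)}g\Big(\frac{|u(\xi)|}{|\xi_0^{-1}\circ\xi|^s_{\mathbb{H}^n}}\Big)\frac{d\xi}{|\xi_0^{-1}\circ\xi|^{Q+s}_{\mathbb{H}^n}}$. *)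

(* Defs.v *)
From HB Require Import structures.
From mathcomp Require Import all_boot all_order all_algebra.
From mathcomp Require Import all_classical all_reals all_analysis.
From mathcomp Require Import ess_sup_inf.

Set Implicit Arguments.
Unset Strict Implicit.
Unset Printing Implicit Defensive.

Import Order.TTheory GRing.Theory Num.Theory.
Import numFieldNormedType.Exports.

Local Open Scope classical_set_scope.
Local Open Scope ring_scope.

(* The library equips 'rV[R]_m with its topology but not with a sigma-algebra;
   the one below is generated by the coordinates, that is, the Borel one. *)

Definition rV_display : measure_display.
Proof. exact: default_measure_display. Qed.

Section measurable_rV.
Context {R : realType} {m : nat}.

Let coord (i : 'I_m) (x : 'rV[R]_m) : measurableTypeR R := x ord0 i.

Let rV_set0 : g_sigma_preimage coord set0.
Proof. exact: sigma_algebra0. Qed.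

Let rV_setC A : g_sigma_preimage coord A -> g_sigma_preimage coord (~` A).
Proof. exact: sigma_algebraC. Qed.

Let rV_bigcup (F : (set 'rV[R]_m)^nat) :
  (forall i, g_sigma_preimage coord (F i)) ->
  g_sigma_preimage coord (\bigcup_i (F i)).
Proof. exact: sigma_algebra_bigcup. Qed.

HB.instance Definition _ := @isMeasurable.Build rV_display 'rV[R]_m
  (g_sigma_preimage coord) rV_set0 rV_setC rV_bigcup.

End measurable_rV.

(* The library has this fact, but its canonical instance for [m1 \x m2] is
   shadowed by the one for subprobabilities. *)
Lemma sigma_finite_product d1 d2 (T1 : measurableType d1)
    (T2 : measurableType d2) (R : realType)
    (m1 : {sigma_finite_measure set T1 -> \bar R})
    (m2 : {sigma_finite_measure set T2 -> \bar R}) :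
  sigma_finite setT (m1 \x m2)%E.
Proof.
have /sigma_finiteP[F [TF ndF Foo]] := sigma_finiteT m1.
have /sigma_finiteP[G [TG ndG Goo]] := sigma_finiteT m2.
exists (fun n => F n `*` G n).
  rewrite -setXTT TF TG predeqE => -[x y]; split.
    move=> [/= [n _ Fnx] [k _ Gky]]; exists (maxn n k) => //; split.
    - by move: x Fnx; exact/subsetPset/ndF/leq_maxl.
    - by move: y Gky; exact/subsetPset/ndG/leq_maxr.
  by move=> [n _ []/= ? ?]; split; exists n.
move=> k; have [? ?] := Foo k; have [? ?] := Goo k.
split; first exact: measurableX.
by rewrite product_measure1E// lte_mul_pinfty// ge0_fin_numE.
Qed.

Section lebesgue_rV.
Context {R : realType}.

Definition rV_cons m (z : measurableTypeR R * 'rV[R]_m) : 'rV[R]_m.+1 :=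
  \row_(i < m.+1) if unlift ord0 i is Some j then z.2 ord0 j else z.1.

Lemma measurable_rV_coord m (i : 'I_m) :
  measurable_fun [set: 'rV[R]_m]
    (fun x : 'rV[R]_m => x ord0 i : measurableTypeR R).
Proof.
move=> _ Y mY; rewrite setTI; apply: sub_sigma_algebra => /=.
rewrite -bigcup_seq/=; exists i => /=; first by rewrite mem_index_enum.
by exists Y => //; rewrite setTI.
Qed.

Lemma measurable_rV d (T : measurableType d) m (f : T -> 'rV[R]_m) :
  (forall i, measurable_fun setT (fun t => f t ord0 i : measurableTypeR R)) ->
  measurable_fun setT f.
Proof.
move=> mf _ A; rewrite setTI.
suff : measurable `<=` [set A : set 'rV[R]_m | measurable (f @^-1` A)] by apply.
apply: smallest_sub.
  split=> /= [|B mB|F mF].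
  - by rewrite preimage_set0.
  - by rewrite setTD preimage_setC; exact: measurableC.
  - by rewrite preimage_bigcup; exact: bigcup_measurable.
rewrite -bigcup_seq => B [i _ [Y mY <-]] /=; rewrite setTI -comp_preimage.
by rewrite -[X in measurable X]setTI; exact: mf.
Qed.

Lemma measurable_rV_cons m : measurable_fun setT (@rV_cons m).
Proof.
apply: measurable_rV => i; have [j ij|ij] := unliftP ord0 i.
- rewrite (_ : (fun t => _) =
      (fun x : 'rV[R]_m => x ord0 j : measurableTypeR R) \o snd).
    exact: (measurableT_comp (measurable_rV_coord j) measurable_snd).
  by apply/funext => z /=; rewrite mxE ij liftK.
- rewrite (_ : (fun t => _) = fst); first exact: measurable_fst.
  by apply/funext => z /=; rewrite mxE ij unlift_none.
Qed.

Definition lebesgue_rVS m (mu : {sigma_finite_measure set 'rV[R]_m -> \bar R})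
  : set 'rV[R]_m.+1 -> \bar R :=
  pushforward (lebesgue_measure \x mu)%E (@rV_cons m).

Section lebesgue_rVS_measure.
Context (m : nat) (mu : {sigma_finite_measure set 'rV[R]_m -> \bar R}).

Let nu : {measure set 'rV[R]_m.+1 -> \bar R} :=
  measure_function_pushforward__canonical__measure_function_Measure
    (lebesgue_measure \x mu)%E (@measurable_rV_cons m).

Let lebesgue_rVS0 : lebesgue_rVS mu set0 = 0%E.
Proof. exact: (measure0 nu). Qed.

Let lebesgue_rVS_ge0 A : (0 <= lebesgue_rVS mu A)%E.
Proof. exact: (measure_ge0 nu). Qed.

Let lebesgue_rVS_sigma_additive : semi_sigma_additive (lebesgue_rVS mu).
Proof. exact: (@measure_semi_sigma_additive _ _ _ nu). Qed.

HB.instance Definition _ := isMeasure.Build _ _ _ (lebesgue_rVS mu)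
  lebesgue_rVS0 lebesgue_rVS_ge0 lebesgue_rVS_sigma_additive.

Lemma sigma_finite_lebesgue_rVS : sigma_finite setT (lebesgue_rVS mu).
Proof.
pose uncons (x : 'rV[R]_m.+1) : measurableTypeR R * 'rV[R]_m :=
  (x ord0 ord0, \row_j x ord0 (lift ord0 j)).
have muncons : measurable_fun setT uncons.
  apply: measurable_fun_pair; first exact: measurable_rV_coord.
  apply: measurable_rV => i.
  rewrite (_ : (fun t => _) =
    fun x : 'rV[R]_m.+1 => x ord0 (lift ord0 i) : measurableTypeR R).
    exact: measurable_rV_coord.
  by apply/funext => x; rewrite mxE.
have consK : cancel (@rV_cons m) uncons.
  case=> z v; congr pair; first by rewrite mxE unlift_none.
  by apply/rowP => j; rewrite !mxE liftK.
have [F FT Foo] := sigma_finite_product (@lebesgue_measure R) mu.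
exists (fun k => uncons @^-1` F k).
  by rewrite -preimage_bigcup -FT preimage_setT.
move=> k; have [mF Fk] := Foo k; split.
  by rewrite -[X in measurable X]setTI; exact: muncons.
rewrite /lebesgue_rVS /pushforward -comp_preimage.
by rewrite (_ : uncons \o _ = idfun)//; apply/funext => z /=; exact: consK.
Qed.

HB.instance Definition _ := Measure_isSigmaFinite.Build _ _ _
  (lebesgue_rVS mu) sigma_finite_lebesgue_rVS.

End lebesgue_rVS_measure.

Fixpoint lebesgue_rV (m : nat) :
    {sigma_finite_measure set 'rV[R]_m -> \bar R} :=
  match m with
  | 0 => dirac (0 : 'rV[R]_0)
  | k.+1 => lebesgue_rVS (lebesgue_rV k)
  end.

End lebesgue_rV.

(* H^n = R^(2n+1), a point being written (x, tau) with x in R^(2n). *)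
Definition heis (R : realType) (n : nat) : Type :=
  ('rV[R]_(n + n) * measurableTypeR R)%type.

Section heisenberg.
Context {R : realType} {n : nat}.
Implicit Types (xi eta : heis R n) (r s : R).

Definition lebesgue_heis : set (heis R n) -> \bar R :=
  (lebesgue_rV (n + n) \x lebesgue_measure)%E.

HB.instance Definition _ := Measure.on lebesgue_heis.

HB.instance Definition _ := Measure_isSigmaFinite.Build _ _ _ lebesgue_heis
  (sigma_finite_product (lebesgue_rV (n + n)) lebesgue_measure).

Definition hmul xi eta : heis R n :=
  (xi.1 + eta.1,
   xi.2 + eta.2 + 2^-1 * \sum_(i < n)
     (xi.1 ord0 (lshift n i) * eta.1 ord0 (rshift n i)
      - xi.1 ord0 (rshift n i) * eta.1 ord0 (lshift n i))).

Definition hinv xi : heis R n := (- xi.1, - xi.2).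

Definition hnorm xi : R :=
  ((\sum_(i < n + n) xi.1 ord0 i ^+ 2) ^+ 2 + xi.2 ^+ 2) `^ (4^-1).

(* |eta^-1 o xi| *)
Definition hdist xi eta : R := hnorm (hmul (hinv eta) xi).

Definition hball xi0 r : set (heis R n) := [set xi | hdist xi xi0 < r].

Definition hdim : R := (2 * n + 2)%:R.

Definition bounded_domain (Omega : set (heis R n)) :=
  [/\ Omega !=set0, open Omega, connected Omega & bounded_set Omega].

Definition compactly_contained (A Omega : set (heis R n)) :=
  compact (closure A) /\ closure A `<=` Omega.

(* Lebesgue (not only Borel) measurability: the sigma-algebra of [heis R n] is
   the Borel one. The library integral of a nonnegative function is the
   supremum over simple functions below it, hence it takes the right value on
   Lebesgue measurable functions as well. *)
Definition lebesgue_measurable (u : heis R n -> R) :=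
  exists2 v : heis R n -> R, measurable_fun setT v &
    {ae lebesgue_heis, forall xi, u xi = v xi}.

Definition ess_sup_on (E : set (heis R n)) (u : heis R n -> R) : \bar R :=
  ess_sup lebesgue_heis (patch (fun=> -oo%E) E (EFin \o u)).

Definition ess_inf_on (E : set (heis R n)) (u : heis R n -> R) : \bar R :=
  ess_inf lebesgue_heis (patch (fun=> +oo%E) E (EFin \o u)).

Definition ess_osc (E : set (heis R n)) (u : heis R n -> R) : \bar R :=
  (ess_sup_on E u - ess_inf_on E u)%E.

Definition locally_bounded (Omega : set (heis R n)) (u : heis R n -> R) :=
  forall K, compact K -> K `<=` Omega ->
    exists M, {ae lebesgue_heis, forall xi, K xi -> `|u xi| <= M}.

Definition locally_hoelder (alpha : R) (Omega : set (heis R n))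
    (u : heis R n -> R) :=
  exists2 v : heis R n -> R,
    {ae lebesgue_heis, forall xi, Omega xi -> u xi = v xi} &
    forall K, compact K -> K `<=` Omega ->
      exists M, forall xi eta, K xi -> K eta ->
        `|v xi - v eta| <= M * hdist xi eta `^ alpha.

End heisenberg.

Section growth.
Context {R : realType}.
Implicit Types (g : R -> R) (p q t : R).

Definition primitive g t : R := Rintegral lebesgue_measure `[0, t] g.

(* g is only relevant on [0, +oo[. *)
Definition growth_function p q g :=
  [/\ {within `[0, +oo[, continuous g},
      {in `[0, +oo[ &, {homo g : x y / x < y}},
      g 0 = 0,
      g t @[t --> +oo] --> +oo &
      forall t, 0 < t ->
        p <= t * g t / primitive g t /\ t * g t / primitive g t <= q].

Definition growth_inv g : R -> R := 'pinv_(fun=> 0) `[0, +oo[ g.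

End growth.

Section equation.
Context {R : realType} {n : nat}.
Variables (s : R) (g : R -> R).
Local Notation H := (heis R n).
Local Notation mu := (@lebesgue_heis R n).
Local Notation Q := (@hdim R n).
Local Notation G := (primitive g).
Implicit Types (Omega : set H) (u psi : H -> R).

Definition cross_domain Omega : set (H * H) :=
  (Omega `*` setT) `|` (setT `*` Omega).

Definition HW Omega u :=
  [/\ lebesgue_measurable u,
      (\int[mu]_(xi in Omega) (G `|u xi|)%:E < +oo)%E &
      (\int[mu \x mu]_(z in cross_domain Omega)
        (G (`|u z.1 - u z.2| / hdist z.1 z.2 `^ s)
         / hdist z.1 z.2 `^ Q)%:E < +oo)%E].

Definition Lgs u :=
  lebesgue_measurable u /\
  (\int[mu]_xi (g (`|u xi| / (1 + hnorm xi) `^ s)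
                / (1 + hnorm xi) `^ (Q + s))%:E < +oo)%E.

Definition compact_support_in Omega psi :=
  compactly_contained [set xi | psi xi != 0] Omega.

Definition weak_solution Omega u :=
  HW Omega u /\
  forall psi, HW Omega psi -> compact_support_in Omega psi ->
    (\int[mu \x mu]_(z in cross_domain Omega)
      (g (`|u z.1 - u z.2| / hdist z.1 z.2 `^ s)
       * ((u z.1 - u z.2) / `|u z.1 - u z.2|)
       * (psi z.1 - psi z.2) / hdist z.1 z.2 `^ (Q + s))%:E = 0)%E.

Definition tail u (xi0 : H) (r : R) : \bar R :=
  (\int[mu]_(xi in ~` hball xi0 r)
    (g (`|u xi| / hdist xi xi0 `^ s) / hdist xi xi0 `^ (Q + s))%:E)%E.

End equation.

(* Main.v *)
(* The integral kernel only sees the homogeneous distance, which is a metric, and the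
   volume of its balls, which is comparable to r^Q; De Giorgi's argument is
   therefore run in an abstract Ahlfors regular space. Testing the equation with
   the truncation of u at height M above a level k, minus a barrier, controls not
   only the usual energy but also the interaction between {u > k + h} and the set
   where u lies far below k: such a pair at distance at most r contributes at
   least g(h / r^s) h / r^(Q + s). This nonlocal term replaces both the Sobolev
   inequality (a small ball around a point of the level set consists mostly of
   points outside the previous level set) and the logarithmic estimate (if u lies
   below its middle value on half of the ball, the set where u is close to its
   supremum is small). Hence the oscillation decreases by a fixed factor from one
   ball to a smaller concentric one, provided that the tail, which is controlled
   along the iteration, is small compared to g(osc / r^s). The continuous
   representative is the essential upper limit at each point. *)

Require Import Defs.
From mathcomp Require Import all_boot all_order all_algebra.
From mathcomp Require Import all_classical all_reals all_analysis.
From mathcomp Require Import ring lra measurable_realfun ess_sup_inf.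

Set Implicit Arguments.
Unset Strict Implicit.
Unset Printing Implicit Defensive.

Import Order.TTheory GRing.Theory Num.Theory.
Import numFieldNormedType.Exports.

Local Open Scope classical_set_scope.
Local Open Scope ring_scope.

(** * Growth functions *)

Section growth_functions.
Context {R : realType} {p q : R} {g : R -> R}.
Hypothesis gg : growth_function p q g.
Local Notation G := (primitive g).

(** The constants have to be the same for all [g] with given [p] and [q], so the oscillation
    estimates use [g] only through monotonicity, doubling, and [g (lam * t) <= eps * g t] for small
    [lam]; the last one rests on [1 < p] and drives the improvement of the upper bound. No
    superlinear recursion occurs: in the iteration the radii shrink like [2^(-j/s)] while the gaps
    between the levels shrink like [2^-j], so [g] is evaluated at the same argument at every step,
    and the bound [mu A_j <= c1 / 2 * r_j ^ Q] reproduces itself. The weak formulation is an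
    integral equal to 0, with no integrability given; this value alone forces the positive and
    negative parts to have equal finite integrals. At small scales the induction carries a pointwise
    bound growing like [(dist / r)^s] on the annulus between the current and the initial ball, so
    that only the exterior of the initial ball is paid by the given tail. *)

Lemma growth_homo (t u : R) : 0 <= t -> t <= u -> g t <= g u.
Proof.
move=> t0; rewrite le_eqVlt => /predU1P[->//|tu]; have [_ gi _ _ _] := gg.
by apply/ltW/gi => //; rewrite in_itv/= andbT// (le_trans t0)// ltW.
Qed.

Lemma growth_gt0 (t : R) : 0 < t -> 0 < g t.
Proof.
move=> t0; have [_ gi g0 _ _] := gg.
by rewrite -g0; apply: gi => //; rewrite in_itv/= andbT// ltW.
Qed.

Lemma growth_ge0 (t : R) : 0 <= t -> 0 <= g t.
Proof. by have [_ _ g0 _ _] := gg; rewrite -{2}g0; exact: growth_homo. Qed.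

Lemma growth_addE (t u : R) : 0 <= t -> 0 <= u -> g (t + u) <= g (2 * t) + g (2 * u).
Proof.
move=> t0 u0; have [tu|/ltW ut] := leP t u.
  by rewrite ler_wpDl ?growth_ge0 ?growth_homo ?mulr_ge0//; lra.
by rewrite ler_wpDr ?growth_ge0 ?growth_homo ?mulr_ge0//; lra.
Qed.

(** [g] is monotone on [[0, +oo[] only; composed with [Num.max 0] it becomes monotone on the whole
    line, hence measurable, and agrees with [g] on the values of [f]. *)
Lemma measurable_growth d (T : measurableType d) (D : set T) (f : T -> R) :
  (forall x, 0 <= f x) -> measurable_fun D f ->
  measurable_fun D (fun x => g (f x)).
Proof.
move=> f0 mf; rewrite (_ : (fun _ => _) = (fun t => g (Num.max 0 t)) \o f).
  apply: measurableT_comp => //; apply: nondecreasing_measurable => // x y xy.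
  by apply: growth_homo; [rewrite le_max lexx|rewrite ge_max !le_max lexx xy orbT].
by apply/funext => x /=; rewrite max_r.
Qed.

Lemma growth_integrable b :
  lebesgue_measure.-integrable `[0, b] (EFin \o g).
Proof.
apply: continuous_compact_integrable; first exact: segment_compact.
have [gc _ _ _ _] := gg; apply: continuous_subspaceW gc.
by move=> x /=; rewrite !in_itv/= andbT => /andP[].
Qed.

(** Replaces the differentiation of [G] in the growth estimates: [g] is monotone, so its integral
    over []t, u]] lies between those of its two end values. *)
Lemma primitiveB (t u : R) : 0 <= t -> t <= u ->
  (u - t) * g t <= G u - G t <= (u - t) * g u.
Proof.
move=> t0 tu; rewrite /primitive Rintegral_itvB ?bnd_simp//; last first.
  exact: growth_integrable.
pose D : set (measurableTypeR R) := `]t, u]%classic.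
have mD : measurable D by exact: measurable_itv.
have muD : lebesgue_measure D = (u - t)%:E.
  rewrite /D lebesgue_measure_itv/= lte_fin.
  by case: ltgtP tu => //= -> _; rewrite subrr.
have ig : lebesgue_measure.-integrable D (EFin \o g).
  apply: integrableS (growth_integrable u) => // x /=.
  by rewrite /D/= !in_itv/= => /andP[/ltW tx ->]; rewrite (le_trans t0 tx).
have cst_int (c : R) : \int[lebesgue_measure]_(x in D) c = (u - t) * c.
  by rewrite Rintegral_cst// mulrC; congr (_ * _); exact: (congr1 fine muD).
have icst (c : R) : lebesgue_measure.-integrable D (EFin \o cst c).
  apply/integrableP; split; first exact/measurable_EFinP/measurable_cst.
  by under eq_integral do rewrite /=; rewrite integral_cst//; apply: lte_mul_pinfty;
    rewrite ?lee_fin// [X in (X < _)%E]muD ltry.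
rewrite -(cst_int (g t)) -(cst_int (g u)); apply/andP; split.
  apply: (@le_Rintegral _ _ _ _ D) => //; first exact: (icst (g t)).
  by move=> x; rewrite /D/= in_itv/= => /andP[/ltW tx _]; exact: growth_homo.
apply: (@le_Rintegral _ _ _ _ D) => //; first exact: (icst (g u)).
move=> x; rewrite /D/= in_itv/= => /andP[/ltW tx xu].
by apply: growth_homo => //; exact: le_trans tx.
Qed.

Lemma primitive0 : G 0 = 0.
Proof. by rewrite /primitive set_itv1 Rintegral_set1. Qed.

Lemma primitive_homo (t u : R) : 0 <= t -> t <= u -> G t <= G u.
Proof.
move=> t0 tu; have /andP[+ _] := primitiveB t0 tu; apply: contraTT.
rewrite -!ltNge => Gut; apply: lt_le_trans (_ : 0 <= _).
  by rewrite subr_lt0.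
by rewrite mulr_ge0 ?subr_ge0 ?growth_ge0.
Qed.

Lemma primitive_ge0 (t : R) : 0 <= t -> 0 <= G t.
Proof. by move=> t0; rewrite -primitive0 primitive_homo. Qed.

Lemma primitive_le (t : R) : 0 <= t -> G t <= t * g t.
Proof.
by move=> t0; have /andP[_] := primitiveB (lexx 0) t0; rewrite primitive0 !subr0.
Qed.

Lemma primitive_gt0 (t : R) : 0 < t -> 0 < G t.
Proof.
move=> t0; have h : 0 <= t / 2 <= t by lra.
have /andP[h0 ht] := h.
have /andP[+ _] := primitiveB h0 ht; rewrite lerBrDr.
apply: lt_le_trans; rewrite ltr_pwDl ?primitive_ge0// mulr_gt0//; first lra.
by apply: growth_gt0; lra.
Qed.

Lemma growth_primitive (t : R) : 0 < t -> p * G t <= t * g t <= q * G t.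
Proof.
move=> t0; have [_ _ _ _ /(_ t t0)[pG Gq]] := gg; have G0 := primitive_gt0 t0.
by rewrite -ler_pdivlMr// pG -ler_pdivrMr.
Qed.

Lemma measurable_primitive d (T : measurableType d) (D : set T) (f : T -> R) :
  (forall x, 0 <= f x) -> measurable_fun D f ->
  measurable_fun D (fun x => G (f x)).
Proof.
move=> f0 mf; rewrite (_ : (fun _ => _) = (fun t => G (Num.max 0 t)) \o f).
  apply: measurableT_comp => //; apply: nondecreasing_measurable => // x y xy.
  apply: primitive_homo; first by rewrite le_max lexx.
  by rewrite ge_max !le_max lexx xy orbT.
by apply/funext => x /=; rewrite max_r.
Qed.

(** Surjectivity onto [[0, +oo[] comes from the intermediate value theorem and the divergence of
    [g]; it keeps [growth_inv] away from the default value 0 of the partial inverse. *)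
Lemma growth_invK (t : R) : 0 <= t -> g (growth_inv g t) = t /\ 0 <= growth_inv g t.
Proof.
move=> t0; have [gc gi g0 goo _] := gg.
have tg : t \in g @` `[0, +oo[.
  have [M [Mr tM]] : exists M, 0 <= M /\ t <= g M.
    move/cvgryPge: goo => /(_ t) [M [Mr MP]].
    exists (Num.max 0 (M + 1)); split; first by rewrite le_max lexx.
    by apply: MP; rewrite /= lt_max ltrDl ltr01 orbT.
  have gc' : {within `[0, M], continuous g}.
    apply: continuous_subspaceW gc => x /=.
    by rewrite !in_itv/= andbT => /andP[].
  have [] := @IVT R g 0 M t Mr gc'.
    by rewrite g0 min_l ?growth_ge0// max_r ?growth_ge0// t0.
  move=> c; rewrite in_itv/= => /andP[c0 _] gct.
  by rewrite inE; exists c => //=; rewrite in_itv/= c0.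
split; first by rewrite /growth_inv pinvK.
suff : `[0, +oo[%classic (growth_inv g t) by rewrite /= in_itv/= andbT.
apply: (@surjpinv_image_sub _ _ (fun=> 0) `[0, +oo[ (g @` `[0, +oo[) g) => //.
by exists t => //; rewrite -in_setE.
Qed.

End growth_functions.

Lemma bernoulli_le (R : realType) (x : R) k : 0 <= x ->
  1 + k%:R * x <= (1 + x) ^+ k.
Proof.
move=> x0; elim: k => [|k IH]; first by rewrite mul0r addr0 expr0.
rewrite exprS; apply: le_trans (_ : (1 + x) * (1 + k%:R * x) <= _).
  have : 0 <= k%:R * x * x by rewrite !mulr_ge0.
  by rewrite -natr1; lra.
by rewrite ler_wpM2l//; lra.
Qed.

Lemma bernoulli_unbounded (R : realType) (x y : R) : 0 < x ->
  exists k, y <= (1 + x) ^+ k.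
Proof.
move=> x0; exists (Num.truncn `|y / x|).+1; apply: le_trans (bernoulli_le _ (ltW x0)).
have : y / x <= (Num.truncn `|y / x|).+1%:R.
  by rewrite (le_trans (ler_norm _))// ltW// truncnS_gt.
by rewrite ler_pdivrMr//; lra.
Qed.

(** * Doubling and smallness of [g], with constants depending on [p] and [q] only *)

Section growth_scaling.
Context {R : realType} (p q : R).

(** A discrete form of integrating [G' / G <= q / t]: for [l = 1 + 1 / (2 q)] the increment
    [G (l u) - G u] is at most half of [G (l u)], so [G] at most doubles from [u] to [l u], and [m]
    such steps pass [2 u]. The bound for [g] follows from [t * g t <= q * G t] and
    [G t <= t * g t]. *)
Lemma growth_doubling : 1 < p -> exists2 D : R, 1 <= D &
  forall g, growth_function p q g -> forall t : R, 0 <= t ->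
    g (2 * t) <= D * g t /\ primitive g (2 * t) <= D * primitive g t.
Proof.
(* If [q < p], no [g] satisfies the growth condition at 1, and any constant works. *)
move=> p1; have [pq|qp] := leP p q; last first.
  exists 1 => // g gg; have [_ _ _ _ /(_ 1 ltr01)[]] := gg.
  by move=> /le_trans /[apply]; rewrite leNgt qp.
have q0 : 0 < q by lra.
have c0 : 0 < (2 * q)^-1 by rewrite invr_gt0; lra.
have [m m2] := bernoulli_unbounded 2 c0; set l := 1 + (2 * q)^-1 in m2.
have l1 : 1 <= l by rewrite /l; lra.
have m1 : 1 <= 2 ^+ m :> R by rewrite exprn_ege1//; lra.
exists (q * 2 ^+ m).
  by rewrite -[leLHS]mulr1 ler_pM//; lra.
move=> g gg t t0.
have Gl (u : R) : 0 <= u -> primitive g (l * u) <= 2 * primitive g u.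
  rewrite le_eqVlt => /predU1P[<-|u0].
    by rewrite mulr0 (primitive0); lra.
  have ul : u <= l * u by rewrite ler_peMl// ltW.
  have lu0 : 0 < l * u by rewrite mulr_gt0//; lra.
  have /andP[_ h1] := primitiveB gg (ltW u0) ul.
  have /andP[_ h2] := growth_primitive gg lu0.
  have e : l * u - u = (2 * q)^-1 * u by rewrite /l; ring.
  have glu := growth_ge0 gg (ltW lu0).
  have h3 : (2 * q)^-1 * u * g (l * u) <= (2 * q)^-1 * (q * primitive g (l * u)).
    rewrite -mulrA ler_wpM2l//; first by rewrite ltW.
    by apply: le_trans h2; rewrite ler_wpM2r.
  have e2 : (2 * q)^-1 * (q * primitive g (l * u)) = 2^-1 * primitive g (l * u).
    by field; rewrite gt_eqF.
  by move: h1 h3; rewrite e e2; lra.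
have Gm k (u : R) : 0 <= u -> primitive g (l ^+ k * u) <= 2 ^+ k * primitive g u.
  move=> u0; elim: k => [|k IH]; first by rewrite !expr0 !mul1r.
  rewrite exprS -mulrA (le_trans (Gl _ _))//.
    by rewrite mulr_ge0// exprn_ge0//; lra.
  by rewrite exprS -mulrA ler_wpM2l.
have G2 : primitive g (2 * t) <= 2 ^+ m * primitive g t.
  apply: le_trans (Gm m t t0); apply: (primitive_homo gg); first by rewrite mulr_ge0.
  by rewrite ler_wpM2r.
have Gt0 := primitive_ge0 gg t0.
split; last first.
  apply: (le_trans G2); rewrite ler_wpM2r// ler_peMl//; lra.
move: t0; rewrite le_eqVlt => /predU1P[<-|t0].
  by rewrite mulr0; have [_ _ -> _ _] := gg; rewrite mulr0.
have t20 : 0 < 2 * t by lra.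
have /andP[_ h1] := growth_primitive gg t20.
rewrite -(ler_pM2l t0).
have h2 : q * primitive g (2 * t) <= q * (2 ^+ m * primitive g t).
  by rewrite ler_wpM2l// ltW.
have h3 : q * (2 ^+ m * primitive g t) <= q * (2 ^+ m * (t * g t)).
  by rewrite !ler_wpM2l ?(primitive_le gg) ?ltW// exprn_gt0.
have h4 : 0 <= t * g (2 * t) by rewrite mulr_ge0 ?(growth_ge0 gg)// ltW.
rewrite (_ : t * (q * 2 ^+ m * g t) = q * (2 ^+ m * (t * g t))); last by ring.
by move: h1; rewrite -mulrA; lra.
Qed.

(** Halving the argument divides [G] by at least [1 + p], since [G u - G (u / 2)] is at least
    [u / 2 * g (u / 2)], hence at least [p * G (u / 2)]. Returning from [G] to [g] costs a factor
    [q] and one factor 2 per halving, so [k] halvings leave [q * (2 / (1 + p)) ^ k], which tends to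
    0 because [1 < p]. *)
Lemma growth_small (eps : R) : 1 < p -> 0 < eps -> exists2 lam : R, 0 < lam <= 1 &
  forall g, growth_function p q g -> forall t : R, 0 <= t -> g (lam * t) <= eps * g t.
Proof.
move=> p1 e0; have [pq|qp] := leP p q; last first.
  exists 1; first by lra.
  move=> g gg; have [_ _ _ _ /(_ 1 ltr01)[]] := gg.
  by move=> /le_trans /[apply]; rewrite leNgt qp.
have q0 : 0 < q by lra.
have c0 : 0 < (p - 1) / 2 by lra.
have [k] := bernoulli_unbounded (q / eps) c0.
rewrite (_ : 1 + _ = (1 + p) / 2); last by field.
rewrite ler_pdivrMr// => kq.
exists (2^-1 ^+ k); first by rewrite exprn_gt0//= exprn_ile1//; lra.
move=> g gg t; rewrite le_eqVlt => /predU1P[<-|t0].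
  by rewrite mulr0; have [_ _ -> _ _] := gg; rewrite mulr0.
have Gk m (u : R) : 0 < u -> (1 + p) ^+ m * primitive g (2^-1 ^+ m * u) <= primitive g u.
  elim: m u => [|m IH] u u0; first by rewrite !expr0 !mul1r.
  have -> : 2^-1 ^+ m.+1 * u = 2^-1 ^+ m * (u * 2^-1) by rewrite exprSr; ring.
  rewrite (exprSr (1 + p)).
  have h0 : 0 < u * 2^-1 by lra.
  have hle : u * 2^-1 <= u by lra.
  have /andP[h1 _] := primitiveB gg (ltW h0) hle.
  have /andP[h2 _] := growth_primitive gg h0.
  rewrite -mulrA mulrCA.
  apply: le_trans (_ : (1 + p) * primitive g (u * 2^-1) <= _); last first.
    by move: h1; rewrite (_ : u - u * 2^-1 = u * 2^-1); [lra|field].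
  by rewrite ler_pM2l ?IH//; lra.
set v := 2^-1 ^+ k; have v0 : 0 < v by rewrite exprn_gt0.
have vt0 : 0 < v * t by rewrite mulr_gt0.
have /andP[_ h1] := growth_primitive gg vt0.
have h2 := Gk k t t0; rewrite -/v in h2.
have pk0 : 0 < (1 + p) ^+ k by rewrite exprn_gt0//; lra.
have vt := primitive_le gg (ltW t0).
have gt0 := growth_ge0 gg (ltW t0).
rewrite -(ler_pM2l t0) -(ler_pM2l v0) -(ler_pM2l pk0).
have e1 : (1 + p) ^+ k * v = ((1 + p) / 2) ^+ k by rewrite /v -exprMn.
have h3 : (1 + p) ^+ k * (v * t * g (v * t)) <= q * (t * g t).
  apply: le_trans (_ : (1 + p) ^+ k * (q * primitive g (v * t)) <= _).
    by rewrite ler_pM2l.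
  by rewrite mulrCA ler_pM2l// (le_trans h2).
rewrite mulrA in h3; rewrite -(mulrA v) in h3.
rewrite mulrA in h3.
rewrite mulrA; rewrite -2!mulrA (mulrA (_ ^+ k)) e1 in h3 *.
rewrite (_ : _ * (v * _) = ((1 + p) / 2) ^+ k * eps * (t * g t)); last first.
  by rewrite -e1; ring.
by apply: (le_trans h3); rewrite ler_wpM2r// mulr_ge0// ltW.
Qed.

End growth_scaling.

Import HBNNSimple.

(** * Integrals compared almost everywhere *)

Section integral_without_measurability.
Context d (T : measurableType d) (R : realType) (mu : {measure set T -> \bar R}).
Local Open Scope ereal_scope.

(* The integral of a nonnegative function is a supremum over the simple
   functions below it; no measurability is needed. *)
Lemma ae_le_integral (D : set T) (f g : T -> \bar R) :
  (forall x, D x -> 0 <= f x) -> (forall x, D x -> 0 <= g x) ->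
  {ae mu, forall x, D x -> f x <= g x} ->
  \int[mu]_(x in D) f x <= \int[mu]_(x in D) g x.
Proof.
move=> f0 g0 [N [mN N0 fgN]]; rewrite integral_mkcond [leRHS]integral_mkcond.
have f'0 x : 0 <= (f \_ D) x by rewrite patchE; case: ifPn => // /set_mem/f0.
have g'0 x : 0 <= (g \_ D) x by rewrite patchE; case: ifPn => // /set_mem/g0.
rewrite !ge0_integralTE//; apply: ge_ereal_sup => _ [h hf <-].
(* The simple function is cut off on a measurable null set containing the exceptional points; its
   integral does not change. *)
pose h' := proj_nnsfun h (measurableC mN).
apply: ereal_sup_ubound; exists h' => [x|].
  rewrite -mrestrict patchE; case: ifPn => [|_]; last exact: g'0.
  rewrite inE/= => Nx; apply: (le_trans (hf x)); rewrite !patchE.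
  case: ifPn => // /set_mem Dx; apply: contrapT => fgx; apply/Nx/fgN => /=.
  by move=> /(_ Dx).
rewrite -!integralT_nnsfun; apply: ge0_ae_eq_integral => //.
- exact: measurableT_comp.
- exact: measurableT_comp.
- by move=> x _; rewrite lee_fin.
- by move=> x _; rewrite lee_fin.
- exists N; split => // x /= xN; apply: contrapT => Nx; apply: xN => _.
  by rewrite /= mindicE mem_set// mulr1.
Qed.

Lemma ae_eq_integral_gen (D : set T) (f g : T -> \bar R) :
  {ae mu, forall x, D x -> f x = g x} ->
  \int[mu]_(x in D) f x = \int[mu]_(x in D) g x.
Proof.
move=> fg; rewrite [LHS]integralE [RHS]integralE.
by congr (_ - _); apply/eqP; rewrite eq_le; apply/andP; split;
  apply: ae_le_integral => //; apply: filterS fg => x fgx Dx;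
  rewrite ?funeposE ?funenegE fgx.
Qed.

(** The hypothesis gives the value of the integral of [f], not its integrability. This value is the
    difference of the integrals of the positive and negative parts; an infinite subtrahend would
    make it [-oo], so both are finite and equal. They cancel once the inequality, with the negative
    part of [f] moved to the left, has been integrated. *)
Lemma le_integral_of_eq0 (f G E : T -> R) :
  measurable_fun setT f -> measurable_fun setT G -> measurable_fun setT E ->
  (forall x, 0 <= G x)%R -> (forall x, 0 <= E x)%R ->
  \int[mu]_x (f x)%:E = 0 ->
  {ae mu, forall x, (G x <= f x + E x)%R} ->
  \int[mu]_x (G x)%:E <= \int[mu]_x (E x)%:E.
Proof.
move=> mf mG mE G0 E0; rewrite integralE.
have mfp : measurable_fun setT (EFin \o f)^\+.
  exact/measurable_funepos/measurable_EFinP.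
have mfn : measurable_fun setT (EFin \o f)^\-.
  exact/measurable_funeneg/measurable_EFinP.
set P := \int[mu]_x _; set N := \int[mu]_x _.
have P0 : 0 <= P by exact: integral_ge0.
have N0 : 0 <= N by exact: integral_ge0.
move=> PN GfE.
have Nfin : N \is a fin_num.
  rewrite ge0_fin_numE// ltey; apply/eqP => Noo; move: PN.
  by rewrite Noo addeNy.
have PNE : P = N by rewrite -[LHS](@subeK _ _ _ Nfin) PN add0e.
rewrite -(leeD2rE _ _ Nfin) [leRHS]addeC -{2}PNE /P /N.
have mG' : measurable_fun setT (EFin \o G) by exact/measurable_EFinP.
have mE' : measurable_fun setT (EFin \o E) by exact/measurable_EFinP.
rewrite -[leLHS]ge0_integralD => [||x _||x _|]//=; [|by rewrite lee_fin].
rewrite -[leRHS]ge0_integralD => [||x _||x _|]//=; [|by rewrite lee_fin].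
apply: ae_le_integral => [x _|x _|].
- by rewrite adde_ge0// lee_fin.
- by rewrite adde_ge0// lee_fin.
apply: filterS GfE => x + _; rewrite funeposE funenegE /= -EFin_max -EFin_max.
rewrite -!EFinD lee_fin; have := G0 x; have := E0 x.
by rewrite /Num.max; case: ltP => ?; case: ltP => ?; lra.
Qed.

End integral_without_measurability.

Section product_almost_everywhere.
Context d (T : measurableType d) (R : realType).
Context (mu : {sigma_finite_measure set T -> \bar R}).

Lemma ae_product (P : T -> Prop) : {ae mu, forall x, P x} ->
  {ae (mu \x mu)%E, forall z, P z.1 /\ P z.2}.
Proof.
move=> [N [mN N0 PN]].
exists ((N `*` setT) `|` (setT `*` N)); split.
- by apply: measurableU; apply: measurableX.
- apply/eqP; rewrite -measure_le0; apply: le_trans (measureU2 _ _ _) _.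
  + exact: measurableX.
  + exact: measurableX.
  have NT : ((mu \x mu)%E (N `*` setT) <= 0)%E
    by rewrite product_measure1E// [X in (X * _)%E](_ : _ = 0%E) ?mul0e.
  have TN : ((mu \x mu)%E (setT `*` N) <= 0)%E
    by rewrite product_measure1E// [X in (_ * X)%E](_ : _ = 0%E) ?mule0.
  rewrite -[0%E]adde0; exact: (leeD NT TN).
- move=> z /= nP; apply: contrapT => /not_orP[nl nr]; apply: nP; split.
    by apply: contrapT => h; apply: nl; split => //; exact: PN.
  by apply: contrapT => h; apply: nr; split => //; exact: PN.
Qed.

End product_almost_everywhere.

Section measurable_comparisons.
Context d (T : measurableType d) (R : realType).
Implicit Types f h : T -> R.

Lemma measurable_set_lt f h : measurable_fun setT f -> measurable_fun setT h ->
  measurable [set x | f x < h x].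
Proof.
move=> mf mh; have := measurable_fun_ltr mf mh measurableT (_ : measurable [set true]).
rewrite setTI => /(_ I); exact.
Qed.

Lemma measurable_set_le f h : measurable_fun setT f -> measurable_fun setT h ->
  measurable [set x | f x <= h x].
Proof.
move=> mf mh; have := measurable_fun_ler mf mh measurableT (_ : measurable [set true]).
rewrite setTI => /(_ I); exact.
Qed.

End measurable_comparisons.

(** The product is negative only when [u1 < u2], and then [|u1 - u2| <= c]. For pairs with one point
    outside the ball, [c] will be the positive part of the excess of the far value over the
    level. *)
Lemma signed_mul_lower (R : realType) (F : R -> R) (u1 u2 c t : R) :
  (forall x : R, 0 <= x -> 0 <= F x) ->
  (forall x y : R, 0 <= x -> x <= y -> F x <= F y) ->
  0 <= t -> 0 <= c -> u2 - u1 <= c ->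
  - (F c * t) <= F `|u1 - u2| * ((u1 - u2) / `|u1 - u2|) * t.
Proof.
move=> F0 Fm t0 c0 uc.
have [u12|u12|->] := ltgtP u1 u2; last first.
- by rewrite subrr mul0r mulr0 mul0r oppr_le0 mulr_ge0// F0.
- rewrite gtr0_norm ?subr_gt0// divff ?subr_eq0 ?gt_eqF// mulr1.
  apply: (@le_trans _ _ 0); first by rewrite oppr_le0 mulr_ge0// F0.
  by rewrite mulr_ge0// F0// subr_ge0 ltW.
rewrite ltr0_norm ?subr_lt0// invrN mulrN divff ?subr_eq0 ?lt_eqF//.
rewrite mulrN1 mulNr lerN2 ler_wpM2r// Fm//; lra.
Qed.

(* [a] is [u] minus a barrier that varies by [e]; testing with the positive
   part of [a] only loses [F |e| |e|]. *)
Lemma barrier_pair_lower (R : realType) (F : R -> R) (u1 u2 a1 a2 e : R) :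
  (forall x : R, 0 <= x -> 0 <= F x) ->
  (forall x y : R, 0 <= x -> x <= y -> F x <= F y) ->
  u1 - u2 = a1 - a2 + e ->
  F (`|a1 - a2| / 2) * `|Num.max 0 a1 - Num.max 0 a2| - 3 * (F `|e| * `|e|) <=
  F `|u1 - u2| * ((u1 - u2) / `|u1 - u2|) * (Num.max 0 a1 - Num.max 0 a2).
Proof.
move=> F0 Fm.
wlog a12 : u1 u2 a1 a2 e / a2 <= a1 => [hwlog ue|].
  have [a21|/ltW a12] := leP a2 a1; first exact: hwlog.
  have := hwlog u2 u1 a2 a1 (- e) a12.
  rewrite normrN (distrC a2 a1) (distrC (Num.max 0 a2)) (distrC u2 u1).
  have -> : u2 - u1 = - (u1 - u2) by ring.
  have -> : Num.max 0 a2 - Num.max 0 a1 = - (Num.max 0 a1 - Num.max 0 a2) by ring.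
  by rewrite mulrN mulNr mulrN mulNr opprK; apply; rewrite ue; ring.
move=> ue; set t := Num.max 0 a1 - Num.max 0 a2.
have t0 : 0 <= t by rewrite subr_ge0 ge_max !le_max lexx a12 orbT.
have ta : t <= a1 - a2.
  by rewrite /t /Num.max; case: ltP => ?; case: ltP => ?; lra.
have a0 : 0 <= a1 - a2 by lra.
rewrite (ger0_norm t0) (ger0_norm a0).
have e0 : 0 <= `|e| by [].
have ee : - `|e| <= e by rewrite lerNnormlW.
have Fe0 : 0 <= F `|e| * `|e| by rewrite mulr_ge0 ?F0.
(* Either the barrier varies by at most half of [a1 - a2], and then [u1 - u2] is at least
   [(a1 - a2) / 2]; or the coercive term itself is at most [2 * F |e| * |e|], while the right-hand
   side is at least [- F |e| * |e|]. Together these give the factor 3. *)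
have [big|small] := leP (2 * `|e|) (a1 - a2).
  have [t_eq0|tn0] := eqVneq t 0.
    by rewrite t_eq0 !mulr0; lra.
  have w0 : 0 < u1 - u2.
    have : 0 < t by rewrite lt_neqAle eq_sym tn0.
    lra.
  rewrite (gtr0_norm w0) divff ?gt_eqF// mulr1.
  rewrite lerBlDr ler_wpDr//; first lra.
  by rewrite ler_wpM2r// Fm//; lra.
have h1 : F ((a1 - a2) / 2) * t <= F `|e| * (2 * `|e|).
  by rewrite ler_pM// ?F0//; [lra|rewrite Fm//; lra|lra].
apply: le_trans (_ : - (F `|e| * Num.min t `|e|) <= _); last first.
  have [te|et] := leP t `|e|; first by apply: signed_mul_lower => //; lra.
  have w0 : 0 <= u1 - u2 by lra.
  apply: (@le_trans _ _ 0); first by rewrite oppr_le0 mulr_ge0// F0.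
  move: w0; rewrite le_eqVlt => /predU1P[<-|w0]; first by rewrite mul0r mulr0 mul0r.
  by rewrite mulr_ge0// mulr_ge0 ?F0 ?normr_ge0 ?divr_ge0// ltW.
have h2 : F `|e| * Num.min t `|e| <= F `|e| * `|e|.
  by rewrite ler_wpM2l ?F0// ge_min lexx orbT.
lra.
Qed.

(** * De Giorgi's method in an Ahlfors regular space *)

Section indicator.
Context {T : Type} {R : realType}.
Implicit Types (A : set T) (x : T).

Lemma indic_in A x : A x -> \1_A x = 1 :> R.
Proof. by move=> Ax; rewrite indicE mem_set. Qed.

Lemma indic_notin A x : ~ A x -> \1_A x = 0 :> R.
Proof. by move=> Ax; rewrite indicE memNset. Qed.

End indicator.

Section powR_complements.
Context {R : realType}.
Implicit Types a r s x y : R.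

Lemma le_powR r x y : 0 <= r -> 0 <= x -> x <= y -> x `^ r <= y `^ r.
Proof.
move=> r0 x0 xy; apply: ge0_ler_powR => //; rewrite nnegrE//.
exact: le_trans xy.
Qed.

Lemma powR_exprn x r k : 0 <= x -> (x ^+ k) `^ r = (x `^ r) ^+ k.
Proof. by move=> x0; rewrite -[x ^+ k]powR_mulrn// powRAC powR_mulrn// powR_ge0. Qed.

Lemma powR_scale a x r s : 0 < a -> 0 < x ->
  (a * x) `^ r / x `^ (r + s) = a `^ r / x `^ s.
Proof.
move=> a0 x0; rewrite powRM ?ltW// powRD ?(gt_eqF x0) ?implybT//.
by field; rewrite !gt_eqF ?powR_gt0.
Qed.

Lemma powR_lt1 x r : 0 < x < 1 -> 0 < r -> x `^ r < 1.
Proof.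
move=> /andP[x0 x1] r0; rewrite (_ : 1 = 1 `^ r); last by rewrite powR1.
by apply: gt0_ltr_powR; rewrite ?nnegrE// ltW.
Qed.

Lemma dyadic_scale x : 0 < x -> exists k : nat,
  (2 ^+ k <= x < 2 ^+ k.+1) \/ (2^-1 ^+ k.+1 <= x < 2^-1 ^+ k).
Proof.
move=> x0; have two_gt0 k : 0 < 2 ^+ k :> R by rewrite exprn_gt0.
have half_k k : 2^-1 ^+ k = (2 ^+ k)^-1 :> R by rewrite exprVn.
have [x1|x1] := leP 1 x.
  have [k0 xk0] := bernoulli_unbounded (x + 1) (@ltr01 R).
  have exk : exists k, x < 2 ^+ k.
    by exists k0; rewrite (lt_le_trans _ xk0)// ltrDl.
  case: (ex_minnP exk) => -[|k] xk mink; first by rewrite expr0 ltNge x1 in xk.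
  exists k; left; rewrite xk andbT leNgt; apply/negP => /mink.
  by rewrite ltnn.
have [k0 xk0] := bernoulli_unbounded x^-1 (@ltr01 R).
have exk : exists k, 2^-1 ^+ k <= x.
  exists k0; rewrite half_k -[leRHS]invrK lef_pV2 ?posrE ?invr_gt0//.
case: (ex_minnP exk) => -[|k] xk mink; first by rewrite expr0 leNgt x1 in xk.
exists k; right; rewrite xk/= ltNge; apply/negP => /mink.
by rewrite ltnn.
Qed.

End powR_complements.

Section ahlfors_regular.
Context d (T : measurableType d) (R : realType).
Context (mu : {sigma_finite_measure set T -> \bar R}) (dist : T -> T -> R).
Context (Q c1 c2 s : R).
Context (mdist : measurable_fun setT (fun z : T * T => dist z.1 z.2)).
Context (dist_ge0 : forall x y, 0 <= dist x y).
Context (dist_eq0 : forall x y, dist x y = 0 -> x = y).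
Context (distC : forall x y, dist x y = dist y x).
Context (distD : forall x y z, dist x z <= dist x y + dist y z).
Context (Q_gt0 : 0 < Q) (s_gt0 : 0 < s) (s_lt1 : s < 1).
Context (c1_gt0 : 0 < c1) (c2_gt0 : 0 < c2).

Local Notation B x r := [set y | dist y x < r].

Context (vol_ge : forall x (r : R), 0 < r -> ((c1 * r `^ Q)%:E <= mu (B x r))%E).
Context (vol_le : forall x (r : R), 0 < r -> (mu (B x r) <= (c2 * r `^ Q)%:E)%E).

Let mfst : measurable_fun setT (@fst T T) := measurable_fst.
Let msnd : measurable_fun setT (@snd T T) := measurable_snd.

(* [lra] fails if a section hypothesis is missing from the context; the facts
   it needs have to be in the goal. *)
Ltac drop_context := clear -mdist dist_ge0 dist_eq0 distC distD Q_gt0 s_gt0 s_lt1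
  c1_gt0 c2_gt0 vol_ge vol_le mfst msnd.
Ltac order_lra := drop_context; lra.

Lemma measurable_distl x : measurable_fun setT (fun y => dist y x).
Proof. exact: (measurable_fun_pair1 _ mdist). Qed.

Lemma measurable_distball x r : measurable (B x r).
Proof.
rewrite -[X in measurable X]setTI (_ : B x r = (dist^~ x) @^-1` `]-oo, r[).
  exact: measurable_distl.
by apply/seteqP; split => y /=; rewrite in_itv.
Qed.

(** The kernel times the largest variation, between [x] and [y], of a function with range in
    [[0, 1]] and slope at most [1 / r]; barrier errors are integrated in this form. *)
Definition kern x r y := Num.min 1 (dist y x / r) / dist y x `^ (Q + s).

Lemma kern_ge0 x r y : 0 <= r -> 0 <= kern x r y.
Proof.
by move=> r0; rewrite divr_ge0 ?powR_ge0// le_min ler01/= divr_ge0.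
Qed.

Lemma measurable_kern x r : measurable_fun setT (kern x r).
Proof.
apply: measurable_funM.
  apply: measurable_minr => //.
  by apply: measurable_funM => //; exact: measurable_distl.
rewrite (_ : (fun _ => _) = (fun t => t `^ (- (Q + s))) \o dist^~ x).
  by apply: measurableT_comp; [exact: measurable_powR|exact: measurable_distl].
by apply/funext => y /=; rewrite powRN.
Qed.

(* Dyadic annuli around [x]; the truncation [dist / r] compensates [s] near
   the diagonal because [s < 1]. *)
Lemma integral_kern : exists2 CK : R, 0 < CK & forall x (r : R), 0 < r ->
  (\int[mu]_y (kern x r y)%:E <= (CK / r `^ s)%:E)%E.
Proof.
have s0 := s_gt0; have s1 := s_lt1; have c20 := c2_gt0.
(* Up to the factor [c2 * 2 ^ Q / r ^ s], the annulus at distance about [2^k r] contributes at most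
   [2^(-k s)], and the one at distance about [2^-k r] at most [2 * 2^(-(k + 1) (1 - s))]. Both are
   bounded geometrically with ratio [th], and 1 + 2 is the factor 3 in [C0]. *)
pose th : R := Num.max (2^-1 `^ s) (2^-1 `^ (1 - s)).
have th0 : 0 < th by rewrite lt_max powR_gt0.
have th1 : th < 1
  by rewrite gt_max !powR_lt1 ?subr_gt0 ?invr_gt0 ?invf_lt1 ?ltr1n ?ltr0n//.
pose C0 : R := 3 * c2 * 2 `^ Q.
have C00 : 0 < C0 by rewrite !mulr_gt0 ?powR_gt0.
exists (C0 / (1 - th)); first by rewrite divr_gt0// subr_gt0.
move=> x r r0; have rs0 : 0 < r `^ s by rewrite powR_gt0.
pose w (k : nat) : R := ((2 ^+ k * r) `^ (Q + s))^-1.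
pose w' (k : nat) : R := 2^-1 ^+ k / (2^-1 ^+ k.+1 * r) `^ (Q + s).
have w0 k : 0 <= w k by rewrite invr_ge0 powR_ge0.
have w'0 k : 0 <= w' k by rewrite divr_ge0 ?powR_ge0// exprn_ge0.
pose F (k : nat) y : \bar R := ((w k)%:E * (\1_(B x (2 ^+ k.+1 * r)) y)%:E
  + (w' k)%:E * (\1_(B x (2^-1 ^+ k * r)) y)%:E)%E.
have F0 k y : (0 <= F k y)%E by rewrite /F -!EFinM -EFinD lee_fin addr_ge0// mulr_ge0.
have mI rr : measurable_fun setT (fun y => (\1_(B x rr) y)%:E : \bar R).
  by apply/measurable_EFinP/measurable_indic/measurable_distball.
have mF k : measurable_fun setT (F k).
  by apply: emeasurable_funD; apply: emeasurable_funM.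
apply: le_trans (_ : (\int[mu]_y \sum_(0 <= k <oo) F k y <= _)%E).
  apply: ae_le_integral => [y _|y _|].
  - by rewrite lee_fin kern_ge0 ?ltW.
  - exact: nneseries_ge0.
  apply: aeW => y _.
  have [dy0|] := eqVneq (dist y x) 0.
    by rewrite /kern dy0 mul0r min_r// mul0r nneseries_ge0.
  rewrite eq_le dist_ge0 andbT -ltNge => dy0.
  have dr0 : 0 < dist y x / r by rewrite divr_gt0.
  have [k hk] := dyadic_scale dr0.
  apply: le_trans (_ : (F k y <= _)%E); last first.
    rewrite (nneseriesD1 _ (n := k))// leeDl// nneseries_ge0//.
  rewrite /F -!EFinM -EFinD lee_fin.
  have Qs : 0 <= Q + s by rewrite addr_ge0// ltW.
  case: hk => /andP[].
    rewrite ler_pdivlMr// ltr_pdivrMr// => h1 h2.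
    rewrite (@indic_in _ _ (B x (2 ^+ k.+1 * r)))// mulr1; apply: le_trans (_ : w k <= _); last by rewrite lerDl mulr_ge0.
    rewrite /kern /w -[leRHS]mul1r ler_pM ?invr_ge0 ?powR_ge0//.
    - by rewrite le_min ler01/= ltW.
    - by rewrite ge_min lexx.
    rewrite lef_pV2 ?posrE ?powR_gt0 ?mulr_gt0 ?exprn_gt0//.
    by apply: le_powR => //; rewrite mulr_ge0 ?exprn_ge0 ?ltW.
  rewrite ler_pdivlMr// => h1 h2.
  have h3 := h2; rewrite ltr_pdivrMr// in h3.
  rewrite (@indic_in _ _ (B x (2^-1 ^+ k * r)))// mulr1; apply: le_trans (_ : w' k <= _); last by rewrite lerDr mulr_ge0.
  rewrite /kern /w' ler_pM ?invr_ge0 ?powR_ge0//.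
  - by rewrite le_min ler01/= ltW.
  - by rewrite ge_min (ltW h2) orbT.
  rewrite lef_pV2 ?posrE ?powR_gt0 ?mulr_gt0 ?exprn_gt0//.
  by apply: le_powR => //; rewrite mulr_ge0 ?exprn_ge0 ?ltW.
rewrite integral_nneseries//.
apply: lime_le; first by apply: is_cvg_nneseries => k _ _; exact: integral_ge0.
apply: nearW => n.
have intF k : (\int[mu]_y F k y <= (C0 / r `^ s * th ^+ k)%:E)%E.
  rewrite /F ge0_integralD//; last 4 first.
  - by move=> y _; rewrite -EFinM lee_fin mulr_ge0.
  - exact: emeasurable_funM.
  - by move=> y _; rewrite -EFinM lee_fin mulr_ge0.
  - exact: emeasurable_funM.
  rewrite !ge0_integralZl_EFin//; try by move=> y _; rewrite lee_fin.
  rewrite !integral_indic ?setIT//; try exact: measurable_distball.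
  have p1 : 0 < 2 ^+ k * r by rewrite mulr_gt0// exprn_gt0.
  have p2 : 0 < 2^-1 ^+ k.+1 * r by rewrite mulr_gt0// exprn_gt0.
  apply: le_trans (_ : ((w k)%:E * (c2 * (2 ^+ k.+1 * r) `^ Q)%:E +
    (w' k)%:E * (c2 * (2^-1 ^+ k * r) `^ Q)%:E <= _)%E).
    by apply: leeD; apply: lee_wpmul2l; rewrite ?lee_fin//;
      apply: vol_le; rewrite mulr_gt0// exprn_gt0.
  rewrite -!EFinM -EFinD lee_fin.
  have -> : w k * (c2 * (2 ^+ k.+1 * r) `^ Q) = c2 * 2 `^ Q / r `^ s * (2^-1 `^ s) ^+ k.
    have half_s : 2^-1 `^ s = (2 `^ s)^-1 by rewrite -powR_inv1// powRAC powR_inv1 ?powR_ge0.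
    rewrite /w exprS -(mulrA 2) [LHS](_ : _ = c2 * ((2 * (2 ^+ k * r)) `^ Q /
      (2 ^+ k * r) `^ (Q + s))); last by ring.
    rewrite powR_scale//.
    rewrite powRM ?exprn_ge0 ?ltW// powR_exprn// half_s exprVn; field.
    by rewrite !gt_eqF ?exprn_gt0 ?powR_gt0.
  have -> : w' k * (c2 * (2^-1 ^+ k * r) `^ Q) =
      2 * c2 * 2 `^ Q / r `^ s * (2^-1 `^ (1 - s)) ^+ k.+1.
    have -> : 2^-1 ^+ k * r = 2 * (2^-1 ^+ k.+1 * r) by rewrite exprS; field.
    have h0 : 0 < 2^-1 ^+ k.+1 :> R by rewrite exprn_gt0.
    rewrite /w' [LHS](_ : _ = c2 * ((2 * (2^-1 ^+ k.+1 * r)) `^ Q /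
      (2^-1 ^+ k.+1 * r) `^ (Q + s)) * 2^-1 ^+ k); last by ring.
    rewrite powR_scale// -powR_exprn//.
    rewrite powRB ?(gt_eqF h0) ?implybT// powRr1 ?ltW//.
    have -> : 2^-1 ^+ k = 2 * 2^-1 ^+ k.+1 :> R by rewrite exprS; field.
    move: (2^-1 ^+ k.+1) h0 => z z0.
    rewrite powRM ?(ltW z0) ?(ltW r0)//; field.
    by rewrite !gt_eqF ?powR_gt0.
  have t1 : (2^-1 `^ s) ^+ k <= th ^+ k.
    by rewrite lerXn2r ?nnegrE ?powR_ge0 ?(ltW th0)// le_max lexx.
  have t2 : (2^-1 `^ (1 - s)) ^+ k.+1 <= th ^+ k.
    apply: le_trans (_ : th ^+ k.+1 <= _).
      by rewrite lerXn2r ?nnegrE ?powR_ge0 ?(ltW th0)// le_max lexx orbT.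
    by rewrite exprS ler_piMl ?exprn_ge0 ?(ltW th0) ?(ltW th1).
  have D0 : 0 <= c2 * 2 `^ Q / r `^ s.
    by rewrite divr_ge0 ?mulr_ge0 ?powR_ge0 ?ltW.
  have -> : C0 / r `^ s * th ^+ k = c2 * 2 `^ Q / r `^ s * (th ^+ k + 2 * th ^+ k).
    by rewrite /C0; ring.
  rewrite (_ : 2 * c2 * 2 `^ Q / r `^ s * _ =
    c2 * 2 `^ Q / r `^ s * (2 * (2^-1 `^ (1 - s)) ^+ k.+1)); last by ring.
  by rewrite -mulrDr ler_wpM2l// lerD// ler_wpM2l.
apply: le_trans (_ : (\sum_(0 <= k < n) (C0 / r `^ s * th ^+ k)%:E <= _)%E).
  by apply: lee_sum => k _; exact: intF.
rewrite sumEFin lee_fin.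
have := @geometric_le_lim R n (C0 / r `^ s) th.
rewrite /series/= => /(_ _ th0) h; apply: le_trans (h _ _) _.
- by rewrite divr_ge0 ?ltW.
- by rewrite gtr0_norm.
- by rewrite mulrAC.
Qed.

(** * Barrier, truncated test functions and level sets *)

Definition barrier x0 rho x : R :=
  Num.min 1 (Num.max 0 (4 * dist x x0 / rho - 1)).

Lemma barrier_ge0 x0 rho x : 0 <= barrier x0 rho x.
Proof. by rewrite le_min ler01 le_max lexx. Qed.

Lemma barrier_le1 x0 rho x : barrier x0 rho x <= 1.
Proof. by rewrite ge_min lexx. Qed.

Lemma barrier1 x0 rho x : 0 < rho -> rho / 2 <= dist x x0 -> barrier x0 rho x = 1.
Proof.
move=> rho0 h; apply/min_l; rewrite le_max; apply/orP; right.
by rewrite lerBrDr ler_pdivlMr//; lra.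
Qed.

Lemma barrier0 x0 rho x : 0 < rho -> dist x x0 <= rho / 4 -> barrier x0 rho x = 0.
Proof.
move=> rho0 h; rewrite /barrier max_l ?min_r//.
by rewrite subr_le0 ler_pdivrMr//; lra.
Qed.

Lemma barrier_lip x0 rho x y : 0 < rho ->
  `|barrier x0 rho x - barrier x0 rho y| <= Num.min 1 (dist y x / (rho / 4)).
Proof.
move=> rho0.
wlog : x y / barrier x0 rho y <= barrier x0 rho x => [hw|yx].
  have [|/ltW] := leP (barrier x0 rho y) (barrier x0 rho x); first exact: hw.
  by move=> /hw; rewrite distrC (distC x y).
rewrite ger0_norm ?subr_ge0// le_min; apply/andP; split.
  by have := barrier_ge0 x0 rho y; have := barrier_le1 x0 rho x; lra.
have := distD x y x0; rewrite (distC x y) => h.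
have h4 : 4 * dist x x0 / rho - 4 * dist y x0 / rho <= dist y x / (rho / 4).
  rewrite -mulrBl invf_div mulrA ler_pM2r ?invr_gt0//; move: h; order_lra.
have h0 : 0 <= dist y x / (rho / 4) by rewrite divr_ge0// divr_ge0// ltW.
move: h4 h0; rewrite /barrier; move: (_ / (rho / 4)) => t.
move: (4 * dist x x0 / rho) (4 * dist y x0 / rho) => X Y; drop_context => h4 h0.
rewrite /Num.max; case: (ltP 0 (X - 1)) => ?; case: (ltP 0 (Y - 1)) => ?;
  by rewrite /Num.min; do 2 case: ltP => ?; lra.
Qed.

Lemma measurable_barrier x0 rho : measurable_fun setT (barrier x0 rho).
Proof.
apply: measurable_minr => //; apply: measurable_maxr => //.
apply: measurable_funB => //; apply: measurable_funM => //.
by apply: measurable_funM => //; exact: measurable_distl.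
Qed.

(** Inside the ball of radius [rho], where [u <= k + M] will be assumed, this is the positive part
    of [u - k - M * barrier]. The truncation at [k + M] acts far away: the barrier is 1 beyond
    [rho / 2], so the function vanishes there however large [u] is. *)
Definition level_test (u : T -> R) x0 rho k M x : R :=
  Num.max 0 (Num.min (u x) (k + M) - k - M * barrier x0 rho x).

(** The distance condition does not follow from the first one, as [u] may exceed [k + M] far
    away. *)
Definition level_set (u : T -> R) x0 rho k M : set T :=
  [set x | k + M * barrier x0 rho x < u x /\ dist x x0 < rho / 2].

Lemma measurable_level_test u x0 rho k M : measurable_fun setT u ->
  measurable_fun setT (level_test u x0 rho k M).
Proof.
move=> mu_; apply: measurable_maxr => //; apply: measurable_funB.
  by apply: measurable_funB => //; exact: measurable_minr.
by apply: measurable_funM => //; exact: measurable_barrier.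
Qed.

Lemma level_test_ge0 u x0 rho k M x : 0 <= level_test u x0 rho k M x.
Proof. by rewrite le_max lexx. Qed.

Lemma level_test_le u x0 rho k M x : 0 <= M -> level_test u x0 rho k M x <= M.
Proof.
move=> M0; rewrite ge_max M0/=.
have : 0 <= M * barrier x0 rho x by rewrite mulr_ge0// barrier_ge0.
have : Num.min (u x) (k + M) <= k + M by rewrite ge_min lexx orbT.
order_lra.
Qed.

Lemma level_test_eq0 u x0 rho k M x : 0 < rho -> 0 <= M ->
  ~ level_set u x0 rho k M x -> level_test u x0 rho k M x = 0.
Proof.
move=> rho0 M0 /not_andP[|] /negP; rewrite -leNgt => h; apply/max_l.
  have : Num.min (u x) (k + M) <= u x by rewrite ge_min lexx.
  by move: h; order_lra.
rewrite barrier1//.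
have : Num.min (u x) (k + M) <= k + M by rewrite ge_min lexx orbT.
by order_lra.
Qed.

Lemma measurable_level_set u x0 rho k M : measurable_fun setT u ->
  measurable (level_set u x0 rho k M).
Proof.
move=> mu_; apply: measurableI; last exact: measurable_distball.
apply: measurable_set_lt => //; apply: measurable_funD => //.
by apply: measurable_funM => //; exact: measurable_barrier.
Qed.

(** * The energy estimate on level sets *)

Definition weak_integrand (g : R -> R) (u psi : T -> R) (z : T * T) : R :=
  g (`|u z.1 - u z.2| / dist z.1 z.2 `^ s)
  * ((u z.1 - u z.2) / `|u z.1 - u z.2|)
  * (psi z.1 - psi z.2) / dist z.1 z.2 `^ (Q + s).

Definition tail_integrand (g : R -> R) (u : T -> R) k x y : R :=
  g (Num.max 0 (u y - k) / dist y x `^ s) / dist y x `^ (Q + s).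

(** The barrier varies by at most [min 1 (d / (rho / 4))], and a number in [[0, 1]] is at most its
    power [s], because [s < 1]. So [|e| / d ^ s] is at most [4 * M / rho ^ s] at every positive
    distance [d], and the remaining factor [|e|] supplies the truncation in [kern]. *)
Lemma growth_barrier p q g x0 (rho M : R) x y : growth_function p q g ->
  0 < rho -> 0 <= M ->
  forall e, e = M * barrier x0 rho x - M * barrier x0 rho y ->
  g (`|e| / dist y x `^ s) / dist y x `^ (Q + s) * `|e| <=
  g (4 * M / rho `^ s) * M * kern x (rho / 4) y.
Proof.
move=> gg rho0 M0 e eE; have s0 := s_gt0; have s1 := s_lt1.
have rho40 : 0 < rho / 4 by rewrite divr_gt0.
have eM : `|e| <= M * Num.min 1 (dist y x / (rho / 4)).
  by rewrite eE -mulrBr normrM ger0_norm// ler_wpM2l// barrier_lip.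
have rs : (rho / 4) `^ s >= rho `^ s / 4.
  rewrite powRM ?invr_ge0 ?(ltW rho0)// ler_wpM2l ?powR_ge0//.
  by apply: ger1_powR; lra.
have [d0|] := eqVneq (dist y x) 0.
  have : `|e| <= 0 by rewrite (le_trans eM)// d0 mul0r min_r// mulr0.
  rewrite normr_le0 => /eqP ->; rewrite normr0 mulr0.
  rewrite mulr_ge0 ?kern_ge0 ?(ltW rho40)// mulr_ge0// (growth_ge0 gg)//.
  by rewrite divr_ge0 ?powR_ge0// mulr_ge0.
rewrite eq_le dist_ge0 andbT -ltNge => d0.
have ds0 : 0 < dist y x `^ s by rewrite powR_gt0.
have gle : g (`|e| / dist y x `^ s) <= g (4 * M / rho `^ s).
  apply: (growth_homo gg); first by rewrite divr_ge0 ?powR_ge0.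
  rewrite ler_pdivrMr//; apply: (le_trans eM).
  rewrite [leRHS](_ : _ = M * (dist y x `^ s / (rho `^ s / 4))); last first.
    by rewrite invf_div; ring.
  rewrite ler_wpM2l//.
  have [dr|rd] := leP (rho / 4) (dist y x).
    rewrite ge_min; apply/orP; left.
    rewrite ler_pdivlMr ?divr_gt0 ?powR_gt0// mul1r (le_trans rs)//.
    by rewrite le_powR// ltW.
  rewrite ge_min; apply/orP; right.
  have dr1 : 0 < dist y x / (rho / 4) <= 1.
    by rewrite divr_gt0//= ler_pdivrMr// mul1r ltW.
  apply: le_trans (_ : (dist y x / (rho / 4)) `^ s <= _).
    by apply: ger1_powR; [|exact: ltW].
  rewrite powRM ?invr_ge0 ?(ltW rho40) ?(ltW d0)//.
  rewrite -powR_inv1 ?(ltW rho40)// powRAC powR_inv1 ?powR_ge0//.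
  by rewrite ler_wpM2l ?powR_ge0// lef_pV2 ?posrE ?divr_gt0 ?powR_gt0.
rewrite /kern.
rewrite [leLHS](_ : _ = g (`|e| / dist y x `^ s) * `|e| / dist y x `^ (Q + s)); last by ring.
rewrite mulrA ler_wpM2r ?invr_ge0 ?powR_ge0// -mulrA.
rewrite ler_pM//; first by rewrite (growth_ge0 gg)// divr_ge0// ltW.
Qed.

(** With [D = 0], and under the essential bound [u <= k + M], this is the complement of the level
    set in the ball up to a null set, as used in the iteration; a large [D] selects the points far
    below, as used in the improvement of the upper bound. *)
Definition sublevel_set (u : T -> R) x0 rho k M D : set T :=
  [set y | dist y x0 < rho /\ u y <= k + M * barrier x0 rho y - D].

(** The error charged to a point [x] of the level set: the barrier loss, with the factor 3 of
    [barrier_pair_lower], and the interaction with points outside the ball, where the test function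
    at [x] is at most [M]. Adding the same with [x] and [y] exchanged covers all pairs. *)
Definition pair_error g u x0 rho k M x y : R :=
  \1_(level_set u x0 rho k M) x *
  (3 * (g (4 * M / rho `^ s) * M) * kern x (rho / 4) y
   + M * (\1_(~` B x0 rho) y * tail_integrand g u k x y)).

(* Weak formulation integrand of a pair of points, bounded below by a coercive
   term on [level_set (k + h) x Z] up to the barrier and the tail. *)
Lemma weak_integrand_lower p q g (u : T -> R) x0 (rho k M h D r : R) x y :
  growth_function p q g -> 0 < rho -> 0 < M -> 0 < h -> 0 <= D -> 0 < r ->
  (dist x x0 < rho -> u x <= k + M) -> (dist y x0 < rho -> u y <= k + M) ->
  g ((h + D) / (2 * r `^ s)) / r `^ (Q + s) * h *
    (\1_(level_set u x0 rho (k + h) M) x *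
     (\1_(sublevel_set u x0 rho k M D) y * \1_(B x r) y)) <=
  weak_integrand g u (level_test u x0 rho k M) (x, y) +
  (pair_error g u x0 rho k M x y + pair_error g u x0 rho k M y x).
Proof.
move=> gg rho0 M0 h0 D0 r0 ux uy.
set psi := level_test u x0 rho k M; set A := level_set u x0 rho k M.
set A' := level_set u x0 rho (k + h) M; set Z := sublevel_set _ _ _ _ _ _.
set err := pair_error g u x0 rho k M.
have rho40 : 0 <= rho / 4 by rewrite divr_ge0// ltW.
have gM0 : 0 <= 3 * (g (4 * M / rho `^ s) * M).
  by rewrite !mulr_ge0 ?(growth_ge0 gg) ?divr_ge0 ?mulr_ge0 ?powR_ge0 ?(ltW M0).
have t0 v w : 0 <= tail_integrand g u k v w.
  rewrite /tail_integrand divr_ge0 ?powR_ge0// (growth_ge0 gg)//.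
  by rewrite divr_ge0 ?powR_ge0// le_max lexx.
have err0 v w : 0 <= err v w.
  rewrite /err /pair_error mulr_ge0//; apply: addr_ge0.
    by rewrite mulr_ge0// kern_ge0.
  by rewrite mulr_ge0 ?(ltW M0)// mulr_ge0.
have A'A v : A' v -> A v by move=> [uv vx0]; split => //; move: uv h0; order_lra.
have AB v : A v -> dist v x0 < rho by move=> [_ /lt_trans]; apply; move: rho0; order_lra.
have psi0 v : ~ A v -> psi v = 0 by apply: level_test_eq0 => //; exact: ltW.
have good0 : ~ (A' x /\ Z y) -> g ((h + D) / (2 * r `^ s)) / r `^ (Q + s) * h *
    (\1_A' x * (\1_Z y * \1_(B x r) y)) = 0.
  move=> /not_andP[] hn; first by rewrite (indic_notin hn) mul0r mulr0.
  by rewrite (indic_notin hn) mul0r !mulr0.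
have W0 : psi x = psi y -> weak_integrand g u psi (x, y) = 0.
  by move=> e; rewrite /weak_integrand/= e subrr mulr0 mul0r.
have [nAA|nnA] := pselect (~ A x /\ ~ A y).
  case: nAA => nx ny; rewrite good0; last by case=> /A'A.
  by rewrite W0 ?psi0// add0r addr_ge0.
pose F (t : R) := g (t / dist y x `^ s) / dist y x `^ (Q + s).
have F0 (t : R) : 0 <= t -> 0 <= F t.
  by move=> t_ge0; rewrite divr_ge0 ?powR_ge0// (growth_ge0 gg)// divr_ge0 ?powR_ge0.
have Fm (t t' : R) : 0 <= t -> t <= t' -> F t <= F t'.
  move=> t_ge0 tt'; rewrite ler_wpM2r ?invr_ge0 ?powR_ge0//.
  by rewrite (growth_homo gg) ?divr_ge0 ?powR_ge0// ler_wpM2r ?invr_ge0 ?powR_ge0.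
have WE : weak_integrand g u psi (x, y) =
    F `|u x - u y| * ((u x - u y) / `|u x - u y|) * (psi x - psi y).
  by rewrite /weak_integrand/= /F (distC x y); ring.
(* With both points in the ball the barrier estimate applies. With one outside, the test function
   vanishes there and only the tail is lost. Both outside is impossible, since one of the points
   lies in the level set. *)
have [Bx|nBx] := ltP (dist x x0) rho; have [By|nBy] := ltP (dist y x0) rho.
- pose a v := u v - k - M * barrier x0 rho v.
  pose e := M * barrier x0 rho x - M * barrier x0 rho y.
  have psia v : (dist v x0 < rho -> u v <= k + M) -> dist v x0 < rho ->
      psi v = Num.max 0 (a v).
    by move=> uv Bv; rewrite /psi /level_test min_l// uv.
  have := @barrier_pair_lower R F (u x) (u y) (a x) (a y) e F0 Fm.
  rewrite -(psia x)// -(psia y)// -WE => /(_ _)h1.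
  have {}h1 := h1 (ltac:(rewrite /a /e; ring)).
  have h2 : F `|e| * `|e| <= g (4 * M / rho `^ s) * M * kern x (rho / 4) y.
    exact: (growth_barrier gg rho0 (ltW M0)).
  have h3 : 3 * (g (4 * M / rho `^ s) * M) * kern x (rho / 4) y <= err x y + err y x.
    have kC : kern x (rho / 4) y = kern y (rho / 4) x by rewrite /kern distC.
    have [Ax|nAx] := pselect (A x).
      apply: le_trans (_ : err x y <= _); last by rewrite lerDl.
      by rewrite /err /pair_error (indic_in Ax) mul1r lerDl mulr_ge0 ?(ltW M0)// mulr_ge0.
    have Ay : A y by apply: contrapT => nAy; apply: nnA.
    apply: le_trans (_ : err y x <= _); last by rewrite lerDr.
    by rewrite /err /pair_error (indic_in Ay) mul1r kC lerDl mulr_ge0 ?(ltW M0)// mulr_ge0.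
  suff h4 : g ((h + D) / (2 * r `^ s)) / r `^ (Q + s) * h *
    (\1_A' x * (\1_Z y * \1_(B x r) y)) <= F (`|a x - a y| / 2) * `|psi x - psi y|.
    by move: h1 h2 h3 h4; order_lra.
  have Fpsi : 0 <= F (`|a x - a y| / 2) * `|psi x - psi y|.
    by rewrite mulr_ge0// F0// divr_ge0.
  have [[A'x Zy]|] := pselect (A' x /\ Z y); last by move=> /good0 ->.
  have [Bxy|nBxy] := ltP (dist y x) r; last first.
    by rewrite (@indic_notin _ _ (B x r)) ?mulr0//; apply/negP; rewrite -leNgt.
  rewrite (indic_in A'x) (indic_in Zy) (@indic_in _ _ (B x r))// !mulr1.
  (* After subtraction of the barrier the two values differ by at least [h + D]; in particular the
     points are distinct, which makes the powers of their distance positive. *)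
  have ax : h <= a x by case: A'x => + _; rewrite /a /=; order_lra.
  have ay : a y <= - D by case: Zy => _; rewrite /a /=; order_lra.
  have dxy : 0 < dist y x.
    rewrite lt_neqAle dist_ge0 andbT eq_sym; apply/eqP => /dist_eq0 yx.
    by move: ax ay h0 D0; rewrite yx; order_lra.
  have psixy : h <= `|psi x - psi y|.
    rewrite (psia x)// (psia y)// (@max_r _ _ _ (a x)) ?(@max_l _ _ _ (a y)); last 2 first.
    - by move: ay D0; order_lra.
    - by move: ax h0; order_lra.
    by rewrite subr0 (le_trans ax)// ler_norm.
  rewrite ler_pM ?(ltW h0)//.
    rewrite divr_ge0 ?powR_ge0// (growth_ge0 gg)// divr_ge0 ?addr_ge0 ?(ltW h0)//.
    by rewrite mulr_ge0 ?powR_ge0.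
  rewrite /F ler_pM ?invr_ge0 ?powR_ge0//.
  + rewrite (growth_ge0 gg)// divr_ge0 ?addr_ge0 ?(ltW h0)// mulr_ge0 ?powR_ge0//.
  + apply: (growth_homo gg).
      by rewrite divr_ge0 ?addr_ge0 ?(ltW h0)// mulr_ge0 ?powR_ge0.
    rewrite invfM mulrA ler_pM ?invr_ge0 ?powR_ge0//.
    * by rewrite divr_ge0// addr_ge0// ltW.
    * rewrite ler_wpM2r//; apply: le_trans (ler_norm _); move: ax ay; order_lra.
    * by rewrite lef_pV2 ?posrE ?powR_gt0// le_powR ?(ltW s_gt0) ?(ltW Bxy).
  + rewrite lef_pV2 ?posrE ?powR_gt0// le_powR ?(ltW Bxy)//.
    by rewrite addr_ge0// ltW.
- rewrite good0; last by case=> _ []; rewrite ltNge nBy.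
  have nAy : ~ A y by move=> /AB; rewrite ltNge nBy.
  have Ax : A x by apply: contrapT => nAx; apply: nnA.
  rewrite WE (psi0 y nAy) subr0.
  apply: le_trans (_ : F `|u x - u y| * ((u x - u y) / `|u x - u y|) * psi x
    + M * F (Num.max 0 (u y - k)) <= _); last first.
    rewrite lerD2l; apply: le_trans (_ : err x y <= _); last by rewrite lerDl.
    rewrite /err /pair_error (indic_in Ax) mul1r (@indic_in _ _ (~` B x0 rho)).
      by rewrite mul1r lerDr mulr_ge0 ?kern_ge0.
    by apply/negP; rewrite -leNgt.
  have k_ux : k < u x.
    by case: Ax => + _; apply: le_lt_trans; rewrite lerDl mulr_ge0 ?barrier_ge0 ?(ltW M0).
  have := @signed_mul_lower R F (u x) (u y) (Num.max 0 (u y - k)) (psi x) F0 Fm.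
  have max0 : 0 <= Num.max 0 (u y - k) by rewrite le_max lexx.
  have uyx : u y - u x <= Num.max 0 (u y - k) by rewrite le_max; apply/orP; right; move: k_ux; order_lra.
  move=> /(_ (level_test_ge0 _ _ _ _ _ _) max0 uyx).
  have : F (Num.max 0 (u y - k)) * psi x <= M * F (Num.max 0 (u y - k)).
    by rewrite mulrC ler_wpM2r ?F0// level_test_le ?(ltW M0).
  order_lra.
- rewrite good0; last by case=> /A'A/AB; rewrite ltNge nBx.
  have nAx : ~ A x by move=> /AB; rewrite ltNge nBx.
  have Ay : A y by apply: contrapT => nAy; apply: nnA.
  rewrite WE (psi0 x nAx) sub0r.
  apply: le_trans (_ : F `|u x - u y| * ((u x - u y) / `|u x - u y|) * - psi y
    + M * F (Num.max 0 (u x - k)) <= _); last first.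
    rewrite lerD2l; apply: le_trans (_ : err y x <= _); last by rewrite lerDr.
    rewrite /err /pair_error (indic_in Ay) mul1r (@indic_in _ _ (~` B x0 rho)).
      by rewrite mul1r /F (distC y x) lerDr mulr_ge0 ?kern_ge0.
    by apply/negP; rewrite -leNgt.
  have k_uy : k < u y.
    by case: Ay => + _; apply: le_lt_trans; rewrite lerDl mulr_ge0 ?barrier_ge0 ?(ltW M0).
  have := @signed_mul_lower R F (u y) (u x) (Num.max 0 (u x - k)) (psi y) F0 Fm.
  have max0 : 0 <= Num.max 0 (u x - k) by rewrite le_max lexx.
  have uyx : u x - u y <= Num.max 0 (u x - k) by rewrite le_max; apply/orP; right; move: k_uy; order_lra.
  move=> /(_ (level_test_ge0 _ _ _ _ _ _) max0 uyx).
  rewrite distrC -(opprB (u x)) mulNr mulrN mulNr -mulrN.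
  have : F (Num.max 0 (u x - k)) * psi y <= M * F (Num.max 0 (u x - k)).
    by rewrite mulrC ler_wpM2r ?F0// level_test_le ?(ltW M0).
  order_lra.
- by case: nnA; split=> /AB; rewrite ltNge ?nBx ?nBy.
Qed.

(** The factor 2 inside [g] absorbs the change of centre from a point of the half ball to [x0], so
    that one integral bounds the tails seen from all points of the level set. *)
Definition center_tail (g : R -> R) (u : T -> R) x0 k y : R :=
  g (2 * Num.max 0 (u y - k) / dist y x0 `^ s) / dist y x0 `^ (Q + s).

Lemma center_tail_ge0 p q g u x0 k y : growth_function p q g ->
  0 <= center_tail g u x0 k y.
Proof.
move=> gg; rewrite /center_tail divr_ge0 ?powR_ge0// (growth_ge0 gg)//.
by rewrite divr_ge0 ?powR_ge0// mulr_ge0// le_max lexx.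
Qed.

Lemma tail_integrand_ge0 p q g u k x y : growth_function p q g ->
  0 <= tail_integrand g u k x y.
Proof.
move=> gg; rewrite /tail_integrand divr_ge0 ?powR_ge0// (growth_ge0 gg)//.
by rewrite divr_ge0 ?powR_ge0// le_max lexx.
Qed.

Lemma pair_error_ge0 p q g u x0 (rho k M : R) x y : growth_function p q g ->
  0 < rho -> 0 < M -> 0 <= pair_error g u x0 rho k M x y.
Proof.
move=> gg rho0 M0; rewrite /pair_error mulr_ge0//; apply: addr_ge0.
  rewrite mulr_ge0 ?kern_ge0 ?divr_ge0 ?(ltW rho0)//.
  rewrite mulr_ge0// mulr_ge0 ?(ltW M0)// (growth_ge0 gg)// divr_ge0 ?powR_ge0//.
  by rewrite mulr_ge0// ltW.
by rewrite mulr_ge0 ?(ltW M0)// mulr_ge0// (tail_integrand_ge0 _ _ _ _ gg).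
Qed.

(** Since [x] is within [rho / 2] of [x0] and [y] is at least [rho] away,
    [dist y x0 <= 2 * dist y x]; inside [g] the resulting [2 ^ s] is at most 2, and outside it the
    power [Q + s] of 2 remains. *)
Lemma tail_integrand_center p q g u x0 (rho k : R) x y : growth_function p q g ->
  0 < rho -> dist x x0 < rho / 2 -> rho <= dist y x0 ->
  tail_integrand g u k x y <= 2 `^ (Q + s) * center_tail g u x0 k y.
Proof.
move=> gg rho0 xx0 yx0; have s0 := s_gt0; have s1 := s_lt1.
have max0 : 0 <= Num.max 0 (u y - k) by rewrite le_max lexx.
have d2 : dist y x0 <= 2 * dist y x by have := distD y x x0; lra.
have d00 : 0 < dist y x0 by lra.
have d0 : 0 < dist y x by lra.
have Qs : 0 <= Q + s by rewrite addr_ge0// ltW.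
rewrite /tail_integrand /center_tail mulrCA ler_pM ?invr_ge0 ?powR_ge0//.
- by rewrite (growth_ge0 gg)// divr_ge0 ?powR_ge0.
- apply: (growth_homo gg); first by rewrite divr_ge0 ?powR_ge0.
  rewrite (mulrC 2) -mulrA ler_wpM2l// -[leLHS]mul1r ler_pdivrMr ?powR_gt0//.
  rewrite mulrAC ler_pdivlMr ?powR_gt0// mul1r.
  apply: (le_trans (le_powR (ltW s0) (ltW d00) d2)).
  rewrite powRM ?(ltW d0)// ler_wpM2r ?powR_ge0//.
  by apply: ler1_powR; lra.
- rewrite -[leLHS]mul1r ler_pdivrMr ?powR_gt0// mulrAC ler_pdivlMr ?powR_gt0//.
  by rewrite mul1r -powRM ?(ltW d0)// le_powR// ltW.
Qed.

Lemma measurable_distC : measurable_fun setT (fun z : T * T => dist z.2 z.1).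
Proof.
by rewrite (_ : (fun _ => _) = fun z : T * T => dist z.1 z.2)//;
   apply/funext => z; rewrite distC.
Qed.

Lemma measurable_powR_fun d' (T' : measurableType d') (f : T' -> R) r :
  measurable_fun setT f -> measurable_fun setT (fun x => f x `^ r).
Proof. by move=> mf; apply: (measurableT_comp (measurable_powR r)). Qed.

Lemma measurable_inv_powR d' (T' : measurableType d') (f : T' -> R) r :
  measurable_fun setT f -> measurable_fun setT (fun x => (f x `^ r)^-1).
Proof.
move=> mf; under eq_fun do rewrite -powRN; exact: measurable_powR_fun.
Qed.

Lemma measurable_weak_integrand p q g u psi : growth_function p q g ->
  measurable_fun setT u -> measurable_fun setT psi ->
  measurable_fun setT (weak_integrand g u psi).
Proof.
move=> gg mu_ mpsi.
have m1 (v : T -> R) : measurable_fun setT v -> measurable_fun setT (fun z : T * T => v z.1).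
  by move=> mv; apply: (measurableT_comp mv).
have m2 (v : T -> R) : measurable_fun setT v -> measurable_fun setT (fun z : T * T => v z.2).
  by move=> mv; apply: (measurableT_comp mv).
have mud : measurable_fun setT (fun z : T * T => u z.1 - u z.2).
  by apply: measurable_funB; [exact: m1|exact: m2].
have mun : measurable_fun setT (fun z : T * T => `|u z.1 - u z.2|).
  exact: measurableT_comp.
apply: measurable_funM; last exact: measurable_inv_powR.
apply: measurable_funM; last by apply: measurable_funB; [exact: m1|exact: m2].
apply: measurable_funM.
  apply: (measurable_growth gg) => [z|]; first by rewrite divr_ge0 ?powR_ge0.
  by apply: measurable_funM => //; exact: measurable_inv_powR.
apply: measurable_funM => //.
rewrite (_ : (fun _ => _) = (fun z : T * T => (`|u z.1 - u z.2| `^ 1)^-1)).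
  exact: measurable_inv_powR.
by apply/funext => z; rewrite powRr1.
Qed.

Lemma measurable_pair_kern r :
  measurable_fun setT (fun z : T * T => kern z.1 r z.2).
Proof.
apply: measurable_funM; last exact: (measurable_inv_powR _ measurable_distC).
apply: measurable_minr => //; apply: measurable_funM => //.
exact: measurable_distC.
Qed.

Lemma measurable_tail_integrand p q g u k : growth_function p q g ->
  measurable_fun setT u ->
  measurable_fun setT (fun z : T * T => tail_integrand g u k z.1 z.2).
Proof.
move=> gg mu_.
apply: measurable_funM; last exact: (measurable_inv_powR _ measurable_distC).
apply: (measurable_growth gg) => [z|].
  by rewrite divr_ge0 ?powR_ge0// le_max lexx.
apply: measurable_funM; last exact: (measurable_inv_powR _ measurable_distC).
apply: measurable_maxr => //; apply: measurable_funB => //.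
exact: (measurableT_comp mu_).
Qed.

Lemma measurable_center_tail p q g u x0 k : growth_function p q g ->
  measurable_fun setT u -> measurable_fun setT (center_tail g u x0 k).
Proof.
move=> gg mu_.
apply: measurable_funM; last exact: (measurable_inv_powR _ (measurable_distl x0)).
apply: (measurable_growth gg) => [z|].
  by rewrite divr_ge0 ?powR_ge0// mulr_ge0// le_max lexx.
apply: measurable_funM; last exact: (measurable_inv_powR _ (measurable_distl x0)).
by apply: measurable_funM => //; apply: measurable_maxr => //; exact: measurable_funB.
Qed.

Lemma measurable_pair_error p q g u x0 rho k M : growth_function p q g ->
  measurable_fun setT u ->
  measurable_fun setT (fun z : T * T => pair_error g u x0 rho k M z.1 z.2).
Proof.
move=> gg mu_; apply: measurable_funM.
  apply: (@measurableT_comp _ _ _ _ _ _ (\1_(level_set u x0 rho k M) : T -> R)) => //.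
  exact/measurable_indic/measurable_level_set.
apply: measurable_funD.
  by apply: measurable_funM => //; exact: measurable_pair_kern.
apply: measurable_funM => //; apply: measurable_funM; last exact: (measurable_tail_integrand _ gg).
apply: (@measurableT_comp _ _ _ _ _ _ (\1_(~` B x0 rho) : T -> R)) => //.
exact/measurable_indic/measurableC/measurable_distball.
Qed.

(** The outer variable is confined to the level set, whose measure becomes a factor, and the inner
    integral is bounded uniformly in it. The constant 12 is the factor 3 of the barrier loss times
    the bound 4 for [4 ^ s], which comes from the kernel at scale [rho / 4]. *)
Lemma integral_pair_error CK p q g u x0 (rho k M T0 : R) :
  (forall x (r : R), 0 < r -> (\int[mu]_y (kern x r y)%:E <= (CK / r `^ s)%:E)%E) ->
  growth_function p q g -> measurable_fun setT u -> 0 < rho -> 0 < M ->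
  (\int[mu]_(y in ~` B x0 rho) (center_tail g u x0 k y)%:E <= T0%:E)%E ->
  (\int[mu]_x \int[mu]_y (pair_error g u x0 rho k M x y)%:E <=
   mu (level_set u x0 rho k M) *
   (M * (12 * CK * (g (4 * M / rho `^ s) / rho `^ s) + 2 `^ (Q + s) * T0))%:E)%E.
Proof.
move=> hCK gg mu_ rho0 M0 hT; set A := level_set _ _ _ _ _.
have mA : measurable A by exact: measurable_level_set.
have s0 := s_gt0; have s1 := s_lt1.
set G := g _; have G0 : 0 <= G.
  by rewrite (growth_ge0 gg)// divr_ge0 ?powR_ge0// mulr_ge0// ltW.
have CK0 : 0 <= CK.
  have := le_trans (integral_ge0 _ _) (hCK x0 1 ltr01).
  rewrite powR1 divr1 lee_fin; apply => y _.
  by rewrite lee_fin kern_ge0.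
have rs0 : 0 < rho `^ s by rewrite powR_gt0.
set c := M * _.
have mtl x : measurable_fun setT (tail_integrand g u k x).
  exact: (measurable_fun_pair2 x (measurable_tail_integrand k gg mu_)).
have mB : measurable (~` B x0 rho) by exact/measurableC/measurable_distball.
have inner x : A x -> (\int[mu]_y (pair_error g u x0 rho k M x y)%:E <= c%:E)%E.
  move=> Ax; rewrite /pair_error (indic_in Ax).
  under eq_integral do rewrite mul1r EFinD EFinM (EFinM M) (EFinM (\1_ _ _)).
  have kern0 y : (0 <= (kern x (rho / 4) y)%:E)%E.
    by rewrite lee_fin kern_ge0// divr_ge0// ltW.
  have tl0 y : 0 <= tail_integrand g u k x y by exact: (tail_integrand_ge0 _ _ _ _ gg).
  have mk : measurable_fun setT (fun y => (kern x (rho / 4) y)%:E : \bar R).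
    exact/measurable_EFinP/measurable_kern.
  have mt : measurable_fun setT (fun y =>
      ((\1_(~` B x0 rho) y)%:E * (tail_integrand g u k x y)%:E : \bar R)%E).
    apply: emeasurable_funM; last exact/measurable_EFinP.
    exact/measurable_EFinP/measurable_indic.
  have t0 y : (0 <= (\1_(~` B x0 rho) y)%:E * (tail_integrand g u k x y)%:E :> \bar R)%E.
    by rewrite mule_ge0// lee_fin.
  have gM0 : 0 <= 3 * (G * M) by rewrite mulr_ge0// mulr_ge0// ltW.
  rewrite ge0_integralD//; last 4 first.
  - by move=> y _; rewrite mule_ge0// lee_fin.
  - by apply: emeasurable_funM.
  - by move=> y _; rewrite mule_ge0// lee_fin ltW.
  - by apply: emeasurable_funM.
  rewrite !ge0_integralZl_EFin ?(ltW M0)//.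
  have h1 : (\int[mu]_y (kern x (rho / 4) y)%:E <= (CK * 4 / rho `^ s)%:E)%E.
    apply: le_trans (hCK x _ (_ : 0 < rho / 4)) _; first by rewrite divr_gt0.
    rewrite lee_fin -mulrA ler_wpM2l// ler_pdivlMr// mulrC.
    rewrite ler_pdivrMr ?powR_gt0 ?divr_gt0//.
    rewrite powRM ?invr_ge0 ?(ltW rho0)// mulrCA -[leLHS]mulr1 ler_wpM2l ?powR_ge0//.
    rewrite -ler_pdivrMl// mulr1; apply: ger1_powR; lra.
  have h2 : (\int[mu]_y ((\1_(~` B x0 rho) y)%:E * (tail_integrand g u k x y)%:E) <=
      (2 `^ (Q + s) * T0)%:E)%E.
    apply: le_trans (_ : (\int[mu]_(y in ~` B x0 rho)
        ((2 `^ (Q + s))%:E * (center_tail g u x0 k y)%:E) <= _)%E).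
      rewrite [leRHS]integral_mkcond; apply: ae_le_integral => [//|y _|].
        rewrite patchE; case: ifPn => // _.
        by rewrite -EFinM lee_fin mulr_ge0 ?powR_ge0// (center_tail_ge0 _ _ _ _ gg).
      apply: aeW => y _; rewrite patchE; case: ifPn => [/set_mem By|/negP nBy].
        rewrite (indic_in By) mul1e -EFinM lee_fin.
        case: Ax => _ xx0; apply: (tail_integrand_center _ _ gg rho0) => //.
        by rewrite leNgt; exact/negP.
      by rewrite indicE (memNset (fun h => nBy (mem_set h))) mul0e.
    rewrite ge0_integralZl_EFin ?powR_ge0//; last 2 first.
    - by move=> y _; rewrite lee_fin (center_tail_ge0 _ _ _ _ gg).
    - apply/measurable_EFinP/(measurable_funS measurableT (@subsetT _ _)).
      exact: (measurable_center_tail _ _ gg).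
    by rewrite EFinM lee_wpmul2l// lee_fin powR_ge0.
  apply: le_trans (leeD (lee_wpmul2l _ h1) (lee_wpmul2l _ h2)) _;
    rewrite ?lee_fin ?(ltW M0)//.
  by rewrite le_eqVlt; apply/orP; left; apply/eqP; rewrite /c /G; ring.
have c0 : 0 <= c.
  have T00 : 0 <= T0.
    rewrite -lee_fin; apply: le_trans hT; apply: integral_ge0 => y _.
    by rewrite lee_fin (center_tail_ge0 _ _ _ _ gg).
  rewrite /c mulr_ge0 ?(ltW M0)// addr_ge0//.
    by rewrite mulr_ge0 ?divr_ge0 ?(ltW rs0)// mulr_ge0.
  by rewrite mulr_ge0// powR_ge0.
apply: le_trans (_ : (\int[mu]_x (c%:E * (\1_A x)%:E) <= _)%E).
  apply: ae_le_integral => [x _|x _|].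
  - by apply: integral_ge0 => y _; rewrite lee_fin (pair_error_ge0 _ _ _ _ _ gg).
  - by rewrite mule_ge0// lee_fin.
  apply: aeW => x _; have [Ax|nAx] := pselect (A x).
    by rewrite (indic_in Ax) mule1 inner.
  rewrite (indic_notin nAx) mule0 integral0_eq// => y _.
  by rewrite /pair_error (indic_notin nAx) mul0r.
rewrite ge0_integralZl_EFin//; last exact/measurable_EFinP/measurable_indic.
by rewrite integral_indic// setIT muleC.
Qed.

(** The pairwise bound is integrated over the product, where the weak formulation removes the
    equation. On the left only the mass [m] of the sublevel set near each point of the higher level
    set is kept, so the measure of the higher level set is controlled by that of the lower one.
    Exchanging [x] and [y] in the error doubles 12 and [2 ^ (Q + s)]. *)
Lemma energy_estimate : exists2 C : R, 0 < C &
  forall p q g (u : T -> R) x0 (rho k M h D r m T0 : R),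
  growth_function p q g -> measurable_fun setT u ->
  0 < rho -> 0 < M -> 0 < h -> 0 <= D -> 0 < r -> 0 <= m ->
  {ae mu, forall x, dist x x0 < rho -> u x <= k + M} ->
  (\int[mu]_(y in ~` B x0 rho) (center_tail g u x0 k y)%:E <= T0%:E)%E ->
  (\int[mu \x mu]_z (weak_integrand g u (level_test u x0 rho k M) z)%:E = 0)%E ->
  (forall x, level_set u x0 rho (k + h) M x ->
    (m%:E <= mu (sublevel_set u x0 rho k M D `&` B x r))%E) ->
  (mu (level_set u x0 rho (k + h) M) *
     (g ((h + D) / (2 * r `^ s)) / r `^ (Q + s) * h * m)%:E <=
   mu (level_set u x0 rho k M) *
     (C * M * (g (4 * M / rho `^ s) / rho `^ s + T0))%:E)%E.
Proof.
have [CK CK0 hCK] := integral_kern.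
exists (24 * CK + 2 * 2 `^ (Q + s)).
  by rewrite addr_gt0// mulr_gt0// powR_gt0.
move=> p q g u x0 rho k M h D r m T0 gg mu_ rho0 M0 h0 D0 r0 m0 uM hT weak hm.
set A := level_set u x0 rho k M; set A' := level_set u x0 rho (k + h) M.
set Z := sublevel_set u x0 rho k M D in hm *.
set cg := g ((h + D) / _) / _ * h.
have cg0 : 0 <= cg.
  rewrite /cg mulr_ge0 ?(ltW h0)// divr_ge0 ?powR_ge0// (growth_ge0 gg)//.
  by rewrite divr_ge0 ?addr_ge0 ?(ltW h0)// mulr_ge0// powR_ge0.
have mA' : measurable A' by exact: measurable_level_set.
have mZ : measurable Z.
  apply: measurableI; first exact: measurable_distball.
  apply: measurable_set_le => //; apply: measurable_funB => //.
  apply: measurable_funD => //; apply: measurable_funM => //.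
  exact: measurable_barrier.
pose err := pair_error g u x0 rho k M.
have err0 x y : 0 <= err x y by exact: (pair_error_ge0 _ _ _ _ _ gg).
have merr : measurable_fun setT (fun z : T * T => err z.1 z.2).
  exact: (measurable_pair_error _ _ _ _ gg).
have merr' : measurable_fun setT (fun z : T * T => err z.2 z.1).
  exact: (measurableT_comp merr (measurable_fun_pair msnd mfst)).
pose good z := cg * (\1_A' z.1 * (\1_Z z.2 * \1_(B z.1 r) z.2)) : R.
have good0 z : 0 <= good z by rewrite /good mulr_ge0// mulr_ge0// mulr_ge0.
have mgood : measurable_fun setT good.
  apply: measurable_funM => //; apply: measurable_funM.
    apply: (@measurableT_comp _ _ _ _ _ _ (\1_A' : T -> R)) => //.
  apply: measurable_funM.
    apply: (@measurableT_comp _ _ _ _ _ _ (\1_Z : T -> R)) => //.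
  rewrite (_ : (fun _ => _) = \1_[set z : T * T | dist z.2 z.1 < r]).
    apply: measurable_indic; apply: measurable_set_lt => //.
    exact: measurable_distC.
  by apply/funext => z; rewrite !indicE; congr (nat_of_bool _)%:R; rewrite !inE.
have err2 z : 0 <= err z.1 z.2 + err z.2 z.1 by rewrite addr_ge0.
have : (\int[mu \x mu]_z (good z)%:E <=
    \int[mu \x mu]_z (err z.1 z.2 + err z.2 z.1)%:E)%E.
  apply: (le_integral_of_eq0 (f := weak_integrand g u (level_test u x0 rho k M))) => //.
  - exact: (measurable_weak_integrand gg mu_ (measurable_level_test x0 rho k M mu_)).
  - exact: measurable_funD.
  - apply: filterS (ae_product uM) => -[x y] [/= ux uy].
    exact: (weak_integrand_lower gg).
move=> le_good.
have merrE : measurable_fun setT (fun z : T * T => (err z.1 z.2)%:E : \bar R).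
  exact/measurable_EFinP.
have merrE' : measurable_fun setT (fun z : T * T => (err z.2 z.1)%:E : \bar R).
  exact/measurable_EFinP.
have errE : (\int[mu \x mu]_z (err z.1 z.2 + err z.2 z.1)%:E =
    \int[mu]_x \int[mu]_y (err x y)%:E + \int[mu]_x \int[mu]_y (err x y)%:E)%E.
  under eq_integral do rewrite EFinD.
  rewrite ge0_integralD//; first congr (_ + _)%E.
  - by rewrite (@fubini_tonelli1 _ _ _ _ _ mu mu _ merrE)// => z; rewrite lee_fin.
  - by rewrite (@fubini_tonelli2 _ _ _ _ _ mu mu _ merrE')// => z; rewrite lee_fin.
  - by move=> z _; rewrite lee_fin.
  - by move=> z _; rewrite lee_fin.
have mgoodE : measurable_fun setT (fun z : T * T => (good z)%:E : \bar R).
  exact/measurable_EFinP.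
have goodE : (\int[mu \x mu]_z (good z)%:E =
    \int[mu]_x \int[mu]_y (good (x, y))%:E)%E.
  by rewrite (@fubini_tonelli1 _ _ _ _ _ mu mu _ mgoodE)// => z; rewrite lee_fin.
rewrite errE goodE in le_good.
have le_err := integral_pair_error hCK gg mu_ rho0 M0 hT.
apply: le_trans (_ : (\int[mu]_x \int[mu]_y (good (x, y))%:E <= _)%E); last first.
  apply: (le_trans le_good); apply: le_trans (leeD le_err le_err) _.
  have T00 : 0 <= T0.
    rewrite -lee_fin; apply: le_trans hT; apply: integral_ge0 => y _.
    by rewrite lee_fin (center_tail_ge0 _ _ _ _ gg).
  set G := g _ / _; have G0 : 0 <= G.
    rewrite divr_ge0 ?powR_ge0// (growth_ge0 gg)// divr_ge0 ?powR_ge0//.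
    by rewrite mulr_ge0// ltW.
  set K := 2 `^ (Q + s); have K0 : 0 <= K by exact: powR_ge0.
  have c0 : 0 <= M * (12 * CK * G + K * T0).
    rewrite mulr_ge0 ?(ltW M0)// addr_ge0 ?(mulr_ge0 K0 T00)//.
    by rewrite mulr_ge0// mulr_ge0// ltW.
  rewrite -ge0_muleDr ?lee_fin// lee_wpmul2l// -EFinD lee_fin.
  have h1 : 0 <= M * (K * G) by rewrite mulr_ge0 ?(ltW M0)// mulr_ge0.
  have h2 : 0 <= M * (CK * T0) by rewrite mulr_ge0 ?(ltW M0)// mulr_ge0// ltW.
  rewrite -subr_ge0 (_ : _ - _ = 2 * (M * (K * G)) + 24 * (M * (CK * T0))); last by ring.
  by rewrite addr_ge0// mulr_ge0.
have mIA : measurable_fun setT (fun x => (\1_A' x)%:E : \bar R).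
  exact/measurable_EFinP/measurable_indic.
have cgm0 : 0 <= cg * m by rewrite mulr_ge0.
apply: le_trans (_ : (\int[mu]_x ((cg * m)%:E * (\1_A' x)%:E) <= _)%E).
  by rewrite ge0_integralZl_EFin// integral_indic// setIT muleC.
apply: ae_le_integral => [x _|x _|].
- by rewrite -EFinM lee_fin mulr_ge0// mulr_ge0.
- by apply: integral_ge0 => y _; rewrite lee_fin.
apply: aeW => x _; have [Ax|nAx] := pselect (A' x); last first.
  by rewrite (indic_notin nAx) mule0; apply: integral_ge0 => y _; rewrite lee_fin.
rewrite (indic_in Ax) mule1 /good/=.
rewrite [leRHS](_ : _ = (\int[mu]_y (cg%:E * (\1_(Z `&` B x r) y)%:E))%E); last first.
  by apply: eq_integral => y _; rewrite (indic_in Ax) mul1r EFinM indicI.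
have mZB : measurable (Z `&` B x r).
  by apply: measurableI => //; exact: measurable_distball.
rewrite ge0_integralZl_EFin//; last exact/measurable_EFinP/measurable_indic.
by rewrite integral_indic// setIT EFinM lee_wpmul2l ?lee_fin// hm.
Qed.

(** * De Giorgi iteration and improvement of the upper bound *)

Lemma geometric_squeeze (a c th : R) : 0 < th < 1 ->
  (forall j : nat, a <= c * th ^+ j) -> a <= 0.
Proof.
move=> /andP[th0 th1] h; rewrite leNgt; apply/negP => a0.
have x0 : 0 < th^-1 - 1 by rewrite subr_gt0 invf_gt1.
have [k] := bernoulli_unbounded ((c + a) / a) x0.
rewrite (_ : 1 + _ = th^-1) ?exprVn; last by ring.
rewrite ler_pdivrMr// => hk.
have := h k; have tk : 0 < th ^+ k by rewrite exprn_gt0.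
have : (c + a) * th ^+ k <= a by rewrite -ler_pdivlMr// mulrC.
have : 0 < a * th ^+ k by rewrite mulr_gt0.
lra.
Qed.

Lemma center_tail_le p q g u x0 (k k' : R) y : growth_function p q g -> k <= k' ->
  center_tail g u x0 k' y <= center_tail g u x0 k y.
Proof.
move=> gg kk; rewrite /center_tail ler_wpM2r ?invr_ge0 ?powR_ge0//.
have max0 k1 : 0 <= Num.max 0 (u y - k1) by rewrite le_max lexx.
apply: (growth_homo gg); first by rewrite divr_ge0 ?powR_ge0// mulr_ge0.
rewrite ler_wpM2r ?invr_ge0 ?powR_ge0// ler_wpM2l//.
by rewrite ge_max max0 le_max lerD2l lerN2 kk orbT.
Qed.

Lemma integral_center_tail_le p q g u x0 (rho k k' : R) : growth_function p q g ->
  k <= k' ->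
  (\int[mu]_(y in ~` B x0 rho) (center_tail g u x0 k' y)%:E <=
   \int[mu]_(y in ~` B x0 rho) (center_tail g u x0 k y)%:E)%E.
Proof.
move=> gg kk; apply: ae_le_integral => [y _|y _|].
- by rewrite lee_fin (center_tail_ge0 _ _ _ _ gg).
- by rewrite lee_fin (center_tail_ge0 _ _ _ _ gg).
- by apply: aeW => y _; rewrite lee_fin (center_tail_le _ _ _ gg).
Qed.

(** The only trace of the equation in the abstract setting. The integral runs over all pairs: those
    that miss the domain contribute 0, as the test function vanishes at both points. *)
Definition weak_on g (u : T -> R) x0 rho := forall k M : R, 0 < M ->
  (\int[mu \x mu]_z (weak_integrand g u (level_test u x0 rho k M) z)%:E = 0)%E.

(* De Giorgi iteration over the levels [k + M / 4 * (1 - 2^-j)]; the points of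
   a small ball lying outside the previous level set play the role of the
   Sobolev inequality. *)
Lemma small_level_set_bound CT : 0 <= CT -> exists2 eps : R, 0 < eps &
  forall p q g (u : T -> R) x0 (rho k M : R),
  growth_function p q g -> measurable_fun setT u -> 0 < rho -> 0 < M ->
  {ae mu, forall x, dist x x0 < rho -> u x <= k + M} ->
  (\int[mu]_(y in ~` B x0 rho) (center_tail g u x0 k y)%:E <=
    (CT * (g (4 * M / rho `^ s) / rho `^ s))%:E)%E ->
  weak_on g u x0 rho ->
  (mu (level_set u x0 rho k M) <= (eps * rho `^ Q)%:E)%E ->
  {ae mu, forall x, dist x x0 < rho / 4 -> u x <= k + M / 4}.
Proof.
move=> CT0; have [C C0 energy] := energy_estimate.
have s0 := s_gt0; have s1 := s_lt1; have Q0 := Q_gt0; have c10 := c1_gt0.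
have is1 : 1 <= s^-1 by rewrite invf_ge1// ltW.
(* Shrinking the radii by [kap] halves their power [s], at the rate of the gaps between the levels.
   The argument [h / (2 * rr j ^ s)] of [g] is then the same at every step. *)
pose kap : R := 2^-1 `^ s^-1.
have kap0 : 0 < kap by rewrite powR_gt0.
have kaps : kap `^ s = 2^-1 by rewrite -powRrM mulVf ?gt_eqF// powRr1.
have kap1 : kap < 1 by apply: powR_lt1; [by rewrite invr_gt0 ltr0n invf_lt1// ltr1n|rewrite invr_gt0].
have [C3 C3E C30] : exists2 C3, C3 = C * (1 + CT) & 0 < C3.
  by exists (C * (1 + CT)); rewrite ?mulr_gt0// ltr_wpDr.
(* That argument equals [M / (16 * e0 * rho ^ s)]; the bound 1/64 makes it at least
   [4 * M / rho ^ s], so that the values of [g] on both sides cancel. The last condition closes the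
   induction on the measures. *)
have [e0 [e00 e064 e0C]] : exists e0 : R,
    [/\ 0 < e0, e0 <= 64^-1 & 8 * C3 * e0 <= c1 / 2 * kap `^ Q].
  have C16 : 0 < 16 * C3 by rewrite mulr_gt0.
  exists (Num.min 64^-1 (c1 * kap `^ Q / (16 * C3))); split.
  - by rewrite lt_min invr_gt0 ltr0n/= divr_gt0// mulr_gt0// powR_gt0.
  - by rewrite ge_min lexx.
  - move: (c1 * _ / _) (ler_pdivlMr (Num.min 64^-1 (c1 * kap `^ Q / (16 * C3)))
      (c1 * kap `^ Q) C16) => y.
    by rewrite ge_min lexx orbT => /esym; move: (Num.min _ _) => z; order_lra.
(* The bound 1/2 keeps the balls of radius [rr j] around points of the half ball inside the ball of
   radius [rho]. *)
have [eps0 [eps00 eps0s eps0half]] : exists eps0 : R,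
    [/\ 0 < eps0, eps0 `^ s = e0 & eps0 <= 2^-1].
  exists (e0 `^ s^-1); split; first by rewrite powR_gt0.
  - by rewrite -powRrM mulVf ?gt_eqF// powRr1 ?ltW.
  - have e01 : 0 < e0 <= 1 by rewrite e00 (le_trans e064)// invf_le1// ler1n.
    apply: le_trans (ge1r_powR e01 is1) _; apply: (le_trans e064).
    by rewrite lef_pV2 ?posrE// ler_nat.
exists (c1 / 2 * eps0 `^ Q); first by rewrite mulr_gt0 ?powR_gt0// divr_gt0.
move=> p q g u x0 rho k M gg mu_ rho0 M0 uM hT weak h0.
have rs0 : 0 < rho `^ s by rewrite powR_gt0.
pose kk (j : nat) := k + M / 4 * (1 - 2^-1 ^+ j).
pose rr (j : nat) := eps0 * rho * kap ^+ j.
have rr0 j : 0 < rr j by rewrite !mulr_gt0// exprn_gt0.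
have rrle j : rr j <= rho / 2.
  apply: le_trans (_ : eps0 * rho <= _); last by rewrite mulrC ler_pM2l.
  by rewrite ler_piMr ?exprn_ile1 ?(ltW kap0) ?(ltW kap1)// mulr_ge0// ltW.
have rrs j : rr j `^ s = e0 * rho `^ s * 2^-1 ^+ j.
  rewrite /rr !powRM ?mulr_ge0 ?exprn_ge0 ?(ltW eps00) ?(ltW rho0) ?(ltW kap0)//.
  by rewrite eps0s powR_exprn ?(ltW kap0)// kaps.
have kkge j : k <= kk j.
  rewrite /kk lerDl mulr_ge0 ?divr_ge0 ?(ltW M0)// subr_ge0 exprn_ile1// invf_le1// ler1n//.
have kkS j : kk j.+1 = kk j + M * 2^-1 ^+ j / 8.
  by rewrite /kk exprS; field.
pose G := g (4 * M / rho `^ s).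
have G0 : 0 < G by apply: (growth_gt0 gg); rewrite divr_gt0// mulr_gt0.
have uMj j : {ae mu, forall x, dist x x0 < rho -> u x <= kk j + M}.
  by apply: filterS uM => x h /h /le_trans; apply; rewrite lerD2r.
have fin j : mu (level_set u x0 rho (kk j) M) \is a fin_num.
  rewrite ge0_fin_numE//; apply: le_lt_trans (ltry (c2 * rho `^ Q)).
  apply: le_trans (vol_le x0 rho0); apply: le_measure; rewrite ?inE//.
  - exact: measurable_level_set.
  - exact: measurable_distball.
  - by move=> x [_ /= /lt_trans]; apply; move: rho0; order_lra.
(* The level set fills at most half of the guaranteed volume [c1 * rr j ^ Q], so around each point
   at least the other half lies outside it. The energy estimate then bounds the next level set by
   [8 * C3 * e0 * rr j ^ Q], which is at most [c1 / 2 * rr j.+1 ^ Q]. *)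
have decay j : (mu (level_set u x0 rho (kk j) M) <= (c1 / 2 * rr j `^ Q)%:E)%E.
  elim: j => [|j IH].
    rewrite /kk expr0 subrr mulr0 addr0 /rr expr0 mulr1.
    by rewrite powRM ?(ltW eps00) ?(ltW rho0)// mulrA.
  set A := level_set _ _ _ _ _ in IH; set A' := level_set _ _ _ _ _.
  pose m := c1 / 2 * rr j `^ Q.
  have m0 : 0 < m by rewrite mulr_gt0 ?powR_gt0// divr_gt0.
  pose h := M * 2^-1 ^+ j / 8.
  have hh0 : 0 < h by rewrite divr_gt0// mulr_gt0// exprn_gt0.
  have hmeas x : level_set u x0 rho (kk j + h) M x ->
      (m%:E <= mu (sublevel_set u x0 rho (kk j) M 0 `&` B x (rr j)))%E.
    move=> [_ /= xx0]; have [N [mN N0 hN]] := uMj j.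
    have mA : measurable A by exact: measurable_level_set.
    have mZ : measurable (sublevel_set u x0 rho (kk j) M 0 `&` B x (rr j)).
      apply: measurableI; last exact: measurable_distball.
      apply: measurableI; first exact: measurable_distball.
      apply: measurable_set_le => //; apply: measurable_funB => //.
      apply: measurable_funD => //; apply: measurable_funM => //.
      exact: measurable_barrier.
    have sub : B x (rr j) `<=`
        (sublevel_set u x0 rho (kk j) M 0 `&` B x (rr j)) `|` A `|` N.
      move=> y /= yx; have yx0 : dist y x0 < rho.
        by have := distD y x x0; have := rrle j; move: yx xx0; order_lra.
      have [Ny|nNy] := pselect (N y); first by right.
      have uy : u y <= kk j + M.
        apply: contrapT => nuy; apply: nNy; apply: hN => /=.
        by move=> /(_ yx0).
      left; have [Ay|nAy] := pselect (A y); [by right|left; split => //; split => //].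
      (* A point outside the level set is either below the level or beyond [rho / 2], where the
         barrier is 1 and the essential bound [kk j + M] suffices. *)
      rewrite subr0; move: nAy => /not_andP[|] /negP; rewrite -leNgt// => hy.
      by rewrite barrier1// mulr1.
    have := vol_ge x (rr0 j).
    move=> /le_trans/(_ (le_measure mu _ _ sub)); rewrite !inE.
    move=> /(_ (measurable_distball _ _) (measurableU _ _ (measurableU _ _ mZ mA) mN)) hc.
    have := le_trans hc (measureU2 _ (measurableU _ _ mZ mA) mN).
    rewrite [X in (_ + X)%E](_ : _ = 0%E)// adde0 => {}hc.
    have := le_trans hc (measureU2 _ mZ mA) => {}hc.
    have := le_trans hc (leeD (lexx _) IH) => {}hc.
    rewrite -(leeD2rE _ _ (_ : m%:E \is a fin_num))//; apply: le_trans hc.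
    by rewrite -EFinD lee_fin /m; order_lra.
  have hTj := le_trans (integral_center_tail_le u x0 rho gg (kkge j)) hT.
  have := energy p q g u x0 rho (kk j) M h 0 (rr j) m _ gg mu_ rho0 M0 hh0
    (lexx 0) (rr0 j) (ltW m0) (uMj j) hTj (weak _ _ M0) hmeas.
  rewrite -kkS -/A -/A' => hE.
  have finA' : mu A' \is a fin_num := fin j.+1.
  have finA : mu A \is a fin_num := fin j.
  move: IH hE; rewrite -(fineK finA') -(fineK finA) -!EFinM !lee_fin.
  set a' := fine (mu A'); set a := fine (mu A) => IH; rewrite addr0.
  have a'0 : 0 <= a' by exact: fine_ge0.
  rewrite -/G.
  have -> : C * M * (G / rho `^ s + CT * (G / rho `^ s)) = C3 * M * G / rho `^ s.
    by rewrite C3E; ring.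
  have gG : G <= g (h / (2 * rr j `^ s)).
    apply: (growth_homo gg); first by rewrite divr_ge0 ?mulr_ge0 ?(ltW M0) ?(ltW rs0).
    rewrite rrs /h; have j0 : 0 < 2^-1 ^+ j :> R by rewrite exprn_gt0.
    rewrite (_ : _ / (2 * _) = M / rho `^ s * (16 * e0)^-1); last first.
      by field; rewrite !gt_eqF.
    rewrite (_ : 4 * M / _ = M / rho `^ s * 4); last by ring.
    rewrite ler_wpM2l ?divr_ge0 ?(ltW M0) ?(ltW rs0)//.
    by rewrite -[leLHS]invrK lef_pV2 ?posrE ?mulr_gt0 ?invr_gt0//; move: e064; order_lra.
  move=> hE; have j0 : 0 < 2^-1 ^+ j :> R by rewrite exprn_gt0.
  have rQ0 : 0 < rr j `^ Q by rewrite powR_gt0.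
  pose K := G / rr j `^ (Q + s) * h * m.
  have K0 : 0 < K by rewrite mulr_gt0// mulr_gt0// divr_gt0// powR_gt0.
  have hK : a' * K <= m * (C3 * M * G / rho `^ s).
    apply: le_trans (_ : a * (C3 * M * G / rho `^ s) <= _); last first.
      by rewrite ler_wpM2r// divr_ge0 ?(ltW rs0)// !mulr_ge0 ?(ltW C30) ?(ltW M0) ?(ltW G0).
    apply: le_trans hE; rewrite ler_wpM2l// /K !ler_wpM2r ?(ltW m0) ?(ltW hh0)//.
    by rewrite invr_ge0 powR_ge0.
  have hK2 : m * (C3 * M * G / rho `^ s) = 8 * C3 * e0 * rr j `^ Q * K.
    rewrite /K /h powRD ?(gt_eqF (rr0 j)) ?implybT// rrs.
    by field; rewrite !gt_eqF.
  move: hK; rewrite hK2 ler_pM2r// => /le_trans; apply.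
  rewrite (_ : rr j.+1 = kap * rr j); last by rewrite /rr exprS; ring.
  by rewrite powRM ?(ltW kap0) ?(ltW (rr0 j))// mulrA ler_pM2r.
(* [k + M / 4] lies above all levels [kk j], so its level set is null; on the ball of radius
   [rho / 4] the barrier is 0 and this bounds [u] itself. *)
have lim : (mu (level_set u x0 rho (k + M / 4) M) <= 0)%E.
  have sub j : level_set u x0 rho (k + M / 4) M `<=` level_set u x0 rho (kk j) M.
    move=> x [/= h1 h2]; split => //=; apply: le_lt_trans h1.
    by rewrite lerD2r /kk lerD2l ler_piMr ?divr_ge0 ?(ltW M0).
  have bd j : (mu (level_set u x0 rho (k + M / 4) M) <= (c1 / 2 * rr j `^ Q)%:E)%E.
    apply: le_trans (decay j); apply: le_measure; rewrite ?inE//;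
      exact: measurable_level_set.
  have finA : mu (level_set u x0 rho (k + M / 4) M) \is a fin_num.
    by rewrite ge0_fin_numE//; apply: le_lt_trans (bd 0%N) (ltry _).
  rewrite -(fineK finA) lee_fin.
  apply: (@geometric_squeeze _ (c1 / 2 * (eps0 * rho) `^ Q) (kap `^ Q)).
    by rewrite powR_gt0//= powR_lt1// kap0.
  move=> j; have := bd j; rewrite -(fineK finA) lee_fin /rr.
  rewrite powRM ?exprn_ge0 ?mulr_ge0 ?(ltW eps00) ?(ltW rho0) ?(ltW kap0)//.
  by rewrite powR_exprn ?(ltW kap0)// mulrA.
exists (level_set u x0 rho (k + M / 4) M); split.
- exact: measurable_level_set.
- by apply/eqP; rewrite -measure_le0.
- move=> x /= h; apply: contrapT => nA; apply: h => xx0.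
  rewrite leNgt; apply/negP => ux; apply: nA; split => /=; last by move: xx0 rho0; order_lra.
  by rewrite barrier0 ?mulr0 ?addr0// ltW.
Qed.

(* If [u] is below the middle value on half of the ball, then the pairs joining
   [{u close to up}] to [{u <= middle}] make the coercive term of size
   [g (om / rho^s)], while the errors only see the truncation [lam * om]. *)
Lemma upper_bound_improvement p q CT : 1 < p -> 0 <= CT ->
  exists2 lam : R, 0 < lam <= 4^-1 &
  forall g (u : T -> R) x0 (rho om up : R),
  growth_function p q g -> measurable_fun setT u -> 0 < rho -> 0 < om ->
  {ae mu, forall x, dist x x0 < rho -> u x <= up} ->
  (\int[mu]_(y in ~` B x0 rho) (center_tail g u x0 (up - lam * om) y)%:E <=
    (CT * (g (4 * (lam * om) / rho `^ s) / rho `^ s))%:E)%E ->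
  weak_on g u x0 rho ->
  ((c1 / 2 * rho `^ Q)%:E <= mu (B x0 rho `&` [set y | (u y <= up - om / 2)%R]))%E ->
  {ae mu, forall x, dist x x0 < rho / 4 -> u x <= up - lam / 4 * om}.
Proof.
move=> p1 CT0; have [C C0 energy] := energy_estimate.
have [eps1 eps10 small] := small_level_set_bound CT0.
have s0 := s_gt0; have s1 := s_lt1; have Q0 := Q_gt0; have c10 := c1_gt0.
have c20 := c2_gt0.
have [C3 C3E C30] : exists2 C3, C3 = C * (1 + CT) & 0 < C3.
  by exists (C * (1 + CT)); rewrite ?mulr_gt0// ltr_wpDr.
have [K KE K0] : exists2 K, K = 2 `^ (Q + s) & 0 < K.
  by exists (2 `^ (Q + s)) => //; rewrite powR_gt0.
(* Makes the errors divided by the coercive term equal to [eps1 * rho ^ Q], the threshold of the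
   iteration: 4 collects the halves in [M / 2] and [c1 / 2], and [K] comes from the radius
   [2 * rho], within which each point of the half ball sees the whole ball. *)
have [e [e0 eE]] : exists e, 0 < e /\ e * (4 * c2 * C3 * K) = eps1 * c1.
  have h : 0 < 4 * c2 * C3 * K by rewrite !mulr_gt0.
  by exists (eps1 * c1 / (4 * c2 * C3 * K)); rewrite divr_gt0 ?mulr_gt0// mulfVK ?gt_eqF.
have [lam' /andP[lam'0 lam'1] hlam] := growth_small q p1 e0.
(* With [t = om / (16 * rho ^ s)], the divisor 64 turns the argument [4 * (lam * om) / rho ^ s] of
   the errors into [lam' * t], while the argument of the coercive term is at least [t]. *)
have [lam lamE] : exists lam, lam = lam' / 64 by exists (lam' / 64).
have lam0 : 0 < lam by rewrite lamE divr_gt0.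
have lam1 : lam <= 4^-1 by rewrite lamE; move: lam'1; order_lra.
exists lam; first by rewrite lam0.
move=> g u x0 rho om up gg mu_ rho0 om0 uup hT weak half.
have rs0 : 0 < rho `^ s by rewrite powR_gt0.
have rQ0 : 0 < rho `^ Q by rewrite powR_gt0.
have [M ME M0] : exists2 M, M = lam * om & 0 < M by exists (lam * om); rewrite ?mulr_gt0.
rewrite -ME in hT.
pose k := up - M; rewrite -/k in hT.
have Mom : M <= om / 4.
  by rewrite ME mulrC ler_pM2l.
pose D := om / 2 - M; have D0 : 0 <= D by rewrite /D; move: Mom om0; order_lra.
have M20 : 0 < M / 2 by rewrite divr_gt0.
pose m := c1 / 2 * rho `^ Q.
have m0 : 0 < m by rewrite mulr_gt0// divr_gt0.
have ukM : {ae mu, forall x, dist x x0 < rho -> u x <= k + M}.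
  by apply: filterS uup => x h /h; rewrite /k subrK.
have mZ0 : measurable (B x0 rho `&` [set y | u y <= up - om / 2]).
  by apply: measurableI; [exact: measurable_distball|exact: measurable_set_le].
have hmeas x : level_set u x0 rho (k + M / 2) M x ->
    (m%:E <= mu (sublevel_set u x0 rho k M D `&` B x (2 * rho)%R))%E.
  move=> [_ /= xx0]; apply: (le_trans half); apply: le_measure; rewrite ?inE//.
    apply: measurableI; last exact: measurable_distball.
    apply: measurableI; first exact: measurable_distball.
    apply: measurable_set_le => //; apply: measurable_funB => //.
    apply: measurable_funD => //; apply: measurable_funM => //.
    exact: measurable_barrier.
  move=> y [/= yx0 uy]; split => /=; last first.
    by have := distD y x0 x; rewrite (distC x0 x); move: yx0 xx0 rho0; order_lra.
  split => //; apply: (le_trans uy).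
  have : 0 <= M * barrier x0 rho y by rewrite mulr_ge0 ?(ltW M0)// barrier_ge0.
  by rewrite /k /D; move: (barrier _ _ _) => b; order_lra.
have r20 : 0 < 2 * rho by rewrite mulr_gt0.
have half_rho : rho / 2 <= rho by move: rho0; order_lra.
have := energy p q g u x0 rho k M (M / 2) D (2 * rho) m _ gg mu_ rho0 M0 M20
  D0 r20 (ltW m0) ukM hT (weak _ _ M0) hmeas.
set A := level_set u x0 rho k M; set A' := level_set u x0 rho (k + M / 2) M.
have AB : A `<=` B x0 rho by move=> x [_ /= /lt_le_trans]; apply.
have A'B : A' `<=` B x0 rho by move=> x [_ /= /lt_le_trans]; apply.
have mA : measurable A by exact: measurable_level_set.
have mA' : measurable A' by exact: measurable_level_set.
have volA : (mu A <= (c2 * rho `^ Q)%:E)%E.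
  apply: le_trans (vol_le x0 rho0); apply: le_measure; rewrite ?inE//.
  exact: measurable_distball.
have finA : mu A \is a fin_num.
  by rewrite ge0_fin_numE//; apply: le_lt_trans volA (ltry _).
have finA' : mu A' \is a fin_num.
  rewrite ge0_fin_numE//; apply: le_lt_trans (ltry (c2 * rho `^ Q)).
  apply: le_trans (vol_le x0 rho0); apply: le_measure; rewrite ?inE//.
  exact: measurable_distball.
(* The iteration starts at the level [k + M / 2] with the same height [M], the bound [u <= k + M]
   being weakened accordingly. It ends at [k + M / 2 + M / 4], which is [up - M / 4]. *)
have smallA' : (mu A' <= (eps1 * rho `^ Q)%:E)%E ->
    {ae mu, forall x, dist x x0 < rho / 4 -> u x <= up - lam / 4 * om}.
  move=> hA'; have kk : k <= k + M / 2 by rewrite lerDl ltW.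
  have uM' : {ae mu, forall x, dist x x0 < rho -> u x <= k + M / 2 + M}.
    by apply: filterS ukM => x h /h; move: M0; order_lra.
  have hT' := le_trans (integral_center_tail_le u x0 rho gg kk) hT.
  have := small p q g u x0 rho (k + M / 2) M gg mu_ rho0 M0 uM' hT' weak hA'.
  apply: filterS => x h /h; rewrite /k ME; order_lra.
move=> hE; apply: smallA'; move: volA hE.
rewrite -(fineK finA') -(fineK finA) -!EFinM !lee_fin.
set a' := fine (mu A'); set a := fine (mu A) => volA.
have a'0 : 0 <= a' by exact: fine_ge0.
have [t tE t0] : exists2 t, t = om / (16 * rho `^ s) & 0 < t.
  by exists (om / (16 * rho `^ s)); rewrite ?divr_gt0 ?mulr_gt0.
have gt0 : 0 < g t by exact: (growth_gt0 gg).
have gM : g (4 * M / rho `^ s) <= e * g t.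
  apply: le_trans (hlam g gg t (ltW t0)).
  rewrite (_ : 4 * M / _ = lam' * t)// ME lamE tE; field.
  by rewrite gt_eqF.
have gD : g t <= g ((M / 2 + D) / (2 * (2 * rho) `^ s)).
  apply: (growth_homo gg); first exact: ltW.
  have r2s : (2 * rho) `^ s <= 2 * rho `^ s.
    rewrite powRM ?(ltW rho0)// ler_wpM2r ?powR_ge0//; apply: ler1_powR; [by rewrite ler1n|exact: ltW].
  rewrite tE ler_pdivlMr ?mulr_gt0 ?powR_gt0// mulrAC ler_pdivrMr ?mulr_gt0//.
  apply: le_trans (_ : om * (2 * (2 * rho `^ s)) <= _).
    by rewrite ler_wpM2l ?(ltW om0)// ler_wpM2l.
  apply: le_trans (_ : om / 4 * (16 * rho `^ s) <= _).
    by rewrite le_eqVlt; apply/orP; left; apply/eqP; field.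
  by rewrite ler_wpM2r ?mulr_ge0 ?(ltW rs0)// /D; move: Mom om0; order_lra.
move=> hE.
pose X := g t / (2 * rho) `^ (Q + s) * (M / 2) * m.
have X0 : 0 < X.
  by rewrite /X mulr_gt0// mulr_gt0// divr_gt0// powR_gt0.
have h1 : a' * X <= c2 * rho `^ Q * (C3 * M * (e * g t) / rho `^ s).
  apply: le_trans (_ : a' * (g ((M / 2 + D) / (2 * (2 * rho) `^ s)) /
      (2 * rho) `^ (Q + s) * (M / 2) * m) <= _).
    rewrite ler_wpM2l// /X !ler_wpM2r ?(ltW m0) ?(ltW M20)//.
    by rewrite invr_ge0 powR_ge0.
  apply: (le_trans hE).
  have -> : C * M * (g (4 * M / rho `^ s) / rho `^ s +
      CT * (g (4 * M / rho `^ s) / rho `^ s)) = C3 * M * g (4 * M / rho `^ s) / rho `^ s.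
    by rewrite C3E; ring.
  have gM0 : 0 <= g (4 * M / rho `^ s).
    by rewrite (growth_ge0 gg)// divr_ge0 ?(ltW rs0)// mulr_ge0// ltW.
  have CM0 : 0 <= C3 * M by rewrite mulr_ge0 ?(ltW C30) ?(ltW M0).
  apply: ler_pM => //.
  - exact: fine_ge0.
  - by rewrite divr_ge0 ?(ltW rs0)// mulr_ge0.
  - by rewrite ler_wpM2r ?invr_ge0 ?(ltW rs0)// ler_wpM2l.
have h2 : c2 * rho `^ Q * (C3 * M * (e * g t) / rho `^ s) = eps1 * rho `^ Q * X.
  have rE : (2 * rho) `^ (Q + s) = K * (rho `^ Q * rho `^ s).
    rewrite KE powRM ?(ltW rho0)// [rho `^ (Q + s)]powRD//.
    by rewrite (gt_eqF rho0) implybT.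
  rewrite /X /m rE; apply: (mulIf (_ : 4 * K != 0)).
    by rewrite gt_eqF// mulr_gt0.
  rewrite [LHS](_ : _ = (e * (4 * c2 * C3 * K)) * (rho `^ Q * M * g t / rho `^ s)); last by ring.
  rewrite eE; field.
  by rewrite !gt_eqF.
by move: h1; rewrite h2 ler_pM2r.
Qed.

(** * Tails along the iteration and decay of the oscillation *)

Definition plain_tail (g : R -> R) (u : T -> R) x0 y : R :=
  g (`|u y| / dist y x0 `^ s) / dist y x0 `^ (Q + s).

Lemma plain_tail_ge0 p q g u x0 y : growth_function p q g ->
  0 <= plain_tail g u x0 y.
Proof.
by move=> gg; rewrite /plain_tail divr_ge0 ?powR_ge0// (growth_ge0 gg)// divr_ge0 ?powR_ge0.
Qed.

Lemma measurable_plain_tail p q g u x0 : growth_function p q g ->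
  measurable_fun setT u -> measurable_fun setT (plain_tail g u x0).
Proof.
move=> gg mu_.
apply: measurable_funM; last exact: (measurable_inv_powR _ (measurable_distl x0)).
apply: (measurable_growth gg) => [z|]; first by rewrite divr_ge0 ?powR_ge0.
apply: measurable_funM; first exact: measurableT_comp.
exact: (measurable_inv_powR _ (measurable_distl x0)).
Qed.

(** On the annulus [r <= dist < rho] the growth bound keeps the argument of [g] below
    [4 * M / r ^ s], and the kernel integrates to [CK / r ^ s]. Beyond [rho], the excess of [u] over
    [k] is at most [|u|] plus a term of the same growth; [growth_addE] separates the two, and two
    doublings lead back to the plain tail, whence [D ^+ 2]. The 1 in [CK + 1] pays for that tail. *)
Lemma center_tail_control p q D CK g (u : T -> R) x0 (rho r M k M1 : R) :
  (forall x (r : R), 0 < r -> (\int[mu]_y (kern x r y)%:E <= (CK / r `^ s)%:E)%E) ->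
  growth_function p q g -> (forall t : R, 0 <= t -> g (2 * t) <= D * g t) ->
  0 <= D -> measurable_fun setT u -> 0 < r -> r <= rho -> 0 < M ->
  {ae mu, forall y, dist y x0 < rho -> r <= dist y x0 ->
    u y - k <= 2 * M * (dist y x0 `^ s / r `^ s)} ->
  - k <= M * (rho `^ s / r `^ s) ->
  (\int[mu]_(y in ~` B x0 rho) (plain_tail g u x0 y)%:E <= (M1 / rho `^ s)%:E)%E ->
  D ^+ 2 * M1 <= g (4 * M / r `^ s) ->
  (\int[mu]_(y in ~` B x0 r) (center_tail g u x0 k y)%:E <=
   ((CK + 1) * (g (4 * M / r `^ s) / r `^ s))%:E)%E.
Proof.
move=> hCK gg hD D0 mu_ r0 rrho M0 hu hk hT hM1.
have s0 := s_gt0; have rho0 : 0 < rho := lt_le_trans r0 rrho.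
have rs0 : 0 < r `^ s by rewrite powR_gt0.
have rhos0 : 0 < rho `^ s by rewrite powR_gt0.
have rs : r `^ s <= rho `^ s by rewrite le_powR// ltW.
set c := g (4 * M / _) in hM1 *.
have c0 : 0 <= c.
  by rewrite (growth_ge0 gg)// divr_ge0 ?(ltW rs0)// mulr_ge0// ltW.
pose F y : \bar R := (c%:E * (kern x0 r y)%:E +
  (D ^+ 2)%:E * ((plain_tail g u x0 y)%:E * (\1_(~` B x0 rho) y)%:E))%E.
have pt0 y : 0 <= plain_tail g u x0 y by exact: (plain_tail_ge0 _ _ _ gg).
have k0 y : 0 <= kern x0 r y by rewrite kern_ge0// ltW.
have D20 : 0 <= D ^+ 2 by rewrite exprn_ge0.
have F0 y : (0 <= F y)%E.
  by rewrite /F -!EFinM -EFinD lee_fin addr_ge0// mulr_ge0// mulr_ge0.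
have pt1 y : (0 <= (plain_tail g u x0 y)%:E * (\1_(~` B x0 rho) y)%:E :> \bar R)%E.
  by rewrite -EFinM lee_fin mulr_ge0.
have mB : measurable (~` B x0 rho) by exact/measurableC/measurable_distball.
have mk : measurable_fun setT (fun y => (kern x0 r y)%:E : \bar R).
  exact/measurable_EFinP/measurable_kern.
have mpt : measurable_fun setT (fun y =>
    ((plain_tail g u x0 y)%:E * (\1_(~` B x0 rho) y)%:E : \bar R)%E).
  apply: emeasurable_funM; first exact/measurable_EFinP/(measurable_plain_tail _ gg).
  exact/measurable_EFinP/measurable_indic.
apply: le_trans (_ : (\int[mu]_y F y <= _)%E); last first.
  rewrite /F ge0_integralD//; last 4 first.
  - by move=> y _; rewrite mule_ge0// lee_fin.
  - exact: emeasurable_funM.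
  - by move=> y _; apply: mule_ge0 => //; rewrite lee_fin.
  - exact: emeasurable_funM.
  rewrite !ge0_integralZl_EFin//; last by move=> y _; rewrite lee_fin.
  have hT' : (\int[mu]_y ((plain_tail g u x0 y)%:E * (\1_(~` B x0 rho) y)%:E) <=
      (M1 / rho `^ s)%:E)%E.
    apply: le_trans hT; rewrite [leRHS]integral_mkcond.
    apply: ae_le_integral => // [y _|]; first by rewrite patchE; case: ifPn => // _; rewrite lee_fin.
    apply: aeW => y _; rewrite patchE indicE.
    by case: ifPn => _; rewrite ?mule1 ?mule0.
  apply: le_trans (leeD (lee_wpmul2l _ (hCK x0 r r0)) (lee_wpmul2l _ hT')) _;
    rewrite ?lee_fin//.
  have h1 : D ^+ 2 * (M1 / rho `^ s) <= c / r `^ s.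
    rewrite mulrA; apply: le_trans (_ : c / rho `^ s <= _).
      by rewrite ler_wpM2r// invr_ge0 ltW.
    by rewrite ler_wpM2l// lef_pV2.
  by move: h1; rewrite mulrDl mul1r mulrCA; lra.
rewrite [leLHS]integral_mkcond; apply: ae_le_integral => [y _|y _//|].
  rewrite patchE; case: ifPn => // _.
  by rewrite lee_fin (center_tail_ge0 _ _ _ _ gg).
apply: filterS hu => y huy _; rewrite patchE; case: ifPn => // /set_mem /= /negP.
rewrite -leNgt => ry.
have dy0 : 0 < dist y x0 := lt_le_trans r0 ry.
have ds0 : 0 < dist y x0 `^ s by rewrite powR_gt0.
have -> : F y = (c / dist y x0 `^ (Q + s) +
    D ^+ 2 * (plain_tail g u x0 y * \1_(~` B x0 rho) y))%:E.
  by rewrite /F -!EFinM -EFinD /kern min_l ?mul1r// ler_pdivlMr// mul1r.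
rewrite lee_fin.
have max0 : 0 <= Num.max 0 (u y - k) by rewrite le_max lexx.
have [yrho|rhoy] := ltP (dist y x0) rho.
  rewrite (@indic_notin _ _ (~` B x0 rho)) ?mulr0 ?addr0; last by apply.
  rewrite /center_tail ler_wpM2r ?invr_ge0 ?powR_ge0//.
  apply: (growth_homo gg); first by rewrite divr_ge0 ?(ltW ds0)// mulr_ge0.
  rewrite ler_pdivrMr//.
  have h2 : 4 * M / r `^ s * dist y x0 `^ s = 2 * (2 * M * (dist y x0 `^ s / r `^ s)).
    by ring.
  rewrite h2 ler_wpM2l// ge_max (huy yrho ry) andbT.
  by rewrite mulr_ge0 ?divr_ge0 ?(ltW ds0) ?(ltW rs0)// mulr_ge0// ltW.
rewrite (@indic_in _ _ (~` B x0 rho)) ?mulr1; last by apply/negP; rewrite -leNgt.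
rewrite /center_tail /plain_tail mulrA -mulrDl ler_wpM2r ?invr_ge0 ?powR_ge0//.
have ud0 : 0 <= `|u y| / dist y x0 `^ s by rewrite divr_ge0 ?(ltW ds0).
have Mr0 : 0 <= M / r `^ s by rewrite divr_ge0 ?(ltW M0) ?(ltW rs0).
apply: le_trans (_ : g (2 * (`|u y| / dist y x0 `^ s) + 2 * (M / r `^ s)) <= _).
  apply: (growth_homo gg); first by rewrite divr_ge0 ?(ltW ds0)// mulr_ge0.
  rewrite -mulrDr -mulrA ler_wpM2l// ler_pdivrMr// mulrDl divfK ?gt_eqF//.
  have hd : M * (rho `^ s / r `^ s) <= M / r `^ s * dist y x0 `^ s.
    rewrite (mulrC (rho `^ s)) mulrA ler_wpM2l//.
    by rewrite le_powR// ltW.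
  rewrite ge_max; apply/andP; split.
    by rewrite addr_ge0// mulr_ge0// ltW.
  by have := ler_norm (u y); lra.
apply: (le_trans (growth_addE gg (mulr_ge0 (ler0n R 2) ud0) (mulr_ge0 (ler0n R 2) Mr0))).
rewrite addrC lerD//.
  by rewrite (_ : 2 * (2 * (M / _)) = 4 * M / r `^ s)//; ring.
apply: (le_trans (hD _ _)); first by rewrite mulr_ge0.
by rewrite expr2 -mulrA ler_wpM2l// hD.
Qed.

(** At a fixed distance beyond [r], the allowance [2 * (lam * om) * (dist / r) ^ s] is multiplied by
    [4 * (1 - lam / 4)], at least [15 / 4], while the left-hand side rises by at most
    [lam / 4 * om]. On the new annulus [r' <= dist < r] the bound [v <= up] is enough. *)
Lemma tail_invariant_step (v : T -> R) x0 (rho r r' lam om om' up up' b : R) :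
  0 < r -> 0 < r' -> r' `^ s = r `^ s / 4 -> 0 < lam <= 4^-1 ->
  0 < om -> om' = (1 - lam / 4) * om -> 1 <= b ->
  up - lam / 4 * om <= up' <= up ->
  {ae mu, forall y, dist y x0 < r -> v y <= up} ->
  {ae mu, forall y, dist y x0 < rho -> r <= dist y x0 ->
    v y - (up - lam * om) <= 2 * (lam * om) * (dist y x0 `^ s / r `^ s)} ->
  - (up - lam * om) <= lam * om * b ->
  {ae mu, forall y, dist y x0 < rho -> r' <= dist y x0 ->
    v y - (up' - lam * om') <= 2 * (lam * om') * (dist y x0 `^ s / r' `^ s)} /\
  - (up' - lam * om') <= lam * om' * (4 * b).
Proof.
move=> r0 r'0 r's /andP[lam0 lam1] om0 om'E b1 /andP[upl upu] vup vfar hk.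
have s0 := s_gt0; have rs0 : 0 < r `^ s by rewrite powR_gt0.
have lo0 : 0 < lam * om by rewrite mulr_gt0.
have lo' : 15 / 16 * (lam * om) <= lam * om' <= lam * om.
  have : lam * (lam * om) <= 4^-1 * (lam * om) by rewrite ler_wpM2r// ltW.
  have : 0 <= lam * (lam * om) by rewrite mulr_ge0// ltW.
  by rewrite om'E (_ : lam * ((1 - lam / 4) * om) = lam * om - lam * (lam * om) / 4);
    [lra|ring].
have /andP[lo'1 lo'2] := lo'.
split; last first.
  have : 15 / 16 * (lam * om) * (4 * b) <= lam * om' * (4 * b).
    by rewrite ler_wpM2r//; lra.
  have : lam * om * 1 <= lam * om * b by rewrite ler_wpM2l// ltW.
  lra.
near=> y => yrho yr'.
have dr' : 1 <= dist y x0 `^ s / r' `^ s.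
  by rewrite ler_pdivlMr ?powR_gt0// mul1r le_powR// ltW.
have [yr|ry] := ltP (dist y x0) r.
  have vy : v y <= up by move: yr; near: y.
  have : 15 / 16 * (lam * om) * 1 <= lam * om' * (dist y x0 `^ s / r' `^ s).
    by rewrite ler_pM//; lra.
  lra.
have vy : v y - (up - lam * om) <= 2 * (lam * om) * (dist y x0 `^ s / r `^ s).
  by move: yrho ry; near: y.
have e : dist y x0 `^ s / r' `^ s = 4 * (dist y x0 `^ s / r `^ s).
  by rewrite r's; field; rewrite gt_eqF.
have d1 : 1 <= dist y x0 `^ s / r `^ s.
  by rewrite ler_pdivlMr ?powR_gt0// mul1r le_powR// ltW.
rewrite e; move: d1 vy; move: (dist y x0 `^ s / r `^ s) => z z1 vy.
have : 15 / 16 * (lam * om) * z <= lam * om' * z by rewrite ler_wpM2r//; lra.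
have : lam * om * 1 <= lam * om * z by rewrite ler_wpM2l// ltW.
lra.
Unshelve. all: by end_near. Qed.

(** Pigeonhole with the guaranteed volume. The second alternative is written for [- u], to which the
    improvement of the upper bound is then applied, raising the lower bound of [u]. *)
Lemma half_of_ball (u : T -> R) x0 (r mid : R) : measurable_fun setT u -> 0 < r ->
  ((c1 / 2 * r `^ Q)%:E <= mu (B x0 r `&` [set y | (u y <= mid)%R]))%E \/
  ((c1 / 2 * r `^ Q)%:E <= mu (B x0 r `&` [set y | (- u y <= - mid)%R]))%E.
Proof.
move=> mu_ r0.
have [|lt1] := leP (c1 / 2 * r `^ Q)%:E (mu (B x0 r `&` [set y | (u y <= mid)%R])).
  by left.
right; have m1 : measurable (B x0 r `&` [set y | (u y <= mid)%R]).
  by apply: measurableI; [exact: measurable_distball|exact: measurable_set_le].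
have m2 : measurable (B x0 r `&` [set y | (- u y <= - mid)%R]).
  apply: measurableI; first exact: measurable_distball.
  by apply: measurable_set_le => //; exact: measurableT_comp.
have sub : B x0 r `<=` (B x0 r `&` [set y | (u y <= mid)%R]) `|`
    (B x0 r `&` [set y | (- u y <= - mid)%R]).
  move=> y By; have [uy|/ltW uy] := leP (u y) mid; [by left|right; split => //=].
  by rewrite lerN2.
have : (mu (B x0 r) <= mu (B x0 r `&` [set y | (u y <= mid)%R]) +
    mu (B x0 r `&` [set y | (- u y <= - mid)%R]))%E.
  apply: le_trans (measureU2 _ m1 m2); apply: le_measure; rewrite ?inE//.
  - exact: measurable_distball.
  - exact: measurableU.
move=> /(le_trans (vol_ge x0 r0)) h.
rewrite leNgt; apply/negP => lt2.
have := le_lt_trans h (lteD lt1 lt2).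
by rewrite -EFinD lte_fin -mulrDl -mulrDl -mulr2n -[c1 *+ 2]mulr_natr mulfK// ltxx.
Qed.

(** The induction carries an essential interval for [u] and the tail invariant for both [u] and
    [- u]; the occupied half of the ball decides which endpoint moves by [lam / 4] of the length. *)
Lemma oscillation_decay p q : 1 < p -> exists tau sg K0 : R,
  [/\ 15 / 16 <= tau < 1, 0 < sg <= 4^-1, 0 < K0 &
  forall g (u : T -> R) x0 (rho om0 : R),
  growth_function p q g -> measurable_fun setT u -> 0 < rho -> 0 < om0 ->
  {ae mu, forall x, dist x x0 < rho -> `|u x| <= om0 / 2} ->
  (\int[mu]_(y in ~` B x0 rho) (plain_tail g u x0 y)%:E <=
    (g (om0 / (K0 * rho `^ s)) / rho `^ s)%:E)%E ->
  (forall r, 0 < r <= rho ->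
    weak_on g u x0 r /\ weak_on g (fun x => - u x) x0 r) ->
  forall i : nat, exists lo up : R, up - lo = tau ^+ i * om0 /\
    {ae mu, forall x, dist x x0 < sg ^+ i * rho -> lo <= u x <= up}].
Proof.
move=> p1; have s0 := s_gt0; have s1 := s_lt1.
have [CK CK0 hCK] := integral_kern.
have CT0 : 0 <= CK + 1 by lra.
have [D D1 hD] := growth_doubling q p1.
have [lam /andP[lam0 lam1] improve] := upper_bound_improvement q p1 CT0.
have D20 : 0 < (D ^+ 2)^-1 by rewrite invr_gt0 exprn_gt0// (lt_le_trans ltr01).
have [lam2 /andP[lam20 lam21] hlam2] := growth_small q p1 D20.
have [tau tauE] : exists tau : R, tau = 1 - lam / 4 by exists (1 - lam / 4).
have tau1 : 15 / 16 <= tau < 1 by rewrite tauE; move: lam0 lam1; order_lra.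
have tau0 : 0 < tau by move: tau1; order_lra.
(* As [sg ^ s = 1 / 4], the oscillation divided by the power [s] of the radius grows by
   [4 * tau >= 1] per step, so the initial smallness of the tail persists. The bound [sg <= 1 / 4]
   is there because the improvement holds on a quarter of the radius. *)
have [sg [sg0 sg1 sgs]] : exists sg : R, [/\ 0 < sg, sg <= 4^-1 & sg `^ s = 4^-1].
  have q4 : 0 < (4^-1 : R) <= 1 by order_lra.
  exists (4^-1 `^ s^-1); split.
  - by rewrite powR_gt0 ?invr_gt0.
  - by apply: ge1r_powR => //; rewrite invf_ge1// ltW.
  - by rewrite -powRrM mulVf ?gt_eqF// powRr1//; lra.
have lamlam0 : 0 < 4 * lam * lam2 by rewrite !mulr_gt0.
(* With this [K0] the tail is bounded by [g] at [lam2] times the argument [4 * lam * om0 / rho ^ s],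
   and [lam2] absorbs the [D ^+ 2] of [center_tail_control]. *)
have [K0 K0E K00] : exists2 K0, K0 = (4 * lam * lam2)^-1 & 0 < K0.
  by exists (4 * lam * lam2)^-1; rewrite ?invr_gt0.
exists tau, sg, K0; split => //; first by rewrite sg0.
move=> g u x0 rho om0 gg mu_ rho0 om00 uom hT weak.
have mNu : measurable_fun setT (fun x => - u x) by exact: measurableT_comp.
have rhos0 : 0 < rho `^ s by rewrite powR_gt0.
pose om (i : nat) := tau ^+ i * om0; pose rr (i : nat) := sg ^+ i * rho.
have omS i : om i.+1 = (1 - lam / 4) * om i by rewrite /om exprS -mulrA tauE.
have omi0 i : 0 < om i by rewrite mulr_gt0// exprn_gt0.
have rr0 i : 0 < rr i by rewrite mulr_gt0// exprn_gt0.
have rrS i : rr i.+1 = sg * rr i by rewrite /rr exprS -mulrA.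
have rrle i : rr i <= rho.
  by rewrite ler_piMl ?(ltW rho0)// exprn_ile1 ?(ltW sg0)//; move: sg1; order_lra.
have rrs i : rr i `^ s = rho `^ s / 4 ^+ i.
  by rewrite powRM ?exprn_ge0 ?(ltW sg0) ?(ltW rho0)// powR_exprn ?(ltW sg0)// sgs exprVn mulrC.
have four1 i : 1 <= 4 ^+ i :> R by rewrite exprn_ege1// ler1n.
have rsr i : rho `^ s / rr i `^ s = 4 ^+ i.
  by rewrite rrs invf_div mulrCA divff ?mulr1 ?gt_eqF.
(* [4 ^+ i] is [(rho / rr i) ^ s]. At [i = 0] the annulus is empty and the first half is vacuous. *)
pose J (v : T -> R) up i := {ae mu, forall y, dist y x0 < rho -> rr i <= dist y x0 ->
    v y - (up - lam * om i) <= 2 * (lam * om i) * (dist y x0 `^ s / rr i `^ s)} /\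
  - (up - lam * om i) <= lam * om i * 4 ^+ i.
have Jstep v up up' i : {ae mu, forall y, dist y x0 < rr i -> v y <= up} ->
    up - lam / 4 * om i <= up' <= up -> J v up i -> J v up' i.+1.
  move=> vup upup [J1 J2]; rewrite /J exprS.
  apply: (tail_invariant_step (r := rr i) (om := om i) (up := up)) => //.
  - by rewrite !rrs exprSr invfM mulrA.
  - by rewrite lam0.
have Jimprove v up i : measurable_fun setT v -> weak_on g v x0 (rr i) ->
    (forall y, `|v y| = `|u y|) ->
    {ae mu, forall y, dist y x0 < rr i -> v y <= up} -> J v up i ->
    ((c1 / 2 * rr i `^ Q)%:E <= mu (B x0 (rr i) `&` [set y | (v y <= up - om i / 2)%R]))%E ->
    {ae mu, forall y, dist y x0 < rr i.+1 -> v y <= up - lam / 4 * om i}.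
  move=> mv wv vu vup [J1 J2] half.
  have hTv : (\int[mu]_(y in ~` B x0 rho) (plain_tail g v x0 y)%:E <=
      (g (om0 / (K0 * rho `^ s)) / rho `^ s)%:E)%E.
    by apply: le_trans hT; under eq_integral do rewrite /plain_tail vu.
  have lom0 : 0 < lam * om i by rewrite mulr_gt0.
  have J2' : - (up - lam * om i) <= lam * om i * (rho `^ s / rr i `^ s) by rewrite rsr.
  have hM1 : D ^+ 2 * g (om0 / (K0 * rho `^ s)) <= g (4 * (lam * om i) / rr i `^ s).
    have t0 : 0 <= 4 * (lam * om i) / rr i `^ s.
      by rewrite divr_ge0 ?powR_ge0// mulr_ge0// ltW.
    have h := hlam2 g gg _ t0.
    have {}h : D ^+ 2 * g (lam2 * (4 * (lam * om i) / rr i `^ s)) <=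
        g (4 * (lam * om i) / rr i `^ s).
      by rewrite -ler_pdivlMl// exprn_gt0// (lt_le_trans ltr01).
    apply: le_trans h; rewrite ler_wpM2l ?exprn_ge0//; first exact: le_trans ler01 D1.
    apply: (growth_homo gg).
      by rewrite divr_ge0 ?(ltW om00)// mulr_ge0 ?(ltW K00) ?(ltW rhos0).
    rewrite rrs /om K0E.
    rewrite (_ : om0 / _ = 4 * lam * lam2 * om0 / rho `^ s); last first.
      by field; rewrite !gt_eqF.
    rewrite (_ : lam2 * _ = 4 * lam * lam2 * om0 / rho `^ s * (4 * tau) ^+ i); last first.
      by rewrite exprMn; field; rewrite !gt_eqF// exprn_gt0.
    rewrite ler_peMr//.
      by rewrite divr_ge0 ?(ltW rhos0)// mulr_ge0 ?(ltW lamlam0) ?(ltW om00).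
    by rewrite exprn_ege1//; move: tau1; order_lra.
  have := center_tail_control hCK gg (fun t t0 => (hD g gg t t0).1) _ mv
    (rr0 i) (rrle i) lom0 J1 J2' hTv hM1.
  move=> /(_ (le_trans ler01 D1)) hC.
  have := improve g v x0 (rr i) (om i) up gg mv (rr0 i) (omi0 i) vup hC wv half.
  apply: filterS => y hy yr; apply: hy; apply: (lt_le_trans yr).
  by rewrite rrS mulrC ler_pM2l.
suff : forall i, exists lo up, [/\ up - lo = om i,
    {ae mu, forall x, dist x x0 < rr i -> lo <= u x <= up},
    J u up i & J (fun x => - u x) (- lo) i].
  by move=> + i => /(_ i)[lo [up [h1 h2 _ _]]]; exists lo, up.
elim=> [|i [lo [up [uplo ulu Ju JNu]]]].
  exists (- (om0 / 2)), (om0 / 2).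
  have rr00 : rr 0%N = rho by rewrite /rr expr0 mul1r.
  have om000 : om 0%N = om0 by rewrite /om expr0 mul1r.
  have lam00 : 0 < lam * om0 by rewrite mulr_gt0.
  have J0 v : J v (om0 / 2) 0%N.
    split; first by apply: aeW => y; rewrite rr00 => h1 h2; move: h1; rewrite ltNge h2.
    by rewrite om000 expr0; move: lam00 om00; order_lra.
  split; first by rewrite om000; order_lra.
  - by apply: filterS uom => x h; rewrite rr00 => /h; rewrite ler_norml.
  - exact: J0.
  - by rewrite opprK; exact: J0.
have [wu wNu] := weak (rr i) (ltac:(by rewrite rr0 rrle)).
have uup : {ae mu, forall y, dist y x0 < rr i -> u y <= up}.
  by apply: filterS ulu => y h /h /andP[].
have Nulo : {ae mu, forall y, dist y x0 < rr i -> - u y <= - lo}.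
  by apply: filterS ulu => y h /h /andP[h1 _]; rewrite lerN2.
have rlt i' y : dist y x0 < rr i'.+1 -> dist y x0 < rr i'.
  move=> /lt_le_trans; apply; rewrite rrS ler_piMl ?(ltW (rr0 _))//; move: sg1; order_lra.
have lom0 : 0 < lam * om i by rewrite mulr_gt0.
have [half|half] := half_of_ball x0 (up - om i / 2) mu_ (rr0 i).
  exists lo, (up - lam / 4 * om i); split.
  - by rewrite omS; move: uplo; order_lra.
  - have := Jimprove u up i mu_ wu (fun=> erefl) uup Ju half.
    apply: filterS2 ulu => y h1 h2 yr; rewrite h2// andbT.
    by have /andP[] := h1 (rlt _ _ yr).
  - by apply: Jstep uup _ Ju; move: lom0; order_lra.
  - by apply: Jstep Nulo _ JNu; move: lom0; order_lra.
exists (lo + lam / 4 * om i), up; split.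
- by rewrite omS; move: uplo; order_lra.
- have half' : ((c1 / 2 * rr i `^ Q)%:E <=
      mu (B x0 (rr i) `&` [set y | (- u y <= - lo - om i / 2)%R]))%E.
    by rewrite (_ : - lo - om i / 2 = - (up - om i / 2))//; move: uplo; order_lra.
  have := Jimprove _ (- lo) i mNu wNu (fun y => normrN _) Nulo JNu half'.
  apply: filterS2 ulu => y h1 h2 yr; have := h2 yr.
  by have /andP[_ ->] := h1 (rlt _ _ yr); rewrite andbT; order_lra.
- by apply: Jstep uup _ Ju; move: lom0; order_lra.
- by apply: Jstep Nulo _ JNu; move: lom0; order_lra.
Qed.

(** * Finite energy of the test functions *)

Definition gagliardo_integrand (g : R -> R) (u : T -> R) (z : T * T) : R :=
  primitive g (`|u z.1 - u z.2| / dist z.1 z.2 `^ s) / dist z.1 z.2 `^ Q.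

Lemma gagliardo_integrand_ge0 p q g u z : growth_function p q g ->
  0 <= gagliardo_integrand g u z.
Proof.
move=> gg; rewrite /gagliardo_integrand divr_ge0 ?powR_ge0//.
by rewrite (primitive_ge0 gg)// divr_ge0 ?powR_ge0.
Qed.

Lemma measurable_gagliardo_integrand p q g u : growth_function p q g ->
  measurable_fun setT u -> measurable_fun setT (gagliardo_integrand g u).
Proof.
move=> gg mu_; apply: measurable_funM; last exact: measurable_inv_powR.
apply: (measurable_primitive gg) => [z|]; first by rewrite divr_ge0 ?powR_ge0.
apply: measurable_funM; last exact: measurable_inv_powR.
apply: measurableT_comp => //; apply: measurable_funB.
  exact: (measurableT_comp mu_).
exact: (measurableT_comp mu_).
Qed.

Lemma level_test_lip u x0 rho k M x y : 0 <= M ->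
  `|level_test u x0 rho k M x - level_test u x0 rho k M y| <=
  `|u x - u y| + `|M * barrier x0 rho x - M * barrier x0 rho y|.
Proof.
move=> M0; rewrite /level_test; move: (M * barrier x0 rho x) (M * barrier x0 rho y) => a b.
have maxlip (v w : R) : `|Num.max 0 v - Num.max 0 w| <= `|v - w|.
  by rewrite /Num.max; case: ltP => ?; case: ltP => ?; rewrite ler_norml;
    have := ler_norm (v - w); have := ler_norm (- (v - w)); rewrite normrN; lra.
have minlip (v w c : R) : `|Num.min v c - Num.min w c| <= `|v - w|.
  by rewrite /Num.min; case: ltP => ?; case: ltP => ?; rewrite ler_norml;
    have := ler_norm (v - w); have := ler_norm (- (v - w)); rewrite normrN; lra.
apply: (le_trans (maxlip _ _)).
rewrite (_ : _ - _ = (Num.min (u x) (k + M) - Num.min (u y) (k + M)) - (a - b)); last by ring.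
by apply: (le_trans (ler_normB _ _)); rewrite lerD2r.
Qed.

(** The level test varies by at most the variation of [u] plus that of the barrier. Doubling of [G]
    separates the two, and [G t <= t * g t] turns the barrier part into the expression bounded by
    [growth_barrier]. *)
Lemma gagliardo_level_test p q D g u x0 (rho k M : R) x y : growth_function p q g ->
  (forall t : R, 0 <= t -> primitive g (2 * t) <= D * primitive g t) ->
  0 < rho -> 0 < M ->
  gagliardo_integrand g (level_test u x0 rho k M) (x, y) <=
  D * gagliardo_integrand g u (x, y) +
  D * (g (4 * M / rho `^ s) * M * kern x (rho / 4) y).
Proof.
move=> gg hD rho0 M0.
have D0 : 0 <= D.
  have := hD 1 ler01; have := primitive_gt0 gg (ltr01); rewrite mulr1.
  have := primitive_gt0 gg (ltr0Sn R 1) => h2 h1 h.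
  by rewrite -(pmulr_lge0 _ h1) (le_trans _ h)// ltW.
set e := M * barrier x0 rho x - M * barrier x0 rho y.
have ds0 : 0 <= dist x y `^ s by exact: powR_ge0.
have a0 : 0 <= `|u x - u y| / dist x y `^ s by rewrite divr_ge0.
have b0 : 0 <= `|e| / dist x y `^ s by rewrite divr_ge0.
have h1 : primitive g (`|level_test u x0 rho k M x - level_test u x0 rho k M y| /
    dist x y `^ s) <= D * primitive g (`|u x - u y| / dist x y `^ s) +
      D * primitive g (`|e| / dist x y `^ s).
  apply: le_trans (_ : primitive g (`|u x - u y| / dist x y `^ s +
      `|e| / dist x y `^ s) <= _).
    apply: (primitive_homo gg); first by rewrite divr_ge0.
    rewrite -mulrDl ler_wpM2r ?invr_ge0//.
    by apply: level_test_lip; exact: ltW.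
  move: (`|u x - u y| / _) a0 => a a0; move: (`|e| / _) b0 => b b0.
  have [ab|/ltW ba] := leP a b.
    apply: le_trans (_ : primitive g (2 * b) <= _).
      by apply: (primitive_homo gg); [rewrite addr_ge0|lra].
    by rewrite ler_wpDl ?hD// mulr_ge0// (primitive_ge0 gg).
  apply: le_trans (_ : primitive g (2 * a) <= _).
    by apply: (primitive_homo gg); [rewrite addr_ge0|lra].
  by rewrite ler_wpDr ?hD// mulr_ge0// (primitive_ge0 gg).
rewrite /gagliardo_integrand/=.
apply: le_trans (ler_wpM2r _ h1) _; first by rewrite invr_ge0 powR_ge0.
rewrite mulrDl -!(mulrA D) lerD2l ler_wpM2l//.
apply: le_trans _ (growth_barrier gg rho0 (ltW M0) (erefl e)).
rewrite (distC y x); have [d0|d0] := eqVneq (dist x y) 0.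
  rewrite d0 powR0 ?gt_eqF// invr0 mulr0 (primitive0) mul0r.
  by rewrite mulr_ge0// divr_ge0 ?powR_ge0// (growth_ge0 gg)// mulr0.
rewrite powRD ?d0 ?implybT// [leRHS](_ : _ = `|e| / dist x y `^ s *
    g (`|e| / dist x y `^ s) / dist x y `^ Q); last by rewrite invfM; ring.
by rewrite ler_wpM2r ?invr_ge0 ?powR_ge0// (primitive_le gg).
Qed.

(** Pairs that miss the ball contribute nothing. [C] carries no measurability assumption, so the
    bounding functions are cut off by indicators of cylinders over the ball, which are measurable
    and contained in [C]; the two barrier parts are integrated by Tonelli, each in its own order. *)
Lemma level_test_energy p q g u x0 (rho k M : R) (C : set (T * T)) : 1 < p ->
  growth_function p q g -> measurable_fun setT u -> 0 < rho -> 0 < M ->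
  (forall x y, dist x x0 < rho -> C (x, y) /\ C (y, x)) ->
  (\int[mu \x mu]_(z in C) (gagliardo_integrand g u z)%:E < +oo)%E ->
  (\int[mu \x mu]_(z in C)
    (gagliardo_integrand g (level_test u x0 rho k M) z)%:E < +oo)%E.
Proof.
move=> p1 gg mu_ rho0 M0 BC hu.
have [CK CK0 hCK] := integral_kern.
have [D D1 hD] := growth_doubling q p1.
have D0 : 0 <= D by lra.
have rho40 : 0 < rho / 4 by lra.
set psi := level_test u x0 rho k M.
pose c := D * (g (4 * M / rho `^ s) * M).
have c0 : 0 <= c.
  rewrite mulr_ge0// mulr_ge0 ?(ltW M0)// (growth_ge0 gg)// divr_ge0 ?powR_ge0//.
  by rewrite mulr_ge0// ltW.
have gu0 z : 0 <= gagliardo_integrand g u z by exact: (gagliardo_integrand_ge0 _ _ gg).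
have k0 z : 0 <= kern z.1 (rho / 4) z.2 by rewrite kern_ge0// ltW.
pose S := B x0 rho `*` setT `|` setT `*` B x0 rho : set (T * T).
have mS : measurable S.
  by apply: measurableU; apply: measurableX => //; exact: measurable_distball.
pose F1 z := D * (gagliardo_integrand g u z * \1_S z) : R.
pose F2 (z : T * T) := c * (\1_(B x0 rho) z.1 * kern z.1 (rho / 4) z.2) : R.
pose F3 (z : T * T) := c * (\1_(B x0 rho) z.2 * kern z.2 (rho / 4) z.1) : R.
have F10 z : 0 <= F1 z by rewrite mulr_ge0// mulr_ge0.
have F20 z : 0 <= F2 z by rewrite mulr_ge0// mulr_ge0.
have F30 z : 0 <= F3 z by rewrite mulr_ge0// mulr_ge0// (k0 (z.2, z.1)).
have mB : measurable_fun setT (\1_(B x0 rho) : T -> R).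
  exact/measurable_indic/measurable_distball.
have mF1 : measurable_fun setT (EFin \o F1).
  apply/measurable_EFinP/measurable_funM => //; apply: measurable_funM.
    exact: (measurable_gagliardo_integrand gg).
  exact: measurable_indic.
have mf2 : measurable_fun setT F2.
  apply: measurable_funM => //; apply: measurable_funM; last exact: measurable_pair_kern.
  exact: (@measurableT_comp _ _ _ _ _ _ (\1_(B x0 rho) : T -> R)).
have mF2 : measurable_fun setT (EFin \o F2) by exact/measurable_EFinP.
have mF3 : measurable_fun setT (EFin \o F3).
  apply/measurable_EFinP; exact: (measurableT_comp mf2 (measurable_fun_pair msnd mfst)).
have cI0 x : 0 <= c * \1_(B x0 rho) x by rewrite mulr_ge0.
have kE0 x y : (0 <= (kern x (rho / 4) y)%:E)%E by rewrite lee_fin (k0 (x, y)).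
have mkE x : measurable_fun setT (fun y => (kern x (rho / 4) y)%:E : \bar R).
  exact/measurable_EFinP/measurable_kern.
have mBE : measurable_fun setT (fun x => (\1_(B x0 rho) x)%:E : \bar R).
  exact/measurable_EFinP.
have cK0 : 0 <= c * (CK / (rho / 4) `^ s).
  by rewrite mulr_ge0// divr_ge0 ?powR_ge0// ltW.
have kern_bd x : (\int[mu]_y (c * (\1_(B x0 rho) x * kern x (rho / 4) y))%:E <=
    (c * (CK / (rho / 4) `^ s))%:E * (\1_(B x0 rho) x)%:E)%E.
  under eq_integral do rewrite mulrA EFinM.
  rewrite ge0_integralZl_EFin//.
  apply: le_trans (lee_wpmul2l _ (hCK x _ rho40)) _; first by rewrite lee_fin mulr_ge0.
  by rewrite -!EFinM lee_fin mulrAC.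
have fin23 : (\int[mu]_x \int[mu]_y (c * (\1_(B x0 rho) x * kern x (rho / 4) y))%:E < +oo)%E.
  apply: le_lt_trans (_ : (\int[mu]_x ((c * (CK / (rho / 4) `^ s))%:E *
      (\1_(B x0 rho) x)%:E) < _)%E).
    apply: ae_le_integral => [x _|x _|].
    - apply: integral_ge0 => y _; rewrite lee_fin mulr_ge0// mulr_ge0//.
      exact: (k0 (x, y)).
    - by rewrite -EFinM lee_fin mulr_ge0.
    - by apply: aeW => x _; exact: kern_bd.
  rewrite ge0_integralZl_EFin//.
  rewrite integral_indic ?setIT//; last exact: measurable_distball.
  rewrite lte_mul_pinfty ?lee_fin//.
  by apply: le_lt_trans (vol_le x0 rho0) (ltry _).
apply: (@le_lt_trans _ _ (\int[mu \x mu]_z ((F1 z)%:E + ((F2 z)%:E + (F3 z)%:E)))%E).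
  rewrite [leLHS]integral_mkcond; apply: ae_le_integral => [z _|z _|].
  - rewrite patchE; case: ifPn => // _.
    by rewrite lee_fin (gagliardo_integrand_ge0 _ _ gg).
  - by rewrite -!EFinD lee_fin !addr_ge0.
  apply: aeW => -[x y] _; rewrite patchE -!EFinD.
  case: ifPn => _; last by rewrite lee_fin !addr_ge0.
  rewrite lee_fin.
  have [Bx|nBx] := pselect (dist x x0 < rho).
    apply: (le_trans (gagliardo_level_test u x0 k x y gg (fun t t0 => (hD g gg t t0).2) rho0 M0)).
    rewrite /F1 (@indic_in _ _ S) ?mulr1; last by left.
    rewrite lerD2l /F2 (@indic_in _ _ (B x0 rho))// mul1r mulrA lerDl.
    exact: F30.
  have [By|nBy] := pselect (dist y x0 < rho).
    apply: (le_trans (gagliardo_level_test u x0 k x y gg (fun t t0 => (hD g gg t t0).2) rho0 M0)).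
    rewrite /F1 (@indic_in _ _ S) ?mulr1; last by right.
    rewrite lerD2l /F3 (@indic_in _ _ (B x0 rho) y)// mul1r mulrA.
    by rewrite [in leLHS]/kern distC lerDr.
  have psi0 v : ~ dist v x0 < rho -> psi v = 0.
    move=> nv; apply: level_test_eq0 => //; first exact: ltW.
    by move=> [_ /= h]; apply: nv; lra.
  rewrite /gagliardo_integrand/= !psi0// subrr normr0 mul0r (primitive0) mul0r.
  by rewrite !addr_ge0.
have mF23 : measurable_fun setT (fun z => (F2 z)%:E + (F3 z)%:E : \bar R)%E.
  exact: emeasurable_funD.
rewrite ge0_integralD//; last 2 first.
- by move=> z _; rewrite lee_fin.
- by move=> z _; rewrite -EFinD lee_fin addr_ge0.
apply: lte_add_pinfty.
  rewrite /F1; under eq_integral do rewrite EFinM.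
  have gS0 z : (0 <= (gagliardo_integrand g u z * \1_S z)%:E)%E by rewrite lee_fin mulr_ge0.
  have mgS : measurable_fun setT (fun z => (gagliardo_integrand g u z * \1_S z)%:E : \bar R).
    apply/measurable_EFinP/measurable_funM; first exact: (measurable_gagliardo_integrand gg).
    exact: measurable_indic.
  rewrite ge0_integralZl_EFin//.
  rewrite lte_mul_pinfty ?lee_fin//; apply: le_lt_trans hu.
  rewrite [leRHS]integral_mkcond; apply: ae_le_integral => [z _|z _|].
  - by rewrite lee_fin mulr_ge0.
  - by rewrite patchE; case: ifPn => // _; rewrite lee_fin.
  apply: aeW => -[x y] _; rewrite patchE; case: ifPn => [_|/negP nC].
    by rewrite lee_fin indicE; case: (_ \in _); rewrite ?mulr1 ?mulr0.
  rewrite indicE memNset ?mulr0// => -[[/= Bx _]|[_ /= By]].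
    by apply: nC; rewrite inE; exact: (BC _ _ Bx).1.
  by apply: nC; rewrite inE; exact: (BC _ _ By).2.
rewrite ge0_integralD//; last 2 first.
- by move=> z _; rewrite lee_fin.
- by move=> z _; rewrite lee_fin.
apply: lte_add_pinfty.
  rewrite (@fubini_tonelli1 _ _ _ _ _ mu mu _ mF2)// => z; by rewrite lee_fin.
rewrite (@fubini_tonelli2 _ _ _ _ _ mu mu _ mF3)// => z; by rewrite lee_fin.
Qed.

End ahlfors_regular.

(** * The Heisenberg group *)

Lemma planar_cauchy_schwarz (R : realType) (a b c d m1 m2 : R) :
  0 <= m1 -> 0 <= m2 -> a ^+ 2 + b ^+ 2 <= m1 ^+ 2 -> c ^+ 2 + d ^+ 2 <= m2 ^+ 2 ->
  a * c + b * d <= m1 * m2.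
Proof.
move=> m10 m20 h1 h2; rewrite leNgt; apply/negP => h.
have m0 : 0 <= m1 * m2 by rewrite mulr_ge0.
have : (m1 * m2) ^+ 2 < (a * c + b * d) ^+ 2 by rewrite ltrXn2r// ?nnegrE// (le_trans m0)// ltW.
have : (a ^+ 2 + b ^+ 2) * (c ^+ 2 + d ^+ 2) <= m1 ^+ 2 * m2 ^+ 2.
  by rewrite ler_pM// addr_ge0// sqr_ge0.
have := sqr_ge0 (a * d - b * c).
rewrite -exprMn => h3 h4.
have e : (a ^+ 2 + b ^+ 2) * (c ^+ 2 + d ^+ 2) =
  (a * c + b * d) ^+ 2 + (a * d - b * c) ^+ 2 by ring.
by move: h4; rewrite e; lra.
Qed.

(** With [z = a + i b] and [w = c + i d], the two sums are the real and imaginary parts of a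
    Hermitian product [P + i W]. The bound expresses that the squared norm of [Y z - (P - i W) w] is
    nonnegative, where [Y] is the squared norm of [w]; one factor [Y] is divided out, so [Y = 0] is
    treated apart. *)
Lemma complex_cauchy_schwarz (R : realType) n (a b c d : 'I_n -> R) :
  (\sum_i (a i * c i + b i * d i)) ^+ 2 + (\sum_i (a i * d i - b i * c i)) ^+ 2 <=
  (\sum_i (a i ^+ 2 + b i ^+ 2)) * (\sum_i (c i ^+ 2 + d i ^+ 2)).
Proof.
set P := (X in X ^+ 2 + _); set W := (X in _ + X ^+ 2); set X := (X in X * _).
set Y := (X in _ * X).
have Y0 : 0 <= Y by apply: sumr_ge0 => i _; rewrite addr_ge0// sqr_ge0.
have : 0 <= \sum_i ((Y * a i - P * c i - W * d i) ^+ 2 +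
    (Y * b i - P * d i + W * c i) ^+ 2).
  by apply: sumr_ge0 => i _; rewrite addr_ge0// sqr_ge0.
rewrite (eq_bigr (fun i => Y ^+ 2 * (a i ^+ 2 + b i ^+ 2) +
   (P ^+ 2 + W ^+ 2) * (c i ^+ 2 + d i ^+ 2) +
   (- (2 * Y * P)) * (a i * c i + b i * d i) +
   (- (2 * Y * W)) * (a i * d i - b i * c i))); last by move=> i _; ring.
rewrite !big_split/= -!mulr_sumr -/P -/W -/X -/Y.
move: Y0; rewrite le_eqVlt => /predU1P[Yeq _|Y0].
  have cd i : c i = 0 /\ d i = 0.
    have : c i ^+ 2 + d i ^+ 2 <= 0.
      rewrite Yeq /Y (bigD1 i)//= lerDl; apply: sumr_ge0 => j _.
      by rewrite addr_ge0// sqr_ge0.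
    rewrite le_eqVlt ltNge addr_ge0 ?sqr_ge0// orbF paddr_eq0 ?sqr_ge0//.
    by rewrite !sqrf_eq0 => /andP[/eqP -> /eqP ->].
  have -> : P = 0 by apply: big1 => i _; have [-> ->] := cd i; rewrite !mulr0 addr0.
  have -> : W = 0 by apply: big1 => i _; have [-> ->] := cd i; rewrite !mulr0 subr0.
  by rewrite -Yeq mulr0 expr0n/= addr0.
rewrite [Z in 0 <= Z](_ : _ = Y * (X * Y - (P ^+ 2 + W ^+ 2))); last by ring.
by rewrite pmulr_rge0// subr_ge0.
Qed.

(** * The homogeneous distance is a metric *)

Section heisenberg_metric.
Context {R : realType} {n : nat}.
Local Notation H := (heis R n).
Implicit Types (xi eta zeta : H) (r : R).

Definition sqnorm (x : 'rV[R]_(n + n)) : R := \sum_(i < n + n) x ord0 i ^+ 2.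

Definition symplectic (x y : 'rV[R]_(n + n)) : R :=
  \sum_(i < n) (x ord0 (lshift n i) * y ord0 (rshift n i)
                - x ord0 (rshift n i) * y ord0 (lshift n i)).

Lemma sqnorm_ge0 x : 0 <= sqnorm x.
Proof. by apply: sumr_ge0 => i _; exact: sqr_ge0. Qed.

Lemma hnorm_ge0 xi : 0 <= hnorm xi.
Proof. exact: powR_ge0. Qed.

Lemma hnorm4 xi : hnorm xi ^+ 4 = sqnorm xi.1 ^+ 2 + xi.2 ^+ 2.
Proof.
have h : 0 <= sqnorm xi.1 ^+ 2 + xi.2 ^+ 2 by rewrite addr_ge0// sqr_ge0.
by rewrite /hnorm -powR_mulrn ?powR_ge0// -powRrM mulVf ?powRr1// pnatr_eq0.
Qed.

Lemma hnorm_sq_ge xi : sqnorm xi.1 <= hnorm xi ^+ 2 /\ `|xi.2| <= hnorm xi ^+ 2.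
Proof.
have h := hnorm4 xi.
have n0 : 0 <= hnorm xi ^+ 2 by exact: sqr_ge0.
have e : hnorm xi ^+ 4 = (hnorm xi ^+ 2) ^+ 2 by rewrite -exprM.
split; rewrite -(@ler_pXn2r _ 2)// ?nnegrE ?sqnorm_ge0// -e h.
  by rewrite lerDl sqr_ge0.
by rewrite real_normK ?num_real// lerDr sqr_ge0.
Qed.

(** Cygan's argument: the planar vector [(|x|^2, tau)] of a product is the sum of those of the
    factors, of lengths [A^2] and [B^2], and of [(2 P, W / 2)], of length at most [2 A B] by the
    Hermitian Cauchy-Schwarz inequality. The lengths add up to [(A + B)^2]. *)
Lemma hnorm_mul xi eta : hnorm (hmul xi eta) <= hnorm xi + hnorm eta.
Proof.
have A0 := hnorm_ge0 xi; have B0 := hnorm_ge0 eta.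
have [XA tA] := hnorm_sq_ge xi; have [YB tB] := hnorm_sq_ge eta.
have hA := hnorm4 xi; have hB := hnorm4 eta.
set A := hnorm xi in A0 XA tA hA *; set B := hnorm eta in B0 YB tB hB *.
rewrite -(@ler_pXn2r _ 4)// ?nnegrE ?hnorm_ge0 ?addr_ge0// hnorm4.
pose P := \sum_(i < n + n) xi.1 ord0 i * eta.1 ord0 i.
pose W := symplectic xi.1 eta.1.
have -> : sqnorm (hmul xi eta).1 = sqnorm xi.1 + sqnorm eta.1 + 2 * P.
  rewrite /sqnorm /P mulr_sumr -!big_split/=; apply: eq_bigr => i _.
  by rewrite !mxE; ring.
have -> : (hmul xi eta).2 = xi.2 + eta.2 + 2^-1 * W by [].
have PW : P ^+ 2 + W ^+ 2 <= sqnorm xi.1 * sqnorm eta.1.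
  rewrite /P /sqnorm !big_split_ord/= -!big_split/=.
  exact: complex_cauchy_schwarz.
have AB0 : 0 <= 2 * (A * B) by rewrite !mulr_ge0.
have v3 : (2 * P) ^+ 2 + (2^-1 * W) ^+ 2 <= (2 * (A * B)) ^+ 2.
  have h1 : sqnorm xi.1 * sqnorm eta.1 <= A ^+ 2 * B ^+ 2.
    by rewrite ler_pM ?sqnorm_ge0.
  have := sqr_ge0 W.
  by rewrite !exprMn; lra.
have A4 : sqnorm xi.1 ^+ 2 + xi.2 ^+ 2 <= (A ^+ 2) ^+ 2 by rewrite -hA -exprM.
have B4 : sqnorm eta.1 ^+ 2 + eta.2 ^+ 2 <= (B ^+ 2) ^+ 2 by rewrite -hB -exprM.
have d12 := planar_cauchy_schwarz (sqr_ge0 A) (sqr_ge0 B) A4 B4.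
have d13 := planar_cauchy_schwarz (sqr_ge0 A) AB0 A4 v3.
have d23 := planar_cauchy_schwarz (sqr_ge0 B) AB0 B4 v3.
rewrite (_ : (A + B) ^+ 4 = (A ^+ 2) ^+ 2 + (B ^+ 2) ^+ 2 + (2 * (A * B)) ^+ 2
  + 2 * (A ^+ 2 * B ^+ 2) + 2 * (A ^+ 2 * (2 * (A * B))) + 2 * (B ^+ 2 * (2 * (A * B))));
  last by ring.
rewrite (_ : (_ + _) ^+ 2 + _ = (sqnorm xi.1 ^+ 2 + xi.2 ^+ 2) +
  (sqnorm eta.1 ^+ 2 + eta.2 ^+ 2) + ((2 * P) ^+ 2 + (2^-1 * W) ^+ 2)
  + 2 * (sqnorm xi.1 * sqnorm eta.1 + xi.2 * eta.2)
  + 2 * (sqnorm xi.1 * (2 * P) + xi.2 * (2^-1 * W))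
  + 2 * (sqnorm eta.1 * (2 * P) + eta.2 * (2^-1 * W))); last by ring.
by rewrite !lerD// ler_wpM2l.
Qed.

Lemma hdist_ge0 xi eta : 0 <= hdist xi eta.
Proof. exact: hnorm_ge0. Qed.

Lemma hdistE1 xi eta i : (hmul (hinv eta) xi).1 ord0 i = xi.1 ord0 i - eta.1 ord0 i.
Proof. by rewrite !mxE addrC. Qed.

Lemma hdistE2 xi eta : (hmul (hinv eta) xi).2 =
  xi.2 - eta.2 - 2^-1 * symplectic eta.1 xi.1.
Proof.
rewrite /= (addrC (- eta.2)); congr (_ + _); rewrite -mulrN; congr (_ * _).
by rewrite -sumrN; apply: eq_bigr => i _; rewrite !mxE; ring.
Qed.

Lemma symplecticxx x : symplectic x x = 0.
Proof. by rewrite /symplectic big1// => i _; rewrite mulrC subrr. Qed.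

Lemma symplecticC x y : symplectic x y = - symplectic y x.
Proof. by rewrite -sumrN; apply: eq_bigr => i _; ring. Qed.

Lemma hdistxx xi : hdist xi xi = 0.
Proof.
suff : hdist xi xi ^+ 4 == 0 by rewrite expf_eq0 => /andP[_ /eqP].
rewrite hnorm4 hdistE2 symplecticxx mulr0 subr0 subrr.
rewrite expr0n/= addr0 sqrf_eq0 /sqnorm big1// => i _.
by rewrite hdistE1 subrr expr0n.
Qed.

Lemma hdist_eq0 xi eta : hdist xi eta = 0 -> xi = eta.
Proof.
move=> h; have [h1 h2] := hnorm_sq_ge (hmul (hinv eta) xi).
rewrite [hnorm _]h expr2 mulr0 in h1 h2.
have x1 : xi.1 = eta.1.
  apply/rowP => i; apply/eqP; rewrite -subr_eq0 -hdistE1 -sqrf_eq0 eq_le sqr_ge0 andbT.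
  apply: le_trans h1; rewrite /sqnorm (bigD1 i)//= lerDl.
  by apply: sumr_ge0 => j _; exact: sqr_ge0.
move: h2; rewrite normr_le0 hdistE2 x1 symplecticxx mulr0 subr0 subr_eq0 => /eqP x2.
by case: xi eta x1 x2 {h h1} => [a b] [c d] /= -> ->.
Qed.

Lemma hdistC xi eta : hdist xi eta = hdist eta xi.
Proof.
rewrite /hdist /hnorm; congr (_ `^ _); congr (_ ^+ 2 + _).
  by apply: eq_bigr => i _; rewrite !mxE; ring.
by rewrite !hdistE2 symplecticC; ring.
Qed.

(** [zeta^-1 o xi] is the product of [zeta^-1 o eta] and [eta^-1 o xi]; this identity is checked by
    bilinearity of the symplectic form. *)
Lemma hdistD xi eta zeta : hdist xi zeta <= hdist xi eta + hdist eta zeta.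
Proof.
rewrite addrC; apply: le_trans (hnorm_mul _ _).
rewrite /hdist le_eqVlt; apply/orP; left; apply/eqP; congr hnorm.
rewrite [LHS]surjective_pairing [RHS]surjective_pairing; congr pair.
  by apply/rowP => i; rewrite !mxE; ring.
rewrite hdistE2 /hmul/=.
rewrite -[X in _ = X]/(_ + _ + 2^-1 * symplectic (- zeta.1 + eta.1) (- eta.1 + xi.1)).
rewrite -![\sum_(i < n) _]/(symplectic _ _).
have symN x y : symplectic (- x) y = - symplectic x y.
  by rewrite -sumrN; apply: eq_bigr => i _; rewrite !mxE; ring.
have symD x y z : symplectic (x + y) z = symplectic x z + symplectic y z.
  by rewrite -big_split; apply: eq_bigr => i _; rewrite /= !mxE; ring.
have symDr x y z : symplectic x (y + z) = symplectic x y + symplectic x z.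
  by rewrite symplecticC symD opprD -!(symplecticC x).
have symNr x y : symplectic x (- y) = - symplectic x y.
  by rewrite symplecticC symN opprK symplecticC.
by rewrite !(symN, symD, symDr, symNr) symplecticxx; field.
Qed.

End heisenberg_metric.

(** * Volume of balls *)

Section heisenberg_measure.
Context {R : realType}.

Definition rV_cube m (a : 'rV[R]_m) (r : R) : set 'rV[R]_m :=
  [set x | forall i, `|x ord0 i - a ord0 i| < r].

Lemma measurable_coord_ball m (a : 'rV[R]_m) (r : R) i :
  measurable [set x : 'rV[R]_m | `|x ord0 i - a ord0 i| < r].
Proof.
apply: measurable_set_lt => //; apply: measurableT_comp => //.
by apply: measurable_funB => //; exact: measurable_rV_coord.
Qed.

Lemma measurable_rV_cube m (a : 'rV[R]_m) (r : R) : measurable (rV_cube a r).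
Proof.
rewrite (_ : rV_cube a r = \bigcap_(i in [set: 'I_m]) [set x | `|x ord0 i - a ord0 i| < r]).
  by apply: fin_bigcap_measurable => // i _; exact: measurable_coord_ball.
by apply/seteqP; split => [x h i _|x h i]; [exact: h|exact: (h i)].
Qed.

Lemma lebesgue_measure_ball_itv (c r : R) : 0 < r ->
  lebesgue_measure [set t : measurableTypeR R | `|t - c| < r] = (2 * r)%:E.
Proof.
move=> r0; rewrite (_ : [set t | _] = `]c - r, c + r[%classic); last first.
  by apply/seteqP; split => t /=; rewrite in_itv/= ltr_distl.
rewrite lebesgue_measure_itv/= lte_fin ifT; last lra.
by rewrite -EFinB; congr EFin; ring.
Qed.

Lemma lebesgue_rV_cube m (a : 'rV[R]_m) (r : R) : 0 < r ->
  lebesgue_rV m (rV_cube a r) = ((2 * r) ^+ m)%:E.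
Proof.
move=> r0; elim: m a => [|m IH] a.
  rewrite /= diracE mem_set ?expr0// => -[]//.
pose a' : 'rV[R]_m := \row_j a ord0 (lift ord0 j).
pose I0 : set (measurableTypeR R) := [set t | `|t - a ord0 ord0| < r].
rewrite /= /lebesgue_rVS /pushforward.
rewrite (_ : _ @^-1` _ = I0 `*` rV_cube a' r).
  rewrite product_measure1E//; last 2 first.
  - by apply: measurable_set_lt => //; apply: measurableT_comp => //; exact: measurable_funB.
  - exact: measurable_rV_cube.
  transitivity ((2 * r)%:E * ((2 * r) ^+ m)%:E)%E; last by rewrite -EFinM exprS.
  by congr (_ * _)%E; [exact: lebesgue_measure_ball_itv|exact: IH].
apply/seteqP; split => [[t x] /= h|[t x] /= [h0 h] i].
  split.
    by have := h ord0; rewrite mxE unlift_none.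
  by move=> j; have := h (lift ord0 j); rewrite !mxE liftK.
by rewrite mxE; case: unliftP => [j ->|->] //; have := h j; rewrite mxE.
Qed.

Context {n : nat}.
Local Notation H := (heis R n).
Local Notation mu := (@lebesgue_heis R n).

Lemma measurable_sum_fun d (T : measurableType d) m (F : 'I_m -> T -> R) :
  (forall i, measurable_fun setT (F i)) ->
  measurable_fun setT (fun x => \sum_(i < m) F i x).
Proof.
move=> mF; rewrite (_ : (fun _ => _) = \sum_(i < m) F i); last first.
  by apply/funext => x; rewrite fct_sumE.
elim/big_ind : _ => //; first exact: measurable_cst.
by move=> f h mf mh; exact: measurable_funD.
Qed.

Lemma measurable_heis_coord d (T : measurableType d) (f : T -> H) i :
  measurable_fun setT f -> measurable_fun setT (fun t => (f t).1 ord0 i : R).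
Proof.
move=> mf; apply: (measurableT_comp (measurable_rV_coord i)).
exact: (measurableT_comp measurable_fst mf).
Qed.

Lemma measurable_heis_snd d (T : measurableType d) (f : T -> H) :
  measurable_fun setT f -> measurable_fun setT (fun t => (f t).2 : R).
Proof. by move=> mf; exact: (measurableT_comp measurable_snd mf). Qed.

Lemma measurable_hdist d (T : measurableType d) (f h : T -> H) :
  measurable_fun setT f -> measurable_fun setT h ->
  measurable_fun setT (fun t => hdist (f t) (h t)).
Proof.
move=> mf mh; apply: (measurableT_comp (measurable_powR _)).
have mfi i := measurable_heis_coord i mf; have mhi i := measurable_heis_coord i mh.
apply: measurable_funD; apply: measurable_funX.
  apply: measurable_sum_fun => i; apply: measurable_funX.
  under eq_fun do rewrite hdistE1.
  exact: measurable_funB.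
under eq_fun do rewrite hdistE2.
apply: measurable_funB.
  by apply: measurable_funB; exact: measurable_heis_snd.
apply: measurable_funM => //; apply: measurable_sum_fun => i.
by apply: measurable_funB; apply: measurable_funM.
Qed.

(** A box translated by the group law, hence sheared in the last coordinate. Every section over a
    horizontal point is an interval of length [2 r^2] of which only the centre varies, so the volume
    is explicit, and balls lie between two such boxes. *)
Definition hbox (xi0 : H) (r : R) : set H := [set xi |
  rV_cube xi0.1 r xi.1 /\ `|(hmul (hinv xi0) xi).2| < r ^+ 2].

Lemma measurable_hbox xi0 r : measurable (hbox xi0 r).
Proof.
apply: measurableI.
  rewrite -[X in measurable X]setTI; apply: measurable_fst => //.
  exact: measurable_rV_cube.
have mid : measurable_fun setT (@idfun H) by exact: measurable_id.
apply: measurable_set_lt => //; apply: measurableT_comp => //.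
under eq_fun do rewrite hdistE2.
apply: measurable_funB.
  by apply: measurable_funB => //; exact: (measurable_heis_snd mid).
apply: measurable_funM => //; apply: measurable_sum_fun => i.
by apply: measurable_funB; apply: measurable_funM => //; exact: (measurable_heis_coord _ mid).
Qed.

Lemma lebesgue_hbox xi0 (r : R) : 0 < r ->
  mu (hbox xi0 r) = ((2 * r) ^+ (n + n) * (2 * r ^+ 2))%:E.
Proof.
move=> r0; rewrite /lebesgue_heis /product_measure1.
have r20 : 0 < r ^+ 2 by rewrite exprn_gt0.
transitivity (\int[lebesgue_rV (n + n)]_x
    ((2 * r ^+ 2)%:E * (\1_(rV_cube xi0.1 r) x)%:E))%E.
  apply: eq_integral => x _ /=.
  have [hx|hx] := pselect (rV_cube xi0.1 r x); last first.
    rewrite (indic_notin hx) mule0 (_ : xsection _ _ = set0) ?measure0//.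
    by apply/seteqP; split => t //; rewrite /xsection/= inE => -[].
  rewrite (indic_in hx) mule1.
  rewrite -(lebesgue_measure_ball_itv (xi0.2 + 2^-1 * symplectic xi0.1 x) r20).
  congr (lebesgue_measure _).
  apply/seteqP; split => t; rewrite /xsection/= inE/=.
    by move=> [_]; rewrite hdistE2 opprD addrA.
  by move=> h; split => //; rewrite hdistE2/= -addrA -opprD.
have mc := measurable_rV_cube xi0.1 r.
have mI : measurable_fun setT (fun x => (\1_(rV_cube xi0.1 r) x)%:E : \bar R).
  exact/measurable_EFinP/measurable_indic.
have r22 : 0 <= 2 * r ^+ 2 by rewrite mulr_ge0// ltW.
rewrite ge0_integralZl_EFin//.
rewrite integral_indic// setIT.
transitivity ((2 * r ^+ 2)%:E * ((2 * r) ^+ (n + n))%:E)%E.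
  by congr (_ * _)%E; exact: lebesgue_rV_cube.
by rewrite -EFinM mulrC.
Qed.

Lemma hball_sub_hbox xi0 r : hball xi0 r `<=` hbox xi0 r.
Proof.
move=> xi /= h; have [h1 h2] := hnorm_sq_ge (hmul (hinv xi0) xi).
have r0 : 0 <= r by rewrite (le_trans (hdist_ge0 xi xi0))// ltW.
have d2 : hdist xi xi0 ^+ 2 < r ^+ 2 by rewrite ltrXn2r// ?nnegrE// hdist_ge0.
split; last exact: le_lt_trans h2 d2.
move=> i; rewrite -(@ltr_pXn2r _ 2)// ?nnegrE// real_normK ?num_real//.
apply: le_lt_trans d2; apply: le_trans h1.
rewrite /sqnorm (bigD1 i)//= hdistE1 lerDl.
by apply: sumr_ge0 => j _; exact: sqr_ge0.
Qed.

(** With [N = 2 n + 2] and [c = r / N], the fourth power of the norm is below [((2 n)^2 + 1) c^4],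
    hence below [N^4 c^4 = r^4]. *)
Lemma hbox_sub_hball xi0 (r : R) : 0 < r -> hbox xi0 (r / (n.*2.+2)%:R) `<=` hball xi0 r.
Proof.
move=> r0 xi [h1 h2]; change (hdist xi xi0 < r).
set N := (n.*2.+2)%:R in h1 h2; have N0 : 0 < N :> R by rewrite ltr0n.
rewrite -(@ltr_pXn2r _ 4)// ?nnegrE ?hdist_ge0 ?(ltW r0)// hnorm4.
set c := r / N in h1 h2; have c0 : 0 < c by rewrite divr_gt0.
have s1 : sqnorm (hmul (hinv xi0) xi).1 <= (n + n)%:R * c ^+ 2.
  apply: le_trans (_ : \sum_(i < n + n) c ^+ 2 <= _); last first.
    by rewrite sumr_const card_ord mulr_natl.
  apply: ler_sum => i _; rewrite hdistE1 -real_normK ?num_real//.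
  by rewrite lerXn2r// ?nnegrE ?(ltW c0)// ltW.
have s2 : sqnorm (hmul (hinv xi0) xi).1 ^+ 2 <= ((n + n)%:R * c ^+ 2) ^+ 2.
  by rewrite lerXn2r// ?nnegrE ?sqnorm_ge0// mulr_ge0// sqr_ge0.
have s3 : (hmul (hinv xi0) xi).2 ^+ 2 < (c ^+ 2) ^+ 2.
  by rewrite -real_normK ?num_real// ltrXn2r// ?nnegrE// ltW// exprn_gt0.
apply: (lt_le_trans (ler_ltD s2 s3)).
rewrite (_ : _ + _ = c ^+ 4 * ((n + n)%:R ^+ 2 + 1)); last by ring.
rewrite (_ : r ^+ 4 = c ^+ 4 * N ^+ 4); last first.
  by rewrite /c; field; rewrite gt_eqF.
rewrite ler_wpM2l ?exprn_ge0 ?(ltW c0)//.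
have N1 : 1 <= N by rewrite ler1n.
have nN : (n + n)%:R + 1 <= N by rewrite natr1 ler_nat addnn.
apply: le_trans (_ : N ^+ 2 <= _).
  apply: le_trans (_ : ((n + n)%:R + 1) ^+ 2 <= _).
    by rewrite sqrrD expr1n lerD2r lerDl mulr1 mulrn_wge0.
  by rewrite lerXn2r// ?nnegrE ?addr_ge0// ltW.
by rewrite ler_weXn2l.
Qed.

Lemma measurable_hball (xi0 : H) r : measurable (hball xi0 r).
Proof.
apply: measurable_set_lt => //; apply: measurable_hdist => //.
Qed.

Lemma hball_volume : exists c1 c2 : R, [/\ 0 < c1, 0 < c2,
  forall xi0 (r : R), 0 < r -> ((c1 * r `^ @hdim R n)%:E <= mu (hball xi0 r))%E &
  forall xi0 (r : R), 0 < r -> (mu (hball xi0 r) <= (c2 * r `^ @hdim R n)%:E)%E].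
Proof.
have volE (r : R) : 0 < r ->
    (2 * r) ^+ (n + n) * (2 * r ^+ 2) = 2 ^+ (n + n).+1 * r `^ @hdim R n.
  move=> r0; rewrite /hdim powR_mulrn ?(ltW r0)//.
  rewrite (_ : (2 * n + 2 = (n + n).+2)%N); last by rewrite mul2n addnn addn2.
  by rewrite exprMn !exprS; ring.
pose c : R := (n.*2.+2)%:R^-1.
have c0 : 0 < c by rewrite invr_gt0.
exists (2 ^+ (n + n).+1 * c `^ @hdim R n), (2 ^+ (n + n).+1); split.
- by rewrite mulr_gt0 ?exprn_gt0 ?powR_gt0.
- by rewrite exprn_gt0.
- move=> xi0 r r0; have cr0 : 0 < r / (n.*2.+2)%:R by rewrite divr_gt0.
  apply: le_trans (_ : mu (hbox xi0 (r / (n.*2.+2)%:R)) <= _)%E.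
    rewrite lebesgue_hbox// volE// powRM ?(ltW r0) ?(ltW c0)//.
    by rewrite lee_fin -mulrA ler_wpM2l ?exprn_ge0// mulrC.
  apply: le_measure; rewrite ?inE; [exact: measurable_hbox|exact: measurable_hball|].
  exact: hbox_sub_hball.
- move=> xi0 r r0; apply: le_trans (_ : mu (hbox xi0 r) <= _)%E.
    apply: le_measure; rewrite ?inE; [exact: measurable_hball|exact: measurable_hbox|].
    exact: hball_sub_hbox.
  by rewrite lebesgue_hbox// volE.
Qed.

End heisenberg_measure.

(** * Regularity of weak solutions *)

Section weak_solutions.
Context {R : realType} {n : nat} (p q s : R).
Local Notation H := (heis R n).
Local Notation mu := (@lebesgue_heis R n).
Local Notation Q := (@hdim R n).
Implicit Types (g : R -> R) (Omega : set H) (u v psi : H -> R).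

Let mdist : measurable_fun setT (fun z : H * H => hdist z.1 z.2) :=
  measurable_hdist measurable_fst measurable_snd.

Lemma hdim_gt0 : 0 < Q.
Proof. by rewrite /hdim ltr0n addnS. Qed.

Lemma compactly_contained_sub (A B Omega : set H) : A `<=` B ->
  compactly_contained B Omega -> compactly_contained A Omega.
Proof.
move=> AB [cB BO]; have cAB : closure A `<=` closure B by exact: closure_subset.
split; last exact: subset_trans BO.
by apply: subclosed_compact cB cAB; exact: closed_closure.
Qed.

Lemma HW_opp g Omega psi : HW s g Omega psi -> HW s g Omega (fun x => - psi x).
Proof.
move=> [[v mv psiv] h1 h2]; split.
- exists (fun x => - v x); first exact: measurableT_comp.
  by apply: filterS psiv => x ->.
- by under eq_integral do rewrite normrN.
- have e z : `|- psi z.1 - - psi z.2| = `|psi z.1 - psi z.2| :> R.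
    by rewrite (_ : _ - _ = - (psi z.1 - psi z.2)) ?normrN//; ring.
  by under eq_integral do rewrite e.
Qed.

Lemma weak_integrand_opp g u psi (z : H * H) :
  weak_integrand hdist Q s g (fun x => - u x) psi z =
  weak_integrand hdist Q s g u (fun x => - psi x) z.
Proof.
rewrite /weak_integrand (_ : - u z.1 - - u z.2 = - (u z.1 - u z.2)); last by ring.
by rewrite normrN; ring.
Qed.

Lemma HW_level_test g Omega v x0 (r k M : R) : 1 < p -> 0 < s < 1 ->
  growth_function p q g -> measurable_fun setT v -> 0 < r -> 0 < M ->
  hball x0 r `<=` Omega ->
  (\int[mu \x mu]_(z in cross_domain Omega)
    (gagliardo_integrand hdist Q s g v z)%:E < +oo)%E ->
  HW s g Omega (level_test hdist v x0 r k M).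
Proof.
move=> p1 /andP[s0 s1] gg mv r0 M0 BO hv.
have [c1 [c2 [c10 c20 vge vle]]] := @hball_volume R n.
have mpsi := measurable_level_test mdist x0 r k M mv.
split.
- by exists (level_test hdist v x0 r k M) => //; exact: aeW.
- apply: (@le_lt_trans _ _ (\int[mu]_x ((primitive g M)%:E * (\1_(hball x0 r) x)%:E))%E).
    rewrite [leLHS]integral_mkcond; apply: ae_le_integral => [x _|x _|].
    + rewrite patchE; case: ifPn => // _.
      by rewrite lee_fin (primitive_ge0 gg).
    + by rewrite -EFinM lee_fin mulr_ge0// (primitive_ge0 gg)// ltW.
    + apply: aeW => x _; rewrite patchE; case: ifPn => _; last first.
        by rewrite -EFinM lee_fin mulr_ge0// (primitive_ge0 gg)// ltW.
      rewrite -EFinM lee_fin.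
      have [Bx|nBx] := pselect (hball x0 r x).
        rewrite (indic_in Bx) mulr1 (primitive_homo gg)// ger0_norm ?level_test_ge0//.
        by apply: level_test_le; exact: ltW.
      rewrite (indic_notin nBx) mulr0 level_test_eq0 ?(ltW M0)//.
        by rewrite normr0 primitive0.
      by move=> [_ /= h]; apply: nBx; rewrite /hball/=; lra.
  have mI : measurable_fun setT (fun x => (\1_(hball x0 r) x)%:E : \bar R).
    by apply/measurable_EFinP; apply: measurable_indic; exact: measurable_hball.
  rewrite ge0_integralZl_EFin//; last by rewrite (primitive_ge0 gg)// ltW.
  rewrite integral_indic ?setIT//; last exact: measurable_hball.
  rewrite lte_mul_pinfty ?lee_fin ?(primitive_ge0 gg) ?(ltW M0)//.
  exact: le_lt_trans (vle x0 r r0) (ltry _).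
- apply: (level_test_energy mdist (@hdist_ge0 R n) (@hdistC R n) (@hdistD R n)
    hdim_gt0 s0 s1 c20 vle k p1 gg mv r0 M0 _ hv).
  by move=> x y Bx; split; [left|right]; split => //; exact: BO.
Qed.

Lemma level_test_support x0 r Omega v k M : 0 < r -> 0 <= M ->
  compactly_contained (hball x0 r) Omega ->
  compact_support_in Omega (level_test hdist v x0 r k M).
Proof.
move=> r0 M0; apply: compactly_contained_sub => x /= /eqP nz.
apply: contrapT => nB; apply: nz; apply: level_test_eq0 => //.
by move=> [_ /= h]; apply: nB; rewrite /hball/=; lra.
Qed.

(** Transfers the equation to a Borel representative [v] and to the whole product: a function
    vanishing off the ball is zero at both points of a pair outside the cross domain. For [- v] the
    sign is moved to the test function, which stays admissible. *)
Lemma weak_solution_weak_on g Omega u v x0 r : 1 < p -> 0 < s < 1 ->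
  growth_function p q g -> weak_solution s g Omega u ->
  measurable_fun setT v -> {ae mu, forall x, u x = v x} ->
  0 < r -> compactly_contained (hball x0 r) Omega ->
  weak_on mu hdist Q s g v x0 r /\
  weak_on mu hdist Q s g (fun x => - v x) x0 r.
Proof.
move=> p1 s01 gg [[_ _ eu] wu] mv uv r0 cc.
have BO : hball x0 r `<=` Omega.
  by apply: subset_trans cc.2; exact: subset_closure.
have uv2 := ae_product uv.
have ev : (\int[mu \x mu]_(z in cross_domain Omega)
    (gagliardo_integrand hdist Q s g v z)%:E < +oo)%E.
  apply: le_lt_trans eu; rewrite le_eqVlt; apply/orP; left; apply/eqP.
  apply: ae_eq_integral_gen; apply: filterS uv2 => z [z1 z2] _.
  by rewrite /gagliardo_integrand z1 z2.
have key psi : HW s g Omega psi -> compact_support_in Omega psi ->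
    (forall x, ~ hball x0 r x -> psi x = 0) ->
    (\int[mu \x mu]_z (weak_integrand hdist Q s g v psi z)%:E = 0)%E.
  move=> hpsi cpsi psi0; rewrite -(wu psi hpsi cpsi).
  rewrite [RHS]integral_mkcond; apply: ae_eq_integral_gen.
  apply: filterS uv2 => z [z1 z2] _; rewrite patchE; case: ifPn => [_|/negP nC].
    by rewrite /weak_integrand z1 z2.
  rewrite /weak_integrand !psi0 ?subrr ?mulr0 ?mul0r//.
    by move=> B2; apply: nC; rewrite inE; right; split => //; exact: BO.
  by move=> B1; apply: nC; rewrite inE; left; split => //; exact: BO.
have test0 w k M x : 0 < M -> ~ hball x0 r x -> level_test hdist w x0 r k M x = 0.
  move=> M0 nB; apply: level_test_eq0; rewrite ?(ltW M0)//.
  by move=> [_ /= h]; apply: nB; rewrite /hball/=; lra.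
pose w : H -> R := fun x => - v x.
have mw : measurable_fun setT w by exact: measurableT_comp.
have ew : (\int[mu \x mu]_(z in cross_domain Omega)
    (gagliardo_integrand hdist Q s g w z)%:E < +oo)%E.
  apply: le_lt_trans ev; rewrite le_eqVlt; apply/orP; left; apply/eqP.
  apply: eq_integral => z _; rewrite /gagliardo_integrand /w.
  rewrite (_ : - v z.1 - - v z.2 = - (v z.1 - v z.2)) ?normrN//; ring.
split => k M M0.
  apply: key.
  - exact: HW_level_test.
  - by apply: level_test_support => //; exact: ltW.
  - by move=> x; exact: test0.
pose psi := level_test hdist w x0 r k M.
rewrite -(key (fun x => - psi x)).
- by apply: eq_integral => z _; rewrite -weak_integrand_opp.
- by apply: (HW_opp (psi := psi)); exact: HW_level_test.
- rewrite /compact_support_in (_ : [set _ | _] = [set x | psi x != 0]).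
    by apply: level_test_support => //; exact: ltW.
  by apply/seteqP; split => x /=; rewrite oppr_eq0.
- by move=> x nB; rewrite /psi test0// oppr0.
Qed.

End weak_solutions.

Section decay.
Context {R : realType} {n : nat}.
Local Notation H := (heis R n).
Local Notation mu := (@lebesgue_heis R n).
Local Notation Q := (@hdim R n).

(** [alpha = ln tau / ln sg] is positive because both logarithms are negative, and below 1 because
    [sg <= 1 / 4 < 15 / 16 <= tau]. *)
Lemma holder_exponent (tau sg : R) : 15 / 16 <= tau < 1 -> 0 < sg <= 4^-1 ->
  exists2 alpha : R, 0 < alpha < 1 & sg `^ alpha = tau.
Proof.
move=> /andP[tau0 tau1] /andP[sg0 sg1].
have t0 : 0 < tau by lra.
have lsg : ln sg < 0 by apply: ln_lt0; lra.
have ltau : ln tau < 0 by apply: ln_lt0; lra.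
have lt : ln sg < ln tau by rewrite ltr_ln ?posrE//; lra.
exists (ln tau / ln sg); last first.
  by rewrite /powR gt_eqF// divfK ?lt_eqF// lnK.
rewrite -[X in 0 < X]mulrNN -invrN divr_gt0 ?oppr_gt0//=.
by rewrite -mulrNN -invrN ltr_pdivrMr ?oppr_gt0// mul1r ltrN2.
Qed.

(** Decay along the radii [sg ^+ i * rho] becomes a power of [r / rho]; the radii in between cost
    the factor [1 / tau] in [C]. *)
Lemma weak_solution_decay (p q s : R) : 1 < p -> 0 < s < 1 ->
  exists alpha C : R, [/\ 0 < alpha < 1, 1 < C &
  forall (g : R -> R) (Omega : set H) (u v : H -> R) x0 (rho S t eps : R),
  growth_function p q g -> weak_solution s g Omega u ->
  measurable_fun setT v -> {ae mu, forall x, u x = v x} ->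
  0 < rho -> compactly_contained (hball x0 rho) Omega ->
  0 <= S -> 0 <= t -> 0 < eps ->
  {ae mu, forall x, hball x0 rho x -> `|v x| <= S} ->
  (tail s g v x0 rho <= t%:E)%E ->
  forall r, 0 < r <= rho -> exists lo up : R,
    up - lo <= C * (r / rho) `^ alpha *
      (S + rho `^ s * growth_inv g (rho `^ s * t) + eps) /\
    {ae mu, forall x, hball x0 r x -> lo <= v x <= up}].
Proof.
move=> p1 s01; have /andP[s0 s1] := s01.
have [c1 [c2 [c10 c20 vge vle]]] := @hball_volume R n.
have mdist : measurable_fun setT (fun z : H * H => hdist z.1 z.2).
  exact: measurable_hdist.
have [tau [sg [K0 [tau01 sg01 K00 decay]]]] := oscillation_decay mdist
  (@hdist_ge0 R n) (@hdist_eq0 R n) (@hdistC R n) (@hdistD R n) (@hdim_gt0 R n)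
  s0 s1 c10 c20 vge vle q p1.
have [alpha alpha01 sga] := holder_exponent tau01 sg01.
have /andP[tau0 tau1] := tau01; have /andP[sg0 sg1] := sg01.
have taupos : 0 < tau by lra.
exists alpha, ((2 + K0) / tau); split => //.
  by rewrite ltr_pdivlMr//; lra.
move=> g Omega u v x0 rho S t eps gg wu mv uv rho0 cc S0 t0 eps0 vS ht r /andP[r0 rrho].
have rs0 : 0 < rho `^ s by rewrite powR_gt0.
have rst0 : 0 <= rho `^ s * t by rewrite mulr_ge0// ltW.
have [ginvK ginv0] := growth_invK gg rst0.
set gi := growth_inv g _ in ginvK ginv0 *.
(* Large enough that [v] is bounded by [om0 / 2] and that [om0 / (K0 * rho ^ s)] is at least
   [growth_inv g (rho ^ s * t)], which is the tail hypothesis. The term [eps] makes it positive even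
   when [v] and the tail vanish. *)
pose om0 := 2 * S + K0 * (rho `^ s * gi) + eps.
have rgi : 0 <= rho `^ s * gi by rewrite mulr_ge0// ltW.
have Krgi : 0 <= K0 * (rho `^ s * gi) by rewrite mulr_ge0// ltW.
have om00 : 0 < om0 by rewrite /om0; move: S0 eps0 Krgi; clear -n; lra.
have vom : {ae mu, forall x, hdist x x0 < rho -> `|v x| <= om0 / 2}.
  by apply: filterS vS => x h /h; rewrite /om0; move: eps0 Krgi; clear -n; lra.
have htail : (\int[mu]_(y in ~` [set y | (hdist y x0 < rho)%R])
    (plain_tail hdist Q s g v x0 y)%:E <= (g (om0 / (K0 * rho `^ s)) / rho `^ s)%:E)%E.
  apply: (le_trans ht); rewrite lee_fin ler_pdivlMr// mulrC -ginvK.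
  apply: (growth_homo gg) => //; rewrite ler_pdivlMr ?mulr_gt0//.
  by rewrite mulrC -mulrA /om0; move: S0 eps0; clear -n; lra.
have weak r' : 0 < r' <= rho -> weak_on mu hdist Q s g v x0 r' /\
    weak_on mu hdist Q s g (fun x => - v x) x0 r'.
  move=> /andP[r'0 r'rho]; apply: (weak_solution_weak_on p1 s01 gg wu mv uv r'0).
  by apply: compactly_contained_sub cc => x; rewrite /hball/= => h; exact: lt_le_trans r'rho.
have [k0 hk0] : exists k, sg ^+ k.+1 * rho < r.
  have x0' : 0 < sg^-1 - 1.
    by rewrite subr_gt0 invf_gt1//; move: sg1; clear -n; lra.
  have [k] := bernoulli_unbounded (rho / r + 1) x0'.
  rewrite (_ : 1 + _ = sg^-1) ?exprVn; last by ring.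
  move=> hk; exists k; have sk0 : 0 < sg ^+ k by rewrite exprn_gt0.
  have : rho / r < (sg ^+ k)^-1 by move: hk; clear -n; lra.
  rewrite -[ltRHS]mul1r ltr_pdivlMr// mulrAC ltr_pdivrMr// mul1r mulrC => h.
  apply: le_lt_trans h; rewrite exprS -mulrA ler_piMl//; last by move: sg1; clear -n; lra.
  by rewrite mulr_ge0// ltW.
have exk : exists k, sg ^+ k.+1 * rho < r by exists k0.
(* The least [i] gives [sg ^+ i.+1 * rho < r <= sg ^+ i * rho]; for [i = 0] the upper bound is the
   hypothesis [r <= rho]. *)
case: (ex_minnP exk) => i hi mini.
have ri : r <= sg ^+ i * rho.
  case: i hi mini => [|i] hi mini; first by rewrite expr0 mul1r.
  by rewrite leNgt; apply/negP => /mini; rewrite ltnn.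
have [lo [up [uplo hv]]] := decay g v x0 rho om0 gg mv rho0 om00 vom htail weak i.
exists lo, up; split; last first.
  by apply: filterS hv => x h xr; apply: h; exact: lt_le_trans ri.
have taui : tau ^+ i <= (r / rho) `^ alpha / tau.
  rewrite ler_pdivlMr// -exprSr -sga -powR_exprn ?(ltW sg0)//.
  apply: le_powR; first by case/andP: alpha01 => /ltW.
    by rewrite exprn_ge0// ltW.
  by rewrite ler_pdivlMr// ltW.
rewrite uplo; apply: le_trans (_ : (r / rho) `^ alpha / tau * om0 <= _).
  by rewrite ler_wpM2r// ltW.
rewrite (_ : (2 + K0) / tau * (r / rho) `^ alpha * _ = (r / rho) `^ alpha / tau *
  ((2 + K0) * (S + rho `^ s * gi + eps))); last by ring.
rewrite ler_wpM2l ?divr_ge0 ?powR_ge0 ?(ltW taupos)//.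
have h1 : 0 <= K0 * S by rewrite mulr_ge0// ltW.
have h2 : 0 <= K0 * eps by rewrite mulr_ge0// ltW.
rewrite /om0 !mulrDl !mulrDr; move: h1 h2 S0 eps0 rgi; clear -n; lra.
Qed.

End decay.

(** * Essential bounds and the estimate in extended reals *)

Section essential_bounds.
Context {R : realType} {n : nat}.
Local Notation H := (heis R n).
Local Notation mu := (@lebesgue_heis R n).
Implicit Types (E : set H) (u v : H -> R).

Lemma ess_sup_on_leP E u (y : R) :
  (ess_sup_on E u <= y%:E)%E <-> {ae mu, forall x, E x -> u x <= y}.
Proof.
rewrite /ess_sup_on; split => [/ess_supP h|h].
  apply: filterS h => x + Ex; rewrite /patch mem_set// lee_fin.
apply/ess_supP; apply: filterS h => x h.
by rewrite /patch; case: ifPn => [/set_mem /h|_]; rewrite ?lee_fin ?leNye.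
Qed.

Lemma ess_inf_on_geP E u (y : R) :
  (y%:E <= ess_inf_on E u)%E <-> {ae mu, forall x, E x -> y <= u x}.
Proof.
rewrite /ess_inf_on; split => [/ess_infP h|h].
  apply: filterS h => x + Ex; rewrite /patch mem_set// lee_fin.
apply/ess_infP; apply: filterS h => x h.
by rewrite /patch; case: ifPn => [/set_mem /h|_]; rewrite ?lee_fin ?leey.
Qed.

Lemma ess_osc_le E u (lo up : R) : {ae mu, forall x, E x -> lo <= u x <= up} ->
  (ess_osc E u <= (up - lo)%:E)%E.
Proof.
move=> h; rewrite /ess_osc EFinB; apply: leeB.
  by apply/ess_sup_on_leP; apply: filterS h => x h /h /andP[].
by apply/ess_inf_on_geP; apply: filterS h => x h /h /andP[].
Qed.

(** Balls have positive volume, so a null set contains none of them. *)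
Lemma ae_hball (P : H -> Prop) x0 (r : R) : 0 < r -> {ae mu, forall x, P x} ->
  exists2 x, hball x0 r x & P x.
Proof.
move=> r0 [N [mN N0 PN]].
have [c1 [c2 [c10 c20 vge vle]]] := @hball_volume R n.
apply: contrapT => hn.
have sub : hball x0 r `<=` N.
  by move=> x Bx; apply: PN => /= Px; apply: hn; exists x.
have : (mu (hball x0 r) <= mu N)%E.
  by apply: le_measure => //; rewrite ?inE//; exact: measurable_hball.
move=> /(le_trans (vge x0 r r0)); rewrite [X in (_ <= X)%E](_ : _ = 0%E)// lee_fin.
by rewrite leNgt mulr_gt0// powR_gt0.
Qed.

Lemma ess_sup_on_norm_ge0 u x0 (r : R) : 0 < r ->
  (0 <= ess_sup_on (hball x0 r) (fun x => `|u x|%R))%E.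
Proof.
move=> r0; rewrite leNgt; apply/negP => lt0.
have [x Bx] := ae_hball x0 r0 (ess_sup_ge mu
  (patch (fun=> -oo%E) (hball x0 r) (EFin \o (fun x => `|u x|%R)))).
rewrite /patch mem_set// => /le_lt_trans /(_ lt0).
by rewrite lte_fin ltNge normr_ge0.
Qed.

Lemma tail_ae s g u v x0 r : {ae mu, forall x, u x = v x} ->
  tail s g u x0 r = tail s g v x0 r.
Proof.
move=> uv; apply: ae_eq_integral_gen; apply: filterS uv => x -> //.
Qed.

End essential_bounds.

Section oscillation_estimate.
Context {R : realType} {n : nat}.
Local Notation H := (heis R n).
Local Notation mu := (@lebesgue_heis R n).

Lemma oscillation_estimate (alpha C s p q : R) (g : R -> R) (Omega : set H)
    (u v : H -> R) (xi0 : H) (rho r : R) :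
  0 < C -> growth_function p q g -> 0 < rho -> 0 < r <= rho ->
  compactly_contained (hball xi0 rho) Omega -> locally_bounded Omega u ->
  {ae mu, forall x, u x = v x} ->
  (forall S t eps : R, 0 <= S -> 0 <= t -> 0 < eps ->
    {ae mu, forall x, hball xi0 rho x -> `|v x| <= S} ->
    (tail s g v xi0 rho <= t%:E)%E ->
    exists lo up : R, up - lo <= C * (r / rho) `^ alpha *
      (S + rho `^ s * growth_inv g (rho `^ s * t) + eps) /\
    {ae mu, forall x, hball xi0 r x -> lo <= v x <= up}) ->
  (ess_osc (hball xi0 r) u <= (C * (r / rho) `^ alpha)%:E *
    (ess_sup_on (hball xi0 rho) (fun xi => `|u xi|%R) +
     (rho `^ s)%:E * er_map (growth_inv g) ((rho `^ s)%:E * tail s g u xi0 rho)))%E.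
Proof.
move=> C0 gg rho0 /andP[r0 rrho] [cB BO] lb uv decay.
have rs0 : 0 < rho `^ s by rewrite powR_gt0.
have Cr0 : 0 < C * (r / rho) `^ alpha by rewrite mulr_gt0// powR_gt0// divr_gt0.
have [M uM] := lb _ cB BO.
have Sge0 := ess_sup_on_norm_ge0 u xi0 rho0.
have Sle : (ess_sup_on (hball xi0 rho) (fun x => `|u x|%R) <= M%:E)%E.
  by apply/ess_sup_on_leP; apply: filterS uM => x h Bx; apply: h; exact: subset_closure.
have Sfin : ess_sup_on (hball xi0 rho) (fun x => `|u x|%R) \is a fin_num.
  by rewrite ge0_fin_numE//; exact: le_lt_trans Sle (ltry _).
set S := ess_sup_on _ _ in Sge0 Sle Sfin *; rewrite -(fineK Sfin).
have tge0 : (0 <= tail s g u xi0 rho)%E.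
  apply: integral_ge0 => x _; rewrite lee_fin divr_ge0 ?powR_ge0//.
  by rewrite (growth_ge0 gg)// divr_ge0 ?powR_ge0.
(* An infinite tail makes the right-hand side [+oo]: [er_map] fixes [+oo], and the factors in front
   are positive. *)
have [tfin|] := boolP (tail s g u xi0 rho \is a fin_num); last first.
  rewrite ge0_fin_numE// -leNgt leye_eq => /eqP ->.
  by rewrite gt0_muley ?lte_fin//= gt0_muley ?lte_fin// addey// gt0_muley ?lte_fin// leey.
have [t tE] : exists t, tail s g u xi0 rho = t%:E.
  by exists (fine (tail s g u xi0 rho)); rewrite fineK.
have t0 : 0 <= t by rewrite tE in tge0.
rewrite tE -[((_ `^ s)%:E * t%:E)%E]/((rho `^ s * t)%:E).
rewrite -[er_map _ _]/((growth_inv g (rho `^ s * t))%:E).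
rewrite -[((_ `^ s)%:E * _%:E)%E]/((rho `^ s * growth_inv g (rho `^ s * t))%:E) -EFinD -EFinM.
apply/lee_addgt0Pr => e e0.
(* The auxiliary [eps] is scaled so that it contributes exactly the arbitrary [e]. *)
have eC0 : 0 < e / (C * (r / rho) `^ alpha) by rewrite divr_gt0.
have vS : {ae mu, forall x, hball xi0 rho x -> `|v x| <= fine S}.
  have : (S <= (fine S)%:E)%E by rewrite fineK.
  by move=> /ess_sup_on_leP; apply: filterS2 uv => x <-.
have ht : (tail s g v xi0 rho <= t%:E)%E by rewrite -tE (tail_ae _ _ _ _ uv).
have [lo [up [uplo hv]]] := decay _ _ _ (fine_ge0 Sge0) t0 eC0 vS ht.
have hu : {ae mu, forall x, hball xi0 r x -> lo <= u x <= up}.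
  by apply: filterS2 uv hv => x ->.
apply: le_trans (ess_osc_le hu) _; rewrite -EFinD lee_fin; apply: (le_trans uplo).
rewrite mulrDr lerD2l mulrC divfK// gt_eqF//.
Qed.

End oscillation_estimate.

(** * Homogeneous balls and the product topology *)

Section heisenberg_topology.
Context {R : realType} {n : nat}.
Local Notation H := (heis R n).
Local Notation mu := (@lebesgue_heis R n).
Implicit Types (x y z : H) (r e : R).

Lemma continuous_heis_coord i : continuous (fun x : H => x.1 ord0 i : R).
Proof.
move=> x; apply: (@continuous_comp _ _ _ fst (fun v : 'rV[R]_(n + n) => v ord0 i)).
  exact: cvg_fst.
exact: coord_continuous.
Qed.

Lemma continuous_sum_fun (T : topologicalType) m (F : 'I_m -> T -> R) :
  (forall i, continuous (F i)) -> continuous (fun t => \sum_(i < m) F i t).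
Proof.
move=> cF; rewrite (_ : (fun _ => _) = \sum_(i < m) F i); last first.
  by apply/funext => x; rewrite fct_sumE.
elim/big_ind : _ => //; first by move=> x; exact: cvg_cst.
by move=> f h cf ch x; apply: cvgD; [exact: cf|exact: ch].
Qed.

(** The fourth power is a polynomial in the coordinates, and balls are its sublevel sets. *)
Lemma continuous_hdist4 y : continuous (fun x : H => hdist x y ^+ 4 : R).
Proof.
under eq_fun do rewrite hnorm4 hdistE2.
have cc := continuous_heis_coord.
have c2 : continuous (fun x : H => x.2 : R) by move=> x; exact: cvg_snd.
have cX (f : H -> R) : continuous f -> continuous (fun x => f x ^+ 2).
  by move=> cf x; under eq_fun do rewrite expr2; apply: cvgM; exact: cf.
move=> x; apply: cvgD; apply: (cX _) => {}x.
  apply: continuous_sum_fun => i {}x; under eq_fun do rewrite hdistE1.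
  by apply: (cX _) => {}x; apply: cvgB; [exact: cc|exact: cvg_cst].
apply: cvgB; first by apply: cvgB; [exact: c2|exact: cvg_cst].
apply: cvgM; first exact: cvg_cst.
apply: continuous_sum_fun => i {}x.
by apply: cvgB; apply: cvgM; (exact: cc || exact: cvg_cst).
Qed.

Lemma open_hball x r : 0 < r -> open (hball x r).
Proof.
move=> r0; rewrite (_ : hball x r = (fun y => hdist y x ^+ 4) @^-1` [set t | t < r ^+ 4]).
  apply: open_comp => [y _|]; [exact: continuous_hdist4|exact: open_lt].
by apply/seteqP; split => y /=; rewrite ltr_pXn2r// ?nnegrE ?hdist_ge0// ltW.
Qed.

Lemma nbhs_hball x r : 0 < r -> nbhs x (hball x r).
Proof.
by move=> r0; apply: open_nbhs_nbhs; split; [exact: open_hball|rewrite /hball/= hdistxx].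
Qed.

Lemma closure_hball x r : 0 < r -> closure (hball x r) `<=` [set y | hdist y x <= r].
Proof.
move=> r0; have cl : closed [set y | hdist y x <= r].
  rewrite (_ : [set _ | _] = (fun y => hdist y x ^+ 4) @^-1` [set t | t <= r ^+ 4]).
    by apply: preimage_closed => [y _|]; [exact: continuous_hdist4|exact: closed_le].
  by apply/seteqP; split => y /=; rewrite ler_pXn2r// ?nnegrE ?hdist_ge0// ltW.
apply: subset_trans (closure_subset _) _; last by move=> y; exact: cl.
by move=> y /ltW.
Qed.

(** [symplectic a a = 0], so [v] may be replaced by its difference from [a]. *)
Lemma symplectic_lipschitz (a : 'rV[R]_(n + n)) : exists2 A : R, 0 <= A &
  forall r v, rV_cube a r v -> `|symplectic a v| <= A * r.
Proof.
exists (\sum_(i < n) (`|a ord0 (lshift n i)| + `|a ord0 (rshift n i)|)).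
  by apply: sumr_ge0 => i _; rewrite addr_ge0.
move=> r x ax; have -> : symplectic a x = \sum_(i < n)
    (a ord0 (lshift n i) * (x ord0 (rshift n i) - a ord0 (rshift n i))
     - a ord0 (rshift n i) * (x ord0 (lshift n i) - a ord0 (lshift n i))).
  by apply: eq_bigr => i _; ring.
apply: le_trans (ler_norm_sum _ _ _) _; rewrite mulr_suml; apply: ler_sum => i _.
apply: le_trans (ler_normB _ _) _; rewrite !normrM mulrDl lerD// ler_wpM2l// ltW//; exact: ax.
Qed.

Lemma hball_sub_ball x e : 0 < e -> exists2 r, 0 < r & hball x r `<=` ball x e.
Proof.
move=> e0; have [A A0 hA] := symplectic_lipschitz x.1.
(* The horizontal coordinates will differ by less than [r] and the last ones by less than
   [r^2 + A r / 2]; the identity [r * e + r * A + r = e] makes both smaller than [e]. *)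
pose r := e / (e + A + 1); have D0 : 0 < e + A + 1 by lra.
have r0 : 0 < r by rewrite divr_gt0.
have rE : r * e + r * A + r = e by rewrite /r; field; rewrite gt_eqF.
clearbody r.
have re0 : 0 < r * e by rewrite mulr_gt0.
have rA0 : 0 <= r * A by rewrite mulr_ge0// ltW.
exists r => // y /hball_sub_hbox[h1]; rewrite hdistE2 => h2.
split => /=.
  split => // i j; rewrite !ord1 /ball/= distrC; apply: lt_trans (h1 j) _; lra.
have := hA _ _ h1; move: h2; rewrite /ball/= !ltr_norml ler_norml expr2.
have rr : r * r <= r * e by rewrite ler_wpM2l ?(ltW r0)//; lra.
lra.
Qed.

Lemma compactly_contained_hball Omega x : open Omega -> Omega x ->
  exists2 r : R, 0 < r & compactly_contained (hball x r) Omega.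
Proof.
move=> oO Ox; have /nbhs_ballP[e /= e0 eO] := open_nbhs_nbhs (conj oO Ox).
have [r r0 re] := hball_sub_ball x e0.
have r20 : 0 < r / 2 by lra.
have cl : closure (hball x (r / 2)) `<=` ball x e.
  move=> y /(closure_hball r20)/= h; apply: re; rewrite /hball/=; lra.
exists (r / 2) => //; split; last exact: subset_trans eO.
pose K1 := [set v : 'rV[R]_(n + n) | forall i,
  `[x.1 ord0 i - e, x.1 ord0 i + e]%classic (v ord0 i)].
pose K2 : set (measurableTypeR R) := `[x.2 - e, x.2 + e]%classic.
have cK : compact (K1 `*` K2).
  apply: compact_setX; last exact: segment_compact.
  apply: (@rV_compact R _ (fun i => `[x.1 ord0 i - e, x.1 ord0 i + e]%classic)) => i.
  exact: segment_compact.
apply: subclosed_compact cK _; first exact: closed_closure.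
move=> y /cl[/= h1 h2]; split.
  move=> i; have := h1.2 ord0 i; rewrite /ball/= in_itv/= ltr_norml; lra.
by move: h2; rewrite /K2 /ball/= in_itv/= ltr_norml; lra.
Qed.

Definition rat_point (c : 'rV[rat]_(n + n) * rat) : H :=
  (map_mx ratr c.1, ratr c.2).

Lemma rat_point_dense x (d : R) : 0 < d -> exists c, hdist (rat_point c) x < d.
Proof.
move=> d0; pose r := d / (n.*2.+2)%:R; have r0 : 0 < r by rewrite divr_gt0.
have h1 i : exists c : rat, ratr c \in `]x.1 ord0 i - r, x.1 ord0 i + r[.
  by apply: rat_in_itvoo; lra.
pose c1 : 'rV[rat]_(n + n) := \row_i xchoose (h1 i).
(* The last coordinate is chosen after the horizontal ones, near the centre of the sheared section
   over them. *)
pose m := x.2 + 2^-1 * symplectic x.1 (map_mx ratr c1).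
have [c2 hc2] : exists c : rat, ratr c \in `]m - r ^+ 2, m + r ^+ 2[.
  by apply: rat_in_itvoo; have := exprn_gt0 2 r0; lra.
exists (c1, c2); apply: (hbox_sub_hball d0); split.
  move=> i; rewrite /= !mxE; have := xchooseP (h1 i).
  by rewrite in_itv/= ltr_distl.
by move: hc2; rewrite hdistE2 in_itv/= /m ltr_norml -/r; lra.
Qed.

End heisenberg_topology.

(** * The continuous representative and its Hoelder estimate *)

Section holder_regularity.
Context {R : realType} {n : nat}.
Local Notation H := (heis R n).
Local Notation mu := (@lebesgue_heis R n).
Local Notation Q := (@hdim R n).
Implicit Types (E : set H) (x y z : H) (r e : R) (u v : H -> R).

Lemma ae_countable (I : countType) (P : I -> H -> Prop) :
  (forall i, {ae mu, forall x, P i x}) -> {ae mu, forall x, forall i, P i x}.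
Proof.
move=> h; have : {ae mu, forall x, forall k, if unpickle k is Some i then P i x else True}.
  by apply: ae_foralln => k; case: unpickle => [i|]; [exact: h|exact: aeW].
by apply: filterS => x hx i; have := hx (pickle i); rewrite pickleK.
Qed.

(** The essential supremum and infimum bound [v] outside one null set, which thus serves all [lo]
    and [up] at once. *)
Lemma ae_ess_bounds E v : {ae mu, forall x, E x -> forall lo up : R,
  {ae mu, forall y, E y -> lo <= v y <= up} -> lo <= v x <= up}.
Proof.
apply: filterS2 (ess_sup_ge mu (patch (fun=> -oo%E) E (EFin \o v)))
  (ess_inf_le mu (patch (fun=> +oo%E) E (EFin \o v))) => x hs hi Ex lo up h.
apply/andP; split; rewrite -lee_fin.
  move: hi; rewrite /patch mem_set//; apply: le_trans.
  by apply/ess_inf_on_geP; apply: filterS h => y hy /hy /andP[].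
move: hs; rewrite /patch mem_set// => /le_trans; apply.
by apply/ess_sup_on_leP; apply: filterS h => y hy /hy /andP[].
Qed.

Definition ess_limsup v x : R :=
  inf [set up | exists2 r, 0 < r & {ae mu, forall y, hball x r y -> v y <= up}].

Lemma ess_limsup_itv v x r (lo up : R) : 0 < r ->
  {ae mu, forall y, hball x r y -> lo <= v y <= up} -> lo <= ess_limsup v x <= up.
Proof.
move=> r0 h; set A := [set up | exists2 r, 0 < r & {ae mu, forall y, hball x r y -> v y <= up}].
have Aup : A up by exists r => //; apply: filterS h => y hy /hy /andP[].
have lb : lbound A lo.
  move=> up' [r' r'0 h'].
  have m0 : 0 < Num.min r r' by rewrite lt_min r0.
  have [y By [y1 y2]] := ae_hball x m0 (filterI h h').
  move: By; rewrite /hball/= lt_min => /andP[b1 b2].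
  have /andP[lv _] := y1 b1; exact: le_trans lv (y2 b2).
apply/andP; split; first by apply: lb_le_inf => //; exists up.
by apply: ge_inf => //; exists lo.
Qed.

Definition oscillation_bounded alpha v (x : H) (r M : R) := forall d : R, 0 < d <= r ->
  exists lo up : R, up - lo <= M * d `^ alpha /\
  {ae mu, forall y, hball x d y -> lo <= v y <= up}.

Lemma oscillation_bounded_le alpha v x (r r' M M' : R) : r' <= r -> M <= M' ->
  oscillation_bounded alpha v x r M -> oscillation_bounded alpha v x r' M'.
Proof.
move=> rr MM h d /andP[d0 dr]; have [|lo [up [ul hv]]] := h d.
  by rewrite d0 (le_trans dr).
exists lo, up; split => //; apply: le_trans ul _.
by rewrite ler_wpM2r// powR_ge0.
Qed.

Lemma ess_limsup_close alpha v x y (r M d : R) : 0 < d <= r -> hdist y x < d ->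
  oscillation_bounded alpha v x r M ->
  `|ess_limsup v x - ess_limsup v y| <= M * d `^ alpha.
Proof.
move=> dr yx /(_ d dr)[lo [up [ul h]]]; have /andP[d0 _] := dr.
have hx := ess_limsup_itv d0 h.
have e0 : 0 < d - hdist y x by lra.
have hy : lo <= ess_limsup v y <= up.
  apply: (ess_limsup_itv e0); apply: filterS h => z hz /= Bz; apply: hz.
  by rewrite /hball/=; have := hdistD z y x; move: Bz; rewrite /hball/=; lra.
apply: le_trans ul; rewrite ler_norml.
by move: (ess_limsup v x) (ess_limsup v y) hx hy => a b; clear; lra.
Qed.

(** Balls with rational centres and radii are countably many, so one null set suffices. A point of
    [Omega] outside it lies in such balls of arbitrarily small radius, where [v x] and
    [ess_limsup v x] belong to a common interval of small length. The rational centre differs from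
    [x], hence the oscillation bound is assumed at all centres near [x]. *)
Lemma ess_limsup_ae alpha v (Omega : set H) : 0 < alpha ->
  (forall x, Omega x -> exists r M, 0 < r /\
    forall z, hball x r z -> oscillation_bounded alpha v z r M) ->
  {ae mu, forall x, Omega x -> v x = ess_limsup v x}.
Proof.
move=> a0 dec.
have : {ae mu, forall x, forall i : ('rV[rat]_(n + n) * rat) * rat,
    hball (rat_point i.1) (ratr i.2) x -> forall lo up : R,
    {ae mu, forall y, hball (rat_point i.1) (ratr i.2) y -> lo <= v y <= up} ->
    lo <= v x <= up}.
  by apply: ae_countable => i; exact: ae_ess_bounds.
apply: filterS => x hx Ox; have [r [M [r0 hM]]] := dec x Ox.
apply/eqP; rewrite -subr_eq0 -normr_le0; apply/ler_addgt0Pr => e e0; rewrite add0r.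
pose K := `|M| + 1; have K0 : 0 < K by rewrite /K; have := normr_ge0 M; lra.
pose d0 := (e / K) `^ alpha^-1.
have d00 : 0 < d0 by rewrite powR_gt0// divr_gt0.
have d0E : K * d0 `^ alpha = e.
  by rewrite -powRrM mulVf ?gt_eqF// powRr1 ?divr_ge0 ?(ltW e0) ?(ltW K0)// mulrC divfK ?gt_eqF.
have [d d_gt0 dd] : exists2 d : R, 0 < d & d <= r /\ d <= d0.
  by exists (Num.min r d0); rewrite ?lt_min ?r0// ge_min lexx ge_min lexx orbT.
have [c hc] := @rat_point_dense R n x (d / 2) ltac:(lra).
have [k] := @rat_in_itvoo R (d / 2) d ltac:(lra).
rewrite in_itv/= => /andP[k1 k2].
have cr : hball x r (rat_point c) by rewrite /hball/=; lra.
have [|lo [up [ul h]]] := hM _ cr (ratr k); first by apply/andP; lra.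
have Bx : hball (rat_point c) (ratr k) x by rewrite /hball/= hdistC; lra.
have vx := hx (c, k) Bx lo up h.
have wx : lo <= ess_limsup v x <= up.
  apply: (@ess_limsup_itv _ _ (ratr k - hdist x (rat_point c))).
    by rewrite subr_gt0.
  apply: filterS h => z hz Bz; apply: hz.
  by have := hdistD z x (rat_point c); move: Bz; rewrite /hball/=; lra.
apply: (@le_trans _ _ (up - lo)); first by rewrite ler_norml; move: (ess_limsup v x) (v x) wx vx => a b; clear; lra.
apply: (le_trans ul); rewrite -d0E; apply: (@le_trans _ _ (K * ratr k `^ alpha)).
  by rewrite ler_wpM2r ?powR_ge0// /K; have := ler_norm M; lra.
rewrite ler_wpM2l ?(ltW K0)// ge0_ler_powR ?nnegrE ?(ltW a0)//;
  move: dd.2 k1 k2 d_gt0; clear -n; lra.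
Qed.

Lemma locally_hoelder_of_oscillation alpha v (Omega : set H) : 0 < alpha ->
  (forall x, Omega x -> exists r M, 0 < r /\
    forall z, hball x r z -> oscillation_bounded alpha v z r M) ->
  locally_hoelder alpha Omega v.
Proof.
move=> a0 dec; exists (ess_limsup v); first exact: ess_limsup_ae dec.
move=> K cK KO; have [w wE] : exists w, w = ess_limsup v by exists (ess_limsup v).
rewrite -wE.
(* Radius, constant and size of [w] are gathered into one index. Near each point of [K] the
   condition holds for all large [i], so compactness yields a single [i] for all of [K]. *)
pose P (i : nat) (x : H) := `|w x| <= i%:R /\
  oscillation_bounded alpha v x (i.+1%:R^-1) i%:R.
have near_P x : K x -> \forall y \near x & i \near \oo, P i y.
  move=> /KO/dec[r [M [r0 hM]]].
  pose B := `|w x| + `|M| * r `^ alpha + `|M| + r^-1.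
  have rp : 0 <= `|M| * r `^ alpha by rewrite mulr_ge0// powR_ge0.
  have ri : 0 < r^-1 by rewrite invr_gt0.
  have wx0 := normr_ge0 (w x); have M0 := normr_ge0 M.
  exists (hball x r, [set i | B <= i%:R]) => /=.
    by split; [exact: nbhs_hball|exact: nbhs_infty_ger].
  move=> [y i] /= [yx Bi]; split.
    have hx : hball x r x by rewrite /hball/= hdistxx.
    have := ess_limsup_close _ yx (hM x hx); rewrite r0 lexx => /(_ isT) c1.
    have c2 : `|w y| <= `|w x| + `|w x - w y|.
      by rewrite -[w y in leLHS](subKr (w x)); exact: ler_normB.
    have c3 : M * r `^ alpha <= `|M| * r `^ alpha by rewrite ler_wpM2r ?powR_ge0// ler_norm.
    by rewrite -wE in c1; rewrite /B in Bi; lra.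
  apply: oscillation_bounded_le (hM y yx).
    rewrite -[leRHS]invrK lef_pV2 ?posrE//.
    by rewrite -natr1; rewrite /B in Bi; lra.
  by have := ler_norm M; rewrite /B in Bi; lra.
have [i hi] : exists i, K `<=` P i.
  have [N _ h] := (compact_near_coveringP K).1 cK _ _ P _ near_P.
  by exists N; exact: h (leqnn N).
have i0 : 0 <= i%:R :> R by exact: ler0n.
pose j : R := i.+1%:R; have j0 : 0 < j by rewrite ltr0n.
exists (2 * i%:R * (2 * j) `^ alpha) => x y Kx Ky.
have [wx ox] := hi x Kx; have [wy _] := hi y Ky.
have [->|/eqP xy] := pselect (x = y).
  by rewrite subrr normr0 !mulr_ge0 ?powR_ge0.
have d0 : 0 < hdist x y.
  rewrite lt_neqAle hdist_ge0 andbT eq_sym; apply: contra xy => /eqP h.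
  by apply/eqP; exact: hdist_eq0.
rewrite -mulrA -powRM ?(mulr_ge0 _ (ltW j0)) ?(ltW d0)//.
(* Close pairs use the oscillation bound at radius [2 * hdist x y], doubled because balls are open.
   For far pairs the base [2 * j * hdist x y] exceeds 1, and the bound [2 * i] on the difference
   suffices. *)
have [near|far] := leP (2 * hdist x y) j^-1.
  apply: le_trans (_ : i%:R * (2 * hdist x y) `^ alpha <= _).
    rewrite wE; apply: ess_limsup_close ox; first by apply/andP; split => //; lra.
    by rewrite hdistC; lra.
  apply: ler_pM => //; rewrite ?powR_ge0//; first lra.
  rewrite ge0_ler_powR ?nnegrE ?(ltW a0)//; first lra.
    by rewrite !mulr_ge0// ltW.
  have j1 : 1 <= j by rewrite ler1n.
  have : 0 <= (j - 1) * hdist x y by rewrite mulr_ge0 ?subr_ge0// ltW.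
  lra.
apply: le_trans (_ : 2 * i%:R <= _).
  by apply: le_trans (ler_normB _ _) _; lra.
rewrite ler_peMr ?mulr_ge0// -[leLHS](@powRr0 R (2 * j * hdist x y)).
rewrite ler_powR ?(ltW a0)//.
by move: far; rewrite -(ltr_pM2l j0) mulfV ?gt_eqF//; lra.
Qed.

End holder_regularity.

(** * Tail bounds uniform in the centre *)

Section uniform_tail.
Context {R : realType} {n : nat}.
Local Notation H := (heis R n).
Local Notation mu := (@lebesgue_heis R n).
Local Notation Q := (@hdim R n).

Lemma hnorm_hdist (x : H) : hnorm x = hdist x (0, 0).
Proof.
have e : hnorm x ^+ 4 = hdist x (0, 0) ^+ 4.
  rewrite !hnorm4 hdistE2/= subr0 (_ : symplectic 0 x.1 = 0); last first.
    by rewrite /symplectic big1// => i _; rewrite !mxE !mul0r subrr.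
  rewrite mulr0 subr0; congr (_ ^+ 2 + _).
  by rewrite oppr0 add0r.
by apply/eqP; rewrite -(@eqrXn2 _ 4)// ?hnorm_ge0 ?hdist_ge0// e.
Qed.

Lemma growth_scale (p q : R) : 1 < p -> forall K : R, exists2 D : R, 0 < D &
  forall g, growth_function p q g -> forall t c : R, 0 <= t -> 0 <= c <= K ->
    g (c * t) <= D * g t.
Proof.
move=> p1 K; have [D D1 hD] := growth_doubling q p1.
have [m Km] : exists m : nat, K <= 2 ^+ m.
  have [m hm] := @bernoulli_unbounded R 1 K ltr01.
  by exists m; apply: le_trans hm _; rewrite (_ : 1 + 1 = 2).
have D0 : 0 < D by lra.
exists (D ^+ m); first by rewrite exprn_gt0.
move=> g gg t c t0 /andP[c0 cK].
apply: (@le_trans _ _ (g (2 ^+ m * t))).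
  by rewrite (growth_homo gg) ?mulr_ge0// ler_wpM2r// (le_trans cK).
elim: {K Km cK} m => [|m IH]; first by rewrite !expr0 !mul1r.
rewrite !exprS -!mulrA; have h : 0 <= 2 ^+ m * t by rewrite mulr_ge0// exprn_ge0.
have [h1 _] := hD g gg _ h; apply: (le_trans h1).
by rewrite ler_wpM2l// ltW.
Qed.

(** At distance at least [r] from [z], [1 + hnorm x] is at most [(1 + L) * hdist x z], with [L] the
    same for all [z] near [x0]. [growth_scale] takes the factor out of [g], so the tail is at most a
    fixed multiple of the integral in [Lgs]. *)
Lemma tail_bounded (p q s : R) (g : R -> R) (v : H -> R) x0 (r : R) :
  1 < p -> 0 < s -> growth_function p q g -> measurable_fun setT v -> 0 < r ->
  (\int[mu]_x (g (`|v x| / (1 + hnorm x) `^ s)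
                / (1 + hnorm x) `^ (Q + s))%:E < +oo)%E ->
  exists2 t : R, 0 <= t & forall z, hdist z x0 < r -> (tail s g v z r <= t%:E)%E.
Proof.
move=> p1 s0 gg mv r0.
pose F x := g (`|v x| / (1 + hnorm x) `^ s) / (1 + hnorm x) `^ (Q + s).
have F0 x : 0 <= F x.
  by rewrite divr_ge0 ?powR_ge0// (growth_ge0 gg)// divr_ge0 ?powR_ge0.
have mF : measurable_fun setT (fun x => (F x)%:E).
  have mn : measurable_fun setT (fun x : H => 1 + hnorm x).
    under eq_fun do rewrite hnorm_hdist.
    by apply: measurable_funD => //; apply: measurable_hdist => //; exact: measurable_id.
  apply/measurable_EFinP; apply: measurable_funM.
    apply: (measurable_growth gg).
      by move=> x; rewrite divr_ge0 ?powR_ge0.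
    apply: measurable_funM; first exact: measurableT_comp.
    exact: measurable_inv_powR.
  exact: measurable_inv_powR.
rewrite -[X in (X < _)%E -> _]/(\int[mu]_x (F x)%:E)%E => Ffin.
have I0 : (0 <= \int[mu]_x (F x)%:E)%E by apply: integral_ge0 => x _; rewrite lee_fin.
have n0 := hnorm_ge0 x0.
have [L L0 Lr] : exists2 L : R, 0 <= L & L * r = 1 + r + hnorm x0.
  exists ((1 + r + hnorm x0) / r); last by rewrite divfK ?gt_eqF.
  by rewrite divr_ge0 ?(ltW r0)//; lra.
have [D D0 hD] := @growth_scale p q p1 ((1 + L) `^ s).
pose c := D * (1 + L) `^ (Q + s).
have c0 : 0 <= c by rewrite mulr_ge0 ?powR_ge0// ltW.
exists (c * fine (\int[mu]_x (F x)%:E)); first by rewrite mulr_ge0// fine_ge0.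
move=> z zx0; rewrite EFinM fineK ?ge0_fin_numE// -ge0_integralZl_EFin//; last first.
  by move=> x _; rewrite lee_fin.
rewrite /tail [leLHS]integral_mkcond; apply: ae_le_integral.
- move=> x _; rewrite patchE; case: ifPn => // _.
  by rewrite lee_fin divr_ge0 ?powR_ge0// (growth_ge0 gg)// divr_ge0 ?powR_ge0.
- by move=> x _; rewrite -EFinM lee_fin mulr_ge0.
apply: aeW => x _; rewrite patchE; case: ifPn => [|_]; last by rewrite -EFinM lee_fin mulr_ge0.
rewrite inE /= => /negP; rewrite -leNgt => rd.
have d0 : 0 < hdist x z by exact: lt_le_trans rd.
have nx := hnorm_ge0 x.
have N1 : 0 < 1 + hnorm x by lra.
have Nd : 1 + hnorm x <= (1 + L) * hdist x z.
  have h1 := hdistD x z (0, 0); have h2 := hdistD z x0 (0, 0).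
  rewrite -!hnorm_hdist in h1 h2.
  have h3 : 1 + r + hnorm x0 <= L * hdist x z.
    by rewrite -Lr ler_wpM2l.
  by lra.
have L1 : 0 <= 1 + L by lra.
have Nds (a : R) : 0 <= a -> (1 + hnorm x) `^ a <= (1 + L) `^ a * hdist x z `^ a.
  by move=> a0; rewrite -(powRM _ L1 (ltW d0)); exact: le_powR a0 (ltW N1) Nd.
have ds0 (a : R) : 0 < hdist x z `^ a by rewrite powR_gt0.
have Ns0 (a : R) : 0 < (1 + hnorm x) `^ a by rewrite powR_gt0.
have hg : g (`|v x| / hdist x z `^ s) <= D * g (`|v x| / (1 + hnorm x) `^ s).
  have -> : `|v x| / hdist x z `^ s =
      ((1 + hnorm x) `^ s / hdist x z `^ s) * (`|v x| / (1 + hnorm x) `^ s).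
    by field; rewrite !gt_eqF.
  apply: (hD g gg); first by rewrite divr_ge0// ltW.
  by rewrite divr_ge0 ?powR_ge0//= ler_pdivrMr// Nds// ltW.
rewrite -EFinM lee_fin /F /c.
have Qs : 0 <= Q + s by rewrite addr_ge0 ?ltW// hdim_gt0.
rewrite ler_pdivrMr//; apply: (le_trans hg).
have G0 : 0 <= D * g (`|v x| / (1 + hnorm x) `^ s).
  by rewrite mulr_ge0 ?(ltW D0)// (growth_ge0 gg)// divr_ge0 ?powR_ge0.
rewrite (_ : D * _ * _ * _ = (D * g (`|v x| / (1 + hnorm x) `^ s)) *
  ((1 + L) `^ (Q + s) * hdist x z `^ (Q + s) / (1 + hnorm x) `^ (Q + s))); last first.
  by field; rewrite gt_eqF.
by rewrite ler_peMr// ler_pdivlMr// mul1r Nds.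
Qed.

(** The decay estimate is applied at every centre of a ball of half the radius, with bounds on [v]
    and on the tail common to all of them; [r] and [M] are therefore the same for all these
    centres. *)
Lemma weak_solution_oscillation (p q s alpha C : R) (g : R -> R) (Omega : set H)
    (u v : H -> R) :
  1 < p -> 0 < s -> 0 < alpha -> 0 < C -> growth_function p q g ->
  open Omega -> Lgs s g u -> locally_bounded Omega u ->
  measurable_fun setT v -> {ae mu, forall x, u x = v x} ->
  (forall x0 (rho S t eps : R), 0 < rho -> compactly_contained (hball x0 rho) Omega ->
    0 <= S -> 0 <= t -> 0 < eps ->
    {ae mu, forall x, hball x0 rho x -> `|v x| <= S} ->
    (tail s g v x0 rho <= t%:E)%E -> forall r : R, 0 < r <= rho ->
    exists lo up : R, up - lo <= C * (r / rho) `^ alpha *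
      (S + rho `^ s * growth_inv g (rho `^ s * t) + eps) /\
    {ae mu, forall x, hball x0 r x -> lo <= v x <= up}) ->
  forall x, Omega x -> exists r M, 0 < r /\
    forall z, hball x r z -> oscillation_bounded alpha v z r M.
Proof.
move=> p1 s0 a0 C0 gg oO [_ Lu] lb mv uv decay x Ox.
have [r' r'0 cc] := compactly_contained_hball oO Ox.
have [r r0 rE] : exists2 r : R, 0 < r & r' = r + r by exists (r' / 2); lra.
have sub z : hball x r z -> hball z r `<=` hball x r'.
  by move=> zx y; have := hdistD y z x; move: zx rE; rewrite /hball/=; lra.
have [M0 uM0] := lb _ cc.1 cc.2.
have vS : {ae mu, forall y, hball x r' y -> `|v y| <= `|M0|}.
  apply: filterS2 uv uM0 => y <- h By; apply: le_trans (ler_norm _).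
  by apply: h; exact: subset_closure.
have Lv : (\int[mu]_x (g (`|v x| / (1 + hnorm x) `^ s)
                / (1 + hnorm x) `^ (Q + s))%:E < +oo)%E.
  apply: le_lt_trans Lu; rewrite le_eqVlt; apply/orP; left; apply/eqP.
  by apply: ae_eq_integral_gen; apply: filterS uv => y ->.
have [t t0 ht] := tail_bounded x p1 s0 gg mv r0 Lv.
exists r, (C * r `^ (- alpha) * (`|M0| + r `^ s * growth_inv g (r `^ s * t) + 1)).
split => // z zx d dr; have /andP[d0 dr'] := dr.
have [||lo [up [ul h]]] := decay z r `|M0| t 1 r0 _ (normr_ge0 _) t0 ltr01 _ (ht z zx) d dr.
- exact: compactly_contained_sub (sub z zx) cc.
- by apply: filterS vS => y hy /(sub z zx); exact: hy.
exists lo, up; split => //; apply: (le_trans ul).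
rewrite powRM ?invr_ge0 ?(ltW d0) ?(ltW r0)// -powR_inv1 ?(ltW r0)// -powRrM mulN1r.
by rewrite le_eqVlt; apply/orP; left; apply/eqP; ring.
Qed.

End uniform_tail.

Theorem theorem1p2 (R : realType) (n : nat) (p q s : R) :
  (1 <= n)%N -> 1 < p -> 0 < s < 1 ->
  exists alpha C : R, [/\ 0 < alpha < 1, 1 < C &
    forall (g : R -> R) (Omega : set (heis R n)) (u : heis R n -> R),
      growth_function p q g ->
      bounded_domain Omega ->
      Lgs s g u ->
      weak_solution s g Omega u ->
      locally_bounded Omega u ->
      locally_hoelder alpha Omega u /\
      forall (xi0 : heis R n) (rho : R), 0 < rho ->
        compactly_contained (hball xi0 rho) Omega ->
        forall r : R, 0 < r <= rho ->
          (ess_osc (hball xi0 r) u <=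
           (C * (r / rho) `^ alpha)%:E *
           (ess_sup_on (hball xi0 rho) (fun xi => `|u xi|%R) +
            (rho `^ s)%:E *
            er_map (growth_inv g) ((rho `^ s)%:E * tail s g u xi0 rho)))%E].
Proof.
move=> _ p1 s01; have [alpha [C [a01 C1 decay]]] := @weak_solution_decay R n p q s p1 s01.
exists alpha, C; split => // g Omega u gg [_ oO _ _] Lu wu lb.
have [[[v mv uv] _ _] _] := wu.
have C0 : 0 < C by lra.
have /andP[a0 _] := a01; have /andP[s0 _] := s01.
have dec := fun x0 rho S t eps => decay g Omega u v x0 rho S t eps gg wu mv uv.
split.
  have := locally_hoelder_of_oscillation a0
    (weak_solution_oscillation p1 s0 a0 C0 gg oO Lu lb mv uv dec).
  by case=> w vw hw; exists w => //; apply: filterS2 uv vw => x ->.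
move=> xi0 rho rho0 cc r rrho.
apply: (oscillation_estimate (v := v) C0 gg rho0 rrho cc lb uv) => S t eps S0 t0 e0 vS ht.
exact: (dec xi0 rho S t eps rho0 cc S0 t0 e0 vS ht r rrho).
Qed.
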